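(* There exists an absolute constant $\mathcal{Q}>0$ such that the following is true. Let $\mathbf{K}$ be a field with odd characteristic. Let $E$ be an elliptic curve over $\mathbf{K}$, given by a Weierstrass equation. Let $\delta\geqslant 1$ be an integer. Let $t$ be a point of order $d=2^\delta$ in $E(\mathbf{K})$. Let $b$ be a point on $E$ defined over a separable extension of $\mathbf{K}$. Assume $db\neq O$. Let $$B=b+\langle t\rangle=\{b,\,b+t,\,b+2t,\,\ldots,\,b+(d-1)t\}.$$ Assume that $B$ is left invariant by the absolute Galois group of $\mathbf{K}$, so that $B$ is a reduced $\mathbf{K}$-subscheme of $E$ of dimension $0$ and degree $d$. For $l\in\mathbf{Z}/d\mathbf{Z}$ let $x_l=x\circ\tau_{-lt}$. There exists a straight-line program that, on input $d$ scalars $(F_l)_{0\leqslant l\leqslant d-1}$ in $\mathbf{K}$, computes $d$ scalars $(f_l)_{0\leqslant l\leqslant d-1}$ in $\mathbf{K}$ such that the functions $$F=\sum_{l\in\mathbf{Z}/d\mathbf{Z}}F_l\,x_l\qquad\text{and}\qquad f=\sum_{l\in\mathbf{Z}/d\mathbf{Z}}f_l\,u_l$$ are congruent modulo $B$, meaning that $f(b+lt)=F(b+lt)$ for every integer $l\in[0,d-1]$. This straight-line program consists of no more than $\mathcal{Q}\,d\log(d)$ operations in $\mathbf{K}$.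
   Context: **Curve and functions.** $E$ is given by $Y^2Z+a_1XYZ+a_3YZ^2=X^3+a_2X^2Z+a_4XZ^2+a_6Z^3$ over $\mathbf{K}$, with $O=(0:1:0)$ the point at infinity (the neutral element), and $x=X/Z$, $y=Y/Z$. For a point $A$ on $E$, $\tau_A$ denotes the translation by $A$, and $x_A=x\circ\tau_{-A}$, $y_A=y\circ\tau_{-A}$. For two distinct points $A,B$ on $E$, $$u_{A,B}=\frac{y_A-y(A-B)}{x_A-x(A-B)},$$ a function on $E$ with polar divisor $[A]+[B]$. **The functions $u_l$.** $\langle t\rangle$ is the group generated by $t$, also seen as the effective divisor $\sum_{0\leqslant l\leqslant d-1}[lt]$ on $E$. The sum $\mathfrak{a}=\sum_{l\in\mathbf{Z}/d\mathbf{Z}}u_{lt,(l+1)t}$ is a constant in $\mathbf{K}$. For $l\in\mathbf{Z}/d\mathbf{Z}$ set $u_l=u_{lt,(l+1)t}+(1-\mathfrak{a})/d$. The family $(u_l)_{l\in\mathbf{Z}/d\mathbf{Z}}$ is a basis of the $\mathbf{K}$-linear (Riemann–Roch) space $\mathcal{L}(\langle t\rangle)$. **Straight-line programs.** A straight-line program over $\mathbf{K}$ is a finite sequence of operations, without loops or conditionals, involving the inputs, precomputed constants in $\mathbf{K}$ (which may depend on $\mathbf{K},E,t,b$ but not on the input), and previously computed elements; here the operations are additions and multiplications by precomputed constants in $\mathbf{K}$. Its complexity is the number of operations. Precomputation of constants is not counted. *)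

(* Defs.v *)
From mathcomp Require Import all_boot all_order all_algebra separable.
From mathcomp Require Import exp.

Set Implicit Arguments.
Unset Strict Implicit.
Unset Printing Implicit Defensive.

Import Order.TTheory GRing.Theory Num.Theory.
Local Open Scope ring_scope.

(* Y^2 Z + a1 XYZ + a3 YZ^2 = X^3 + a2 X^2 Z + a4 XZ^2 + a6 Z^3 *)
Record weierstrass (R : Type) := Weierstrass {
  wa1 : R; wa2 : R; wa3 : R; wa4 : R; wa6 : R }.

Definition map_weierstrass (R S : Type) (f : R -> S) (W : weierstrass R) :
    weierstrass S :=
  Weierstrass (f (wa1 W)) (f (wa2 W)) (f (wa3 W)) (f (wa4 W)) (f (wa6 W)).

(* [Some (x, y)] is the point (x : y : 1); [None] is O = (0 : 1 : 0), the only
   point of a Weierstrass curve on the line Z = 0. *)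
Definition point (R : Type) := option (R * R).

Definition map_point (R S : Type) (f : R -> S) : point R -> point S :=
  omap (fun q => (f q.1, f q.2)).

Section Curve.
Variables (F : fieldType) (W : weierstrass F).
Local Notation a1 := (wa1 W).
Local Notation a2 := (wa2 W).
Local Notation a3 := (wa3 W).
Local Notation a4 := (wa4 W).
Local Notation a6 := (wa6 W).

Definition discriminant : F :=
  let b2 := a1 ^+ 2 + 4%:R * a2 in
  let b4 := 2%:R * a4 + a1 * a3 in
  let b6 := a3 ^+ 2 + 4%:R * a6 in
  let b8 := a1 ^+ 2 * a6 + 4%:R * a2 * a6 - a1 * a3 * a4
            + a2 * a3 ^+ 2 - a4 ^+ 2 in
  - b2 ^+ 2 * b8 - 8%:R * b4 ^+ 3 - 27%:R * b6 ^+ 2 + 9%:R * b2 * b4 * b6.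

Definition elliptic : Prop := discriminant != 0.

Definition on_curve (P : point F) : bool :=
  if P is Some (x, y) then
    y ^+ 2 + a1 * x * y + a3 * y == x ^+ 3 + a2 * x ^+ 2 + a4 * x + a6
  else true.

Definition opp_point (P : point F) : point F :=
  if P is Some (x, y) then Some (x, - y - a1 * x - a3) else None.

(* Chord-and-tangent law. *)
Definition add_point (P Q : point F) : point F :=
  match P, Q with
  | None, _ => Q
  | _, None => P
  | Some (x1, y1), Some (x2, y2) =>
      if (x1 == x2) && (y2 == - y1 - a1 * x1 - a3) then None
      else
        let s := if x1 == x2
                 then (3%:R * x1 ^+ 2 + 2%:R * a2 * x1 + a4 - a1 * y1)
                      / (2%:R * y1 + a1 * x1 + a3)
                 else (y2 - y1) / (x2 - x1) in
        let x3 := s ^+ 2 + a1 * s - a2 - x1 - x2 in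
        Some (x3, s * (x1 - x3) - y1 - a1 * x3 - a3)
  end.

Definition sub_point (P Q : point F) : point F := add_point P (opp_point Q).

Definition mul_point (n : nat) (P : point F) : point F :=
  iter n (add_point P) None.

Definition has_order (P : point F) (d : nat) : Prop :=
  [/\ (0 < d)%N, mul_point d P = None
    & forall k : nat, (0 < k < d)%N -> mul_point k P <> None].

(* <t>, for t of order d *)
Definition multiples (t : point F) (d : nat) : seq (point F) :=
  [seq mul_point l t | l <- iota 0 d].

(* b + <t>, for t of order d *)
Definition translate (b t : point F) (d : nat) : seq (point F) :=
  [seq add_point b (mul_point l t) | l <- iota 0 d].

(* A function on E is given by its values at the points of E, which are only
   meaningful away from its poles (the junk value 0 is used at O for x, y). *)
Definition xfun (P : point F) : F := if P is Some (x, _) then x else 0.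
Definition yfun (P : point F) : F := if P is Some (_, y) then y else 0.

(* x_A = x \o tau_{-A}, y_A = y \o tau_{-A} *)
Definition xtr (A P : point F) : F := xfun (sub_point P A).
Definition ytr (A P : point F) : F := yfun (sub_point P A).

(* The denominator vanishes only at P = B, a pole, and at P = 2A - B.  For
   A = lt and B = (l+1)t, as well as at the pole P = A, such a P is in <t>;
   so the formula computes the value of u_{A,B} at every P outside <t>. *)
Definition ufun (A B P : point F) : F :=
  (ytr A P - yfun (sub_point A B)) / (xtr A P - xfun (sub_point A B)).

Definition xl (t : point F) (l : nat) : point F -> F := xtr (mul_point l t).

Definition ul0 (t : point F) (l : nat) : point F -> F :=
  ufun (mul_point l t) (mul_point l.+1 t).

(* The function \sum_(l in Z/dZ) u_{lt,(l+1)t} is the constant a. *)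
Definition sum_u_is (t : point F) (d : nat) (a : F) : Prop :=
  forall P : point F, on_curve P -> P \notin multiples t d ->
    \sum_(l < d) ul0 t l P = a.

Definition ul (t : point F) (d : nat) (a : F) (l : nat) (P : point F) : F :=
  ul0 t l P + (1 - a) / d%:R.

End Curve.

Definition separable_closure (K Ks : fieldType) (f : {rmorphism K -> Ks}) :
    Prop :=
  (forall z : Ks, exists2 p : {poly K},
     separable_poly p & root (map_poly f p) z) /\
  (forall p : {poly Ks}, separable_poly p -> (1 < size p)%N ->
     exists z : Ks, root p z).

(* Elements of the absolute Galois group Gal(Ks / K). *)
Definition galois_aut (K Ks : fieldType) (f : {rmorphism K -> Ks})
    (s : {rmorphism Ks -> Ks}) : Prop :=
  bijective s /\ forall c : K, s (f c) = f c.

Definition galois_invariant (K Ks : fieldType) (f : {rmorphism K -> Ks})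
    (B : seq (point Ks)) : Prop :=
  forall s : {rmorphism Ks -> Ks}, galois_aut f s ->
    [seq map_point s P | P <- B] =i B.

(* Registers 0, ..., n-1 of a program with n inputs hold the inputs; the k-th
   operation (from k = 0) writes its result in register n + k. *)
Inductive operand (K : Type) :=
  | Reg of nat
  | Cst of K.
Arguments Reg {K} _.

Inductive operation (K : Type) :=
  | SlpAdd of operand K & operand K
  | SlpScale of K & operand K.

Definition operand_ok (K : Type) (n : nat) (o : operand K) : bool :=
  if o is Reg i then (i < n)%N else true.

Definition operation_ok (K : Type) (n : nat) (op : operation K) : bool :=
  match op with
  | SlpAdd o1 o2 => operand_ok n o1 && operand_ok n o2
  | SlpScale _ o => operand_ok n o
  end.

Fixpoint code_ok (K : Type) (n : nat) (c : seq (operation K)) : bool :=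
  if c is op :: c' then operation_ok n op && code_ok n.+1 c' else true.

(* Straight-line programs over K with n inputs and m outputs. *)
Record slp (K : Type) (n m : nat) := Slp {
  slp_code : seq (operation K);
  slp_out : 'I_m -> operand K;
  slp_code_ok : code_ok n slp_code;
  slp_out_ok : forall j, operand_ok (n + size slp_code) (slp_out j) }.

Definition slp_complexity (K : Type) (n m : nat) (S : slp K n m) : nat :=
  size (slp_code S).

Section Eval.
Variable K : fieldType.

Definition operand_val (mem : seq K) (o : operand K) : K :=
  match o with Reg i => mem`_i | Cst c => c end.

Definition operation_val (mem : seq K) (op : operation K) : K :=
  match op with
  | SlpAdd o1 o2 => operand_val mem o1 + operand_val mem o2
  | SlpScale c o => c * operand_val mem o
  end.

Definition slp_eval (n m : nat) (S : slp K n m) (inputs : 'I_n -> K)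
    (j : 'I_m) : K :=
  let mem := foldl (fun mem op => rcons mem (operation_val mem op))
                   [seq inputs i | i <- enum 'I_n] (slp_code S) in
  operand_val mem (slp_out S j).

End Eval.

(* Main.v *)
(* Restricted to B, functions are d-periodic sequences: for P_k = b - k t,
   U(k) = u_0(P_k) and X(k) = x(P_k), one has u_l(P_k) = U(k + l) and
   x_l(P_k) = X(k + l), so that f is to be found with
   \sum_l f_l U(k + l) = \sum_l F_l X(k + l).
   A nonzero combination of the u_l that vanishes on B would force d b = O by
   Abel's theorem; hence f exists and is unique over the separable closure, and
   it is defined over K since it is fixed by the Galois group.
   To compute f, let d = 2 T and split f and F into their symmetric and
   antisymmetric parts under translation by T t.  The symmetric parts satisfy
   the same problem for U(k) + U(k + T) and X(k) + X(k + T), of size T.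
   The antisymmetric parts, multiplied by an antisymmetric function without zeros
   on B, become symmetric and reduce to the same problem of size T, up to
   O(d) operations.  Hence C(d) = 2 C(d / 2) + O(d) operations suffice.
   The folded problem is the one of the quotient of E by T t, but only the
   multiplication rules of the u_l are needed, and these rules are stable under
   folding; they come from the cocycle identity satisfied by the slope of the
   line through two points. *)

From HB Require Import structures.
From mathcomp Require Import classical_sets boolp.
Require Import Defs.
From mathcomp Require Import all_boot all_order all_algebra separable.
From mathcomp Require Import reals exp.
From mathcomp Require Import ring zify.

Set Implicit Arguments.
Unset Strict Implicit.
Unset Printing Implicit Defensive.

Import Order.TTheory GRing.Theory Num.Theory.
Local Open Scope ring_scope.

(** * The group law on a Weierstrass cubic *)

(** Let [z] be the sum of [u_0, ..., u_(T-1)] minus 1/2: it is the antisymmetric function without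
    zeros on B. The antisymmetric part is expanded in the shifts [z_m] of [z], because [z_0 z_m] for
    [m > 0] and [z_0 (x_l - x_(l+T))] for [0 < l < T] involve folded functions only. Two terms
    resist. The product [z_0 (x_0 - x_T)] has a pole of order three and leaves the folded space, so
    [F_0] is split off and [x_0 - x_T] is expanded once and for all in the [z_m]. And [z_0^2] brings
    in [x] instead of a partial sum of the [u_l], so that comparing coefficients yields the other
    coefficients only in terms of that of [z_0], which is computed as a linear form. Both
    corrections cost O(d). Abel's theorem is proved in the coordinate ring, for products of maximal
    ideals, by merging two zeros into their sum. Descent to K needs enough automorphisms of an
    extension that may be infinite; they come from partial morphisms by Zorn's lemma. *)

Section GroupLaw.
Variables (F : fieldType) (W : weierstrass F).
Local Notation a1 := (wa1 W).
Local Notation a2 := (wa2 W).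
Local Notation a3 := (wa3 W).
Local Notation a4 := (wa4 W).
Local Notation a6 := (wa6 W).

Implicit Types (p q r : F * F) (s t : F).

Definition on_affine p :=
  p.2 ^+ 2 + a1 * p.1 * p.2 + a3 * p.2 = p.1 ^+ 3 + a2 * p.1 ^+ 2 + a4 * p.1 + a6.

Definition opp_affine p := (p.1, - p.2 - a1 * p.1 - a3).

Definition slope p q : F :=
  if p.1 == q.1 then (3%:R * p.1 ^+ 2 + 2%:R * a2 * p.1 + a4 - a1 * p.2)
                     / (2%:R * p.2 + a1 * p.1 + a3)
  else (q.2 - p.2) / (q.1 - p.1).

Definition chord_third s p q : F := s ^+ 2 + a1 * s - a2 - p.1 - q.1.

Definition add_affine p q : F * F :=
  let s := slope p q in let x3 := chord_third s p q in
  (x3, s * (p.1 - x3) - p.2 - a1 * x3 - a3).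

Lemma add_pointE p q :
  add_point W (Some p) (Some q) =
  if q == opp_affine p then None else Some (add_affine p q).
Proof.
case: p q => [x1 y1] [x2 y2]; by rewrite /opp_affine xpair_eqE /= [x2 == x1]eq_sym.
Qed.

(* [s] is the slope of the line through [p] and [q], tangent if [p = q]; the
   second equation is that of the difference of the two curve equations,
   divided by [q.1 - p.1]. *)
Definition is_slope p q s : Prop :=
  q.2 = p.2 + s * (q.1 - p.1) /\
  s * (p.2 + q.2 + a1 * q.1 + a3) + a1 * p.2 =
    q.1 ^+ 2 + p.1 * q.1 + p.1 ^+ 2 + a2 * (p.1 + q.1) + a4.

Lemma on_affine_same_x p q : on_affine p -> on_affine q -> p.1 = q.1 ->
  q = p \/ q = opp_affine p.
Proof.
case: p q => [x1 y1] [x2 y2]; rewrite /on_affine /opp_affine /= => e1 e2 ?; subst x2.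
have: (y2 - y1) * (y2 - (- y1 - a1 * x1 - a3)) = 0.
  by transitivity (y2 ^+ 2 + a1 * x1 * y2 + a3 * y2 - (y1 ^+ 2 + a1 * x1 * y1 + a3 * y1));
    [ring | rewrite e1 e2 subrr].
by move/eqP; rewrite mulf_eq0 => /orP[] /eqP/subr0_eq ->; [left|right].
Qed.

Lemma slopeP p q : on_affine p -> on_affine q -> q <> opp_affine p ->
  is_slope p q (slope p q).
Proof.
move=> ep eq nq; rewrite /slope; case: eqP => [exy|/eqP nx].
  have [?|//] := on_affine_same_x ep eq exy; subst q.
  have v0 : 2%:R * p.2 + a1 * p.1 + a3 != 0.
    apply/eqP => v0; apply: nq; rewrite /opp_affine; case: p v0 {ep eq exy} => x y /= v0.
    by congr (_, _); rewrite -[y in LHS]subr0 -v0; ring.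
  split; first by rewrite subrr mulr0 addr0.
  set N := (X in X / _).
  have -> : p.2 + p.2 + a1 * p.1 + a3 = 2%:R * p.2 + a1 * p.1 + a3 by ring.
  by rewrite divfK // /N; ring.
have h0 : q.1 - p.1 != 0 by rewrite subr_eq0 eq_sym.
set s := _ / _; have sE : q.2 = p.2 + s * (q.1 - p.1) by rewrite divfK // addrC subrK.
split=> //; apply: (mulfI h0); apply/eqP; rewrite -subr_eq0; apply/eqP.
transitivity ((q.2 ^+ 2 + a1 * q.1 * q.2 + a3 * q.2 - (p.2 ^+ 2 + a1 * p.1 * p.2 + a3 * p.2))
  - (q.1 ^+ 3 + a2 * q.1 ^+ 2 + a4 * q.1 + a6 - (p.1 ^+ 3 + a2 * p.1 ^+ 2 + a4 * p.1 + a6))).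
  by rewrite sE; ring.
by rewrite ep eq subrr.
Qed.

(** The first equation determines [s] when the abscissas differ; when [p = q] the second one does,
    because the tangent is not vertical. Slopes are identified below by checking [is_slope]. *)
Lemma is_slope_uniq p q s t : on_affine p -> on_affine q -> q <> opp_affine p ->
  is_slope p q s -> is_slope p q t -> s = t.
Proof.
move=> ep eq nq [s1 s2] [t1 t2].
have [exy|/eqP nx] := eqVneq p.1 q.1.
  have [?|//] := on_affine_same_x ep eq exy; subst q.
  have v0 : p.2 + p.2 + a1 * p.1 + a3 != 0.
    apply/eqP => v0; apply: nq; rewrite /opp_affine; case: p v0 {ep eq exy s1 s2 t1 t2} => x y /= v0.
    by congr (_, _); rewrite -[y in LHS]subr0 -v0; ring.
  by apply: (mulIf v0); apply: (addIr (a1 * p.2)); rewrite s2 t2.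
have h0 : q.1 - p.1 != 0 by rewrite subr_eq0 eq_sym; apply/eqP.
by apply: (mulIf h0); apply: (addrI p.2); rewrite -s1 -t1.
Qed.

Lemma is_slope_sym p q s : is_slope p q s -> is_slope q p s.
Proof.
move=> [s1 s2]; split; first by rewrite s1; ring.
apply/eqP; rewrite -subr_eq0; apply/eqP.
move/eqP: s2; rewrite -subr_eq0 => /eqP <-; rewrite s1; ring.
Qed.

Lemma opp_affineK p : opp_affine (opp_affine p) = p.
Proof. by case: p => x y; rewrite /opp_affine /=; congr (_, _); ring. Qed.

Lemma on_affine_opp p : on_affine p -> on_affine (opp_affine p).
Proof. by rewrite /on_affine /opp_affine /= => <-; ring. Qed.

Lemma slopeC p q : on_affine p -> on_affine q -> q <> opp_affine p ->
  slope p q = slope q p.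
Proof.
move=> ep eq nq.
have nq' : p <> opp_affine q by move=> e; apply: nq; rewrite e opp_affineK.
by apply: (is_slope_uniq ep eq nq); [|apply: is_slope_sym]; apply: slopeP.
Qed.

(* The line of slope [s] through [p] and [q] meets the curve at [p], [q] and a
   third point. *)
Lemma chord_cubic p q s (X : F) : on_affine p -> is_slope p q s ->
  let L := p.2 + s * (X - p.1) in
  X ^+ 3 + a2 * X ^+ 2 + a4 * X + a6 - (L ^+ 2 + a1 * X * L + a3 * L) =
  (X - p.1) * (X - q.1) * (X - chord_third s p q).
Proof.
move=> ep [s1 s2] /=; rewrite /chord_third.
have -> : a6 = p.2 ^+ 2 + a1 * p.1 * p.2 + a3 * p.2 - (p.1 ^+ 3 + a2 * p.1 ^+ 2 + a4 * p.1).
  by rewrite ep; ring.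
have -> : a4 = s * (p.2 + q.2 + a1 * q.1 + a3) + a1 * p.2 -
   (q.1 ^+ 2 + p.1 * q.1 + p.1 ^+ 2 + a2 * (p.1 + q.1)) by rewrite s2; ring.
rewrite s1; ring.
Qed.

Lemma on_affine_add p q : on_affine p -> on_affine q -> q <> opp_affine p ->
  on_affine (add_affine p q).
Proof.
move=> ep eq nq; have sl := slopeP ep eq nq.
have := chord_cubic (chord_third (slope p q) p q) ep sl.
rewrite /= subrr mulr0 /on_affine /add_affine /=; set s := slope p q; set x3 := chord_third _ _ _.
move=> /eqP; rewrite subr_eq0 => /eqP ->; ring.
Qed.

Lemma add_affineC p q : on_affine p -> on_affine q -> q <> opp_affine p ->
  add_affine p q = add_affine q p.
Proof.
move=> ep eq nq; have [s1 _] := slopeP ep eq nq.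
rewrite /add_affine -(slopeC ep eq nq) /chord_third.
by congr (_, _); [|rewrite s1]; ring.
Qed.

Hypothesis Wsmooth : elliptic W.

(* Moving the point to the origin leaves the discriminant unchanged. *)
Lemma smooth_affine p : on_affine p ->
  2%:R * p.2 + a1 * p.1 + a3 = 0 ->
  3%:R * p.1 ^+ 2 + 2%:R * a2 * p.1 + a4 - a1 * p.2 = 0 -> False.
Proof.
case: p => x y /= ep vy vx.
have e3 : a3 = - (2%:R * y + a1 * x) by apply/eqP; rewrite -addr_eq0 -vy; apply/eqP; ring.
have e4 : a4 = - (3%:R * x ^+ 2 + 2%:R * a2 * x - a1 * y).
  by apply/eqP; rewrite -addr_eq0 -vx; apply/eqP; ring.
have e6 : a6 = y ^+ 2 + a1 * x * y + a3 * y - (x ^+ 3 + a2 * x ^+ 2 + a4 * x).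
  by move: ep; rewrite /on_affine /= => ->; ring.
move: Wsmooth; rewrite /elliptic /discriminant => /eqP; apply.
rewrite e6 e4 e3; ring.
Qed.

(** The reflection [opp_affine] sends a line of slope [s] to one of slope [- s - a1], and the mirror
    image of the line through [p] and [q] passes through [opp_affine q] and the sum. *)
Lemma is_slope_add_opp p q s : is_slope p q s ->
  let x3 := chord_third s p q in
  is_slope (x3, s * (p.1 - x3) - p.2 - a1 * x3 - a3) (opp_affine q) (- s - a1).
Proof.
move=> [s1 s2] x3; split; rewrite /opp_affine /x3 /chord_third /= s1; first by ring.
have -> : a4 = s * (p.2 + q.2 + a1 * q.1 + a3) + a1 * p.2 -
   (q.1 ^+ 2 + p.1 * q.1 + p.1 ^+ 2 + a2 * (p.1 + q.1)) by rewrite s2; ring.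
rewrite s1; ring.
Qed.

(** This is where smoothness enters. If [p + q = q], the two expressions of the ordinate of [q] make
    the y-derivative of the equation vanish at [q], and the chord equations then make the
    x-derivative vanish too. *)
Lemma add_affine_neq p q : on_affine p -> on_affine q -> q <> opp_affine p ->
  opp_affine q <> opp_affine (add_affine p q).
Proof.
move=> ep eq nq /(congr1 opp_affine); rewrite !opp_affineK => eqr.
have sl := slopeP ep eq nq; have [s1 s2] := sl.
set s := slope p q in sl s1 s2.
have x3E : chord_third s p q = q.1 by rewrite [in RHS]eqr.
have yE : q.2 = s * (p.1 - q.1) - p.2 - a1 * q.1 - a3.
  by rewrite [in LHS]eqr /= -/s x3E.
have vq : 2%:R * q.2 + a1 * q.1 + a3 = 0.
  have -> : 2%:R * q.2 = q.2 + q.2 by ring.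
  by rewrite {1}yE s1; ring.
have nx : p.1 - q.1 != 0.
  rewrite subr_eq0; apply/eqP => exy; apply: nq.
  have [e|//] := on_affine_same_x ep eq exy; subst q.
  rewrite /opp_affine; case: (p) vq => x y /= vq.
  by congr (_, _); rewrite -[y in LHS]subr0 -vq; ring.
apply: (smooth_affine eq vq).
have -> : 3%:R * q.1 ^+ 2 + 2%:R * a2 * q.1 + a4 - a1 * q.2 =
  s * (2%:R * q.2 + a1 * q.1 + a3) + (q.1 - p.1) * (q.1 - chord_third s p q).
  rewrite /chord_third.
  have -> : a4 = s * (p.2 + q.2 + a1 * q.1 + a3) + a1 * p.2 -
    (q.1 ^+ 2 + p.1 * q.1 + p.1 ^+ 2 + a2 * (p.1 + q.1)) by rewrite s2; ring.
  by rewrite s1; ring.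
by rewrite vq x3E; ring.
Qed.

Lemma slope_add_opp p q : on_affine p -> on_affine q -> q <> opp_affine p ->
  slope (add_affine p q) (opp_affine q) = - slope p q - a1.
Proof.
move=> ep eq nq; have er := on_affine_add ep eq nq.
have nr := add_affine_neq ep eq nq; have eq' := on_affine_opp eq.
by apply: (is_slope_uniq er eq' nr (slopeP er eq' nr)); apply/is_slope_add_opp/slopeP.
Qed.

Lemma add_affineK p q : on_affine p -> on_affine q -> q <> opp_affine p ->
  add_affine (add_affine p q) (opp_affine q) = p.
Proof.
move=> ep eq nq; rewrite [LHS]/add_affine (slope_add_opp ep eq nq).
have [s1 s2] := slopeP ep eq nq; move: s1 s2.
rewrite /add_affine; set s := slope p q => s1 s2; rewrite /chord_third /=.
by case: (p) s1 s2 => x y /= s1 s2; congr (_, _); ring.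
Qed.

(** Let [lr] be the ordinate at [r.1] of the line through [p] and [q]. The two factors on the left,
    times [x3 - r.1] and [r.1 - q.1], become [- (lr + r.2 + a1 r.1 + a3)] and [r.2 - lr], whose
    product is given by [chord_cubic] at [r.1]. When [x3 = r.1] or [r.1 = q.1] nothing can be
    cancelled, and the tangent equation is used instead. *)
Lemma slope_add3 p q r : on_affine p -> on_affine q -> on_affine r ->
  q <> opp_affine p -> r <> opp_affine q -> r <> opp_affine (add_affine p q) ->
  (slope (add_affine p q) r + slope p q + a1) * (slope q r - slope p q) = r.1 - p.1.
Proof.
move=> ep eq er npq nqr npqr.
have epq := on_affine_add ep eq npq.
have sl := slopeP ep eq npq; have [l1 l2] := sl.
have [m1 m2] := slopeP eq er nqr; have [n1 n2] := slopeP epq er npqr.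
move: l1 l2 m1 m2 n1 n2; set lam := slope p q; set mu := slope q r; set nu := slope _ r.
rewrite /add_affine /= -/lam; set x3 := chord_third _ _ _ => l1 l2 m1 m2 n1 n2.
have a4E : a4 = lam * (p.2 + q.2 + a1 * q.1 + a3) + a1 * p.2 -
    (q.1 ^+ 2 + p.1 * q.1 + p.1 ^+ 2 + a2 * (p.1 + q.1)) by rewrite l2; ring.
pose lr := p.2 + lam * (r.1 - p.1).
have cub := chord_cubic r.1 ep sl; rewrite -/lam -/lr -er -/x3 /= in cub.
have muE : (mu - lam) * (r.1 - q.1) = r.2 - lr by rewrite m1 /lr l1; ring.
have nuE : (nu + lam + a1) * (x3 - r.1) = - (lr + r.2 + a1 * r.1 + a3).
  by rewrite n1 /lr; ring.
have [x3r|x3r] := eqVneq x3 r.1.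
  have lrE : lr = - r.2 - a1 * r.1 - a3.
    apply/eqP; rewrite -subr_eq0 -[X in _ == X]oppr0 -(mulr0 (nu + lam + a1)).
    rewrite -(subrr x3) {2}x3r nuE opprK; apply/eqP; ring.
  have vr : 2%:R * r.2 + a1 * r.1 + a3 != 0.
    apply/eqP => vr; apply: npqr.
    have [e|//] := on_affine_same_x epq er x3r.
    rewrite -e; rewrite /opp_affine; case: (r) vr => x y /= vr.
    by congr (_, _); rewrite -[y in LHS]subr0 -vr; ring.
  have numul : (nu + lam + a1) * (2%:R * r.2 + a1 * r.1 + a3) = (r.1 - p.1) * (r.1 - q.1).
    have y3E : r.2 = lam * (p.1 - r.1) - p.2 - a1 * r.1 - a3.
      by transitivity (- lr - a1 * r.1 - a3); [rewrite lrE|rewrite /lr]; ring.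
    have n2' : nu * (2%:R * r.2 + a1 * r.1 + a3) = 3%:R * r.1 ^+ 2 + 2%:R * a2 * r.1 + a4 - a1 * r.2.
      move: n2; rewrite x3r -y3E => n2.
      apply: (addIr (a1 * r.2)); transitivity (nu * (r.2 + r.2 + a1 * r.1 + a3) + a1 * r.2); first by ring.
      rewrite n2; ring.
    have a2E : a2 = lam ^+ 2 + a1 * lam - p.1 - q.1 - r.1 by rewrite -x3r /x3 /chord_third; ring.
    by rewrite mulrDl mulrDl n2' a4E a2E y3E l1; ring.
  have muE' : (mu - lam) * (r.1 - q.1) = 2%:R * r.2 + a1 * r.1 + a3 by rewrite muE lrE; ring.
  have rq : r.1 - q.1 != 0 by apply: contra_neq vr => h; rewrite -muE' h mulr0.
  by apply: (mulIf rq); rewrite -mulrA muE' numul.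
have x3r' : x3 - r.1 != 0 by rewrite subr_eq0.
apply: (mulIf x3r').
rewrite mulrAC nuE.
have [rq|rq] := eqVneq r.1 q.1.
  have [e|//] := on_affine_same_x eq er (esym rq); subst r.
  have -> : lr = q.2 by rewrite /lr l1.
  have mE : mu * (2%:R * q.2 + a1 * q.1 + a3) = 3%:R * q.1 ^+ 2 + 2%:R * a2 * q.1 + a4 - a1 * q.2.
    apply: (addIr (a1 * q.2)); transitivity (mu * (q.2 + q.2 + a1 * q.1 + a3) + a1 * q.2); first by ring.
    rewrite m2; ring.
  transitivity (- (mu * (2%:R * q.2 + a1 * q.1 + a3) - lam * (2%:R * q.2 + a1 * q.1 + a3))); first by ring.
  by rewrite mE a4E /x3 /chord_third l1; ring.
have rq' : r.1 - q.1 != 0 by rewrite subr_eq0.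
apply: (mulIf rq').
transitivity (- (lr + r.2 + a1 * r.1 + a3) * ((mu - lam) * (r.1 - q.1))); first by ring.
rewrite muE.
transitivity (- (r.2 ^+ 2 + a1 * r.1 * r.2 + a3 * r.2 - (lr ^+ 2 + a1 * r.1 * lr + a3 * lr))); first by ring.
by rewrite cub; ring.
Qed.
Lemma opp_affine_neqC p q : q <> opp_affine p -> p <> opp_affine q.
Proof. by move=> nq e; apply: nq; rewrite e opp_affineK. Qed.

Lemma slope_opp p q : on_affine p -> on_affine q -> q <> opp_affine p ->
  slope (opp_affine p) (opp_affine q) = - slope p q - a1.
Proof.
move=> ep eq nq; have ep' := on_affine_opp ep; have eq' := on_affine_opp eq.
have nq' : opp_affine q <> opp_affine (opp_affine p).
  by move=> h; apply: nq; rewrite -[q]opp_affineK h opp_affineK.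
apply: (is_slope_uniq ep' eq' nq' (slopeP ep' eq' nq')).
have [s1 s2] := slopeP ep eq nq; split; rewrite /opp_affine /= s1; first by ring.
rewrite -s2 s1; ring.
Qed.

Lemma add_affine_opp p q : on_affine p -> on_affine q -> q <> opp_affine p ->
  add_affine (opp_affine p) (opp_affine q) = opp_affine (add_affine p q).
Proof.
move=> ep eq nq; rewrite [LHS]/add_affine (slope_opp ep eq nq).
by rewrite /add_affine /opp_affine /chord_third /=; congr (_, _); ring.
Qed.

(** Settles associativity when the sum of the three points is O, where the chord formulas do not
    apply. *)
Lemma add_affine_rot p q : on_affine p -> on_affine q -> q <> opp_affine p ->
  p = opp_affine (add_affine q (opp_affine (add_affine p q))).
Proof.
move=> ep eq nq; have er := on_affine_add ep eq nq.
have nr := add_affine_neq ep eq nq.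
have nr' : opp_affine (add_affine p q) <> opp_affine q by move=> h; apply: nr; rewrite h.
rewrite -(add_affine_opp eq (on_affine_opp er) nr') opp_affineK.
by rewrite -add_affineC ?add_affineK //; apply: on_affine_opp.
Qed.

(** Apply [slope_add3] to [(p, q, r)] and to [(r, q, p)] and cancel [slope q r - slope p q];
    associativity follows, as sums are polynomial in slopes and coordinates. If these two slopes
    agree, then [r.1 = p.1], and the cases [r = p] and [r = opp_affine p] are direct. *)
Lemma slope_cocycle_affine p q r : on_affine p -> on_affine q -> on_affine r ->
  q <> opp_affine p -> r <> opp_affine q -> r <> opp_affine (add_affine p q) ->
  p <> opp_affine (add_affine q r) ->
  slope (add_affine p q) r + slope p q = slope q r + slope p (add_affine q r) /\
  add_affine (add_affine p q) r = add_affine p (add_affine q r).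
Proof.
move=> ep eq er npq nqr npqr npqr'.
have epq := on_affine_add ep eq npq; have eqr := on_affine_add eq er nqr.
have nqp := opp_affine_neqC npq; have nrq := opp_affine_neqC nqr.
have cl := slope_add3 ep eq er npq nqr npqr.
have cl' : (slope p (add_affine q r) + slope q r + a1) * (slope q r - slope p q) = r.1 - p.1.
  rewrite add_affineC // in npqr'.
  have := slope_add3 er eq ep nrq nqp npqr'.
  rewrite -(slopeC eq er nqr) -(slopeC ep eq npq) -(add_affineC eq er nqr).
  rewrite (@slopeC (add_affine q r)) //; last by rewrite (add_affineC eq er nqr).
  by move=> h; rewrite -[RHS]opprB -h; ring.
have [mu|nmu] := eqVneq (slope q r) (slope p q); last first.
  have co : slope (add_affine p q) r + slope p q = slope q r + slope p (add_affine q r).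
    apply: (addIr a1); rewrite -subr_eq0 in nmu; apply: (mulIf nmu).
    by rewrite cl [slope q r + _]addrC cl'.
  split=> //.
  have [l1 _] := slopeP ep eq npq; have [m1 _] := slopeP eq er nqr.
  have [n1 _] := slopeP epq er npqr.
  have rhoE : slope p (add_affine q r) = slope (add_affine p q) r + slope p q - slope q r.
    by rewrite co addrC addKr.
  rewrite [LHS]/add_affine [RHS]/add_affine rhoE.
  move: nmu cl l1 m1 n1.
  set lam := slope p q; set mu := slope q r; set nu := slope _ r => nmu cl l1 m1 n1.
  move: n1; rewrite !/add_affine /= -!/lam -!/mu !/chord_third /= => n1.
  rewrite -subr_eq0 in nmu.
  have r1E : r.1 = (nu + lam + a1) * (mu - lam) + p.1 by rewrite cl subrK.
  congr (_, _); first by rewrite r1E; ring.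
  apply/eqP; rewrite -subr_eq0; apply/eqP.
  set x3 := lam ^+ 2 + a1 * lam - a2 - p.1 - q.1 in n1 *.
  have y3E : lam * (p.1 - x3) - p.2 - a1 * x3 - a3 =
    p.2 + lam * (q.1 - p.1) + mu * (r.1 - q.1) - nu * (r.1 - x3).
    by rewrite -l1 -m1 n1; ring.
  rewrite y3E r1E /x3; ring.
have rp : r.1 = p.1 by apply/eqP; rewrite -subr_eq0 -cl mu subrr mulr0.
have [e|e] := on_affine_same_x ep er (esym rp); subst r.
  by rewrite -(add_affineC ep eq npq) addrC (slopeC epq ep npqr) (add_affineC epq ep npqr) (slopeC ep eq npq).
have eop := on_affine_opp ep.
have h1 : slope (add_affine p q) (opp_affine p) = - slope p q - a1.
  by rewrite (add_affineC ep eq npq) (slopeC ep eq npq) slope_add_opp.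
have h2 : slope p (add_affine q (opp_affine p)) = - slope q (opp_affine p) - a1.
  rewrite slopeC //; last exact: opp_affine_neqC.
  by have := slope_add_opp eq eop nqr; rewrite opp_affineK.
split; first by rewrite h1 h2; ring.
rewrite (add_affineC ep eq npq) add_affineK //.
rewrite (@add_affineC p) //; last exact: opp_affine_neqC.
by have := add_affineK eq eop nqr; rewrite opp_affineK.
Qed.

Lemma on_curveP (P : point F) :
  reflect (if P is Some p then on_affine p else True) (on_curve W P).
Proof. by case: P => [[x y]|] /=; [exact: eqP | constructor]. Qed.

Lemma opp_pointE p : opp_point W (Some p) = Some (opp_affine p).
Proof. by case: p. Qed.

Lemma add_point0 (P : point F) : add_point W None P = P. Proof. by case: P. Qed.

Lemma add_pointO (P : point F) : add_point W P None = P. Proof. by case: P => [[]|]. Qed.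

Lemma on_curve_add (P Q : point F) :
  on_curve W P -> on_curve W Q -> on_curve W (add_point W P Q).
Proof.
case: P Q => [p|] [q|]; rewrite ?add_pointO ?add_point0 // => /on_curveP ep /on_curveP eq.
rewrite add_pointE; by case: eqP => // nq; apply/on_curveP; apply: on_affine_add.
Qed.

Lemma on_curve_opp (P : point F) : on_curve W P -> on_curve W (opp_point W P).
Proof. by case: P => [p|] // /on_curveP ep; rewrite opp_pointE; apply/on_curveP/on_affine_opp. Qed.

Lemma add_pointC (P Q : point F) : on_curve W P -> on_curve W Q ->
  add_point W P Q = add_point W Q P.
Proof.
case: P Q => [p|] [q|]; rewrite ?add_pointO ?add_point0 // => /on_curveP ep /on_curveP eq.
rewrite !add_pointE.
have [e|nq] := eqVneq q (opp_affine p); first by subst q; rewrite opp_affineK !eqxx.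
rewrite ifN; first by rewrite add_affineC //; apply/eqP.
by apply/eqP/opp_affine_neqC/eqP.
Qed.

Lemma add_pointN (P : point F) : add_point W (opp_point W P) P = None.
Proof. by case: P => // p; rewrite opp_pointE add_pointE opp_affineK eqxx. Qed.

Lemma add_pointA (P Q R : point F) : on_curve W P -> on_curve W Q -> on_curve W R ->
  add_point W P (add_point W Q R) = add_point W (add_point W P Q) R.
Proof.
case: P => [p|]; last by rewrite !add_point0.
case: Q => [q|]; last by rewrite add_pointO add_point0.
case: R => [r|]; last by rewrite !add_pointO.
move=> /on_curveP ep /on_curveP eq /on_curveP er.
rewrite (add_pointE p q) (add_pointE q r).
have [e|/eqP npq] := eqVneq q (opp_affine p).
  subst q; rewrite add_point0 opp_affineK.
  have [->|nrp] := eqVneq r p; first by rewrite add_pointO.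
  have nrp' : r <> opp_affine (opp_affine p) by rewrite opp_affineK; apply/eqP.
  rewrite (add_affineC eq er nrp') add_pointE.
  have nr := opp_affine_neqC nrp'.
  have := add_affine_neq er eq nr; have := add_affineK er eq nr.
  rewrite opp_affineK => rE nE; have er' := on_affine_add er eq nr.
  case: eqP => [h|h]; first by case: nE; rewrite h opp_affineK.
  by rewrite (add_affineC ep er' h) rE.
have [e|/eqP nqr] := eqVneq r (opp_affine q).
  subst r; rewrite add_pointE; have := add_affine_neq ep eq npq.
  by move/eqP/negPf ->; rewrite add_pointO add_affineK.
rewrite !add_pointE.
have [e|/eqP n1] := eqVneq r (opp_affine (add_affine p q)).
  have := add_affine_rot ep eq npq; rewrite -e => h.
  by rewrite ifT //; apply/eqP; rewrite [in RHS]h opp_affineK.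
have [e|/eqP n2] := eqVneq (add_affine q r) (opp_affine p).
  case: n1; rewrite -[LHS]opp_affineK; congr opp_affine.
  have nrq := opp_affine_neqC nqr.
  have := add_affine_rot er eq nrq; rewrite -(add_affineC eq er nqr) e opp_affineK => {1}->.
  by rewrite opp_affineK (add_affineC ep eq npq).
by have [_ ->] := slope_cocycle_affine ep eq er npq nqr n1 (opp_affine_neqC n2).
Qed.
End GroupLaw.

(** * The curve as an abelian group, and slopes on it *)

Section CurveGroup.
Variables (F : fieldType) (W : weierstrass F).

(** The proof of smoothness is a parameter of the type, so that inference of the group structure
    finds it. *)
Definition curve (smooth : elliptic W) := {P : option (F * F) | on_curve W P}.

Variable smooth : elliptic W.
Local Notation E := (curve smooth).

HB.instance Definition _ := [isSub of E for sval].
HB.instance Definition _ := [Choice of E by <:].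

Definition curve_zero : E := exist _ None isT.
Definition curve_opp (P : E) : E := exist _ (opp_point W (val P)) (on_curve_opp (valP P)).
Definition curve_add (P Q : E) : E :=
  exist _ (add_point W (val P) (val Q)) (on_curve_add (valP P) (valP Q)).

Fact curve_addA : associative curve_add.
Proof. by move=> P Q R; apply: val_inj; apply: add_pointA smooth _ _ _ _ _ _; apply: valP. Qed.
Fact curve_addC : commutative curve_add.
Proof. by move=> P Q; apply: val_inj; apply: add_pointC; apply: valP. Qed.
Fact curve_add0 : left_id curve_zero curve_add.
Proof. by move=> P; apply: val_inj; apply: add_point0. Qed.
Fact curve_addN : left_inverse curve_zero curve_opp curve_add.
Proof. by move=> P; apply: val_inj; apply: add_pointN. Qed.

HB.instance Definition _ :=
  GRing.isZmodule.Build E curve_addA curve_addC curve_add0 curve_addN.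

Implicit Types P Q R : E.

Lemma val_curveD P Q : val (P + Q) = add_point W (val P) (val Q). Proof. by []. Qed.
Lemma val_curveN P : val (- P) = opp_point W (val P). Proof. by []. Qed.

Lemma val_curveB P Q : val (P - Q) = sub_point W (val P) (val Q). Proof. by []. Qed.

Lemma val_curveMn P n : val (P *+ n) = mul_point W n (val P).
Proof. by elim: n => // n IHn; rewrite mulrS val_curveD IHn. Qed.

Definition xcoord P := xfun (val P).
Definition ycoord P := yfun (val P).

Lemma xcoordN P : xcoord (- P) = xcoord P.
Proof. by case: P => [[[x y]|]] . Qed.

Lemma ycoordN P : P != 0 -> ycoord (- P) = - ycoord P - wa1 W * xcoord P - wa3 W.
Proof. by case: P => [[[x y]|]]. Qed.

Definition cslope P Q : F := slope W (xcoord P, ycoord P) (xcoord Q, ycoord Q).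

Lemma curve_neq0 P : P != 0 ->
  val P = Some (xcoord P, ycoord P) /\ on_affine W (xcoord P, ycoord P).
Proof.
case: P => [[[x y]|]] // e; rewrite /xcoord /ycoord /=; split=> //.
exact: (on_curveP W (Some (x, y)) e).
Qed.

Lemma curve_opp_affine P Q : P != 0 -> Q != 0 -> P + Q != 0 ->
  (xcoord Q, ycoord Q) <> opp_affine W (xcoord P, ycoord P).
Proof.
move=> /curve_neq0 [vP _] /curve_neq0 [vQ _] /eqP nPQ e; apply: nPQ; apply: val_inj.
by rewrite val_curveD vP vQ add_pointE e eqxx.
Qed.

Lemma curve_add_affine P Q : P != 0 -> Q != 0 -> P + Q != 0 ->
  (xcoord (P + Q), ycoord (P + Q)) =
  add_affine W (xcoord P, ycoord P) (xcoord Q, ycoord Q).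
Proof.
move=> P0 Q0 PQ0; have /eqP/negPf nPQ := curve_opp_affine P0 Q0 PQ0.
have [vPQ _] := curve_neq0 PQ0; have [vP _] := curve_neq0 P0; have [vQ _] := curve_neq0 Q0.
apply: Some_inj; rewrite -vPQ val_curveD vP vQ add_pointE nPQ //.
Qed.

Lemma cslope_line P Q : P != 0 -> Q != 0 -> P + Q != 0 ->
  cslope P Q * (xcoord P - xcoord Q) = ycoord P - ycoord Q.
Proof.
move=> P0 Q0 PQ0; have [_ eP] := curve_neq0 P0; have [_ eQ] := curve_neq0 Q0.
have [/= e _] := slopeP eP eQ (curve_opp_affine P0 Q0 PQ0).
by rewrite e /cslope; ring.
Qed.

Lemma xcoordD P Q : P != 0 -> Q != 0 -> P + Q != 0 ->
  xcoord (P + Q) = cslope P Q ^+ 2 + wa1 W * cslope P Q - wa2 W - xcoord P - xcoord Q.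
Proof. by move=> P0 Q0 PQ0; have [-> _] := curve_add_affine P0 Q0 PQ0. Qed.

Lemma cslopeDN P Q : P != 0 -> Q != 0 -> P + Q != 0 ->
  cslope (P + Q) (- Q) = - cslope P Q - wa1 W.
Proof.
move=> P0 Q0 PQ0; have [_ eP] := curve_neq0 P0; have [_ eQ] := curve_neq0 Q0.
rewrite [LHS]/cslope curve_add_affine // xcoordN ycoordN //.
exact: (slope_add_opp smooth eP eQ (curve_opp_affine P0 Q0 PQ0)).
Qed.

Lemma cslope_cocycle P Q R : P != 0 -> Q != 0 -> R != 0 -> P + Q != 0 ->
  Q + R != 0 -> P + Q + R != 0 ->
  cslope (P + Q) R + cslope P Q = cslope Q R + cslope P (Q + R).
Proof.
move=> P0 Q0 R0 PQ0 QR0 PQR0.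
have [_ eP] := curve_neq0 P0; have [_ eQ] := curve_neq0 Q0; have [_ eR] := curve_neq0 R0.
have n1 := curve_opp_affine P0 Q0 PQ0; have n2 := curve_opp_affine Q0 R0 QR0.
have n3 := curve_opp_affine PQ0 R0 PQR0.
have PQR0' : Q + R + P != 0 by rewrite addrC addrA.
have n4 := curve_opp_affine QR0 P0 PQR0'.
rewrite curve_add_affine // in n3; rewrite curve_add_affine // in n4.
have [co _] := slope_cocycle_affine smooth eP eQ eR n1 n2 n3 n4.
by rewrite /cslope !curve_add_affine.
Qed.

Lemma cslope3 P Q R : P != 0 -> Q != 0 -> R != 0 -> P + Q != 0 ->
  Q + R != 0 -> P + Q + R != 0 ->
  (cslope (P + Q) R + cslope P Q + wa1 W) * (cslope Q R - cslope P Q) = xcoord R - xcoord P.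
Proof.
move=> P0 Q0 R0 PQ0 QR0 PQR0.
have [_ eP] := curve_neq0 P0; have [_ eQ] := curve_neq0 Q0; have [_ eR] := curve_neq0 R0.
have n1 := curve_opp_affine P0 Q0 PQ0; have n2 := curve_opp_affine Q0 R0 QR0.
have n3 := curve_opp_affine PQ0 R0 PQR0; rewrite curve_add_affine // in n3.
by have := slope_add3 eP eQ eR n1 n2 n3; rewrite /cslope curve_add_affine.
Qed.

Lemma xcoord_inj P Q : P != 0 -> Q != 0 -> xcoord P = xcoord Q -> Q = P \/ Q = - P.
Proof.
move=> P0 Q0 exy; have [vP eP] := curve_neq0 P0; have [vQ eQ] := curve_neq0 Q0.
have [e|e] := on_affine_same_x eP eQ exy; [left|right]; apply: val_inj.
  by rewrite vQ e.
by rewrite vQ e val_curveN vP opp_pointE.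
Qed.

Lemma two_torsion P : P != 0 ->
  (P + P == 0) = (2%:R * ycoord P + wa1 W * xcoord P + wa3 W == 0).
Proof.
move=> P0; have [vP eP] := curve_neq0 P0; rewrite addr_eq0.
have -> : (P == - P) = (ycoord P == ycoord (- P)).
  apply/eqP/eqP => [h|]; first by rewrite {1}h.
  have [vN _] : val (- P) = Some (xcoord (- P), ycoord (- P)) /\ True.
    by split=> //; case: (@curve_neq0 (- P)); rewrite ?oppr_eq0.
  by move=> e; apply: val_inj; rewrite vP vN xcoordN e.
rewrite ycoordN // -subr_eq0; congr (_ == _); ring.
Qed.

End CurveGroup.

(** * Base change of the group law along a field morphism *)

Section MapPoint.
Variables (F F' : fieldType) (f : {rmorphism F -> F'}) (W : weierstrass F).
Local Notation W' := (map_weierstrass f W).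
Local Notation mp := (map_point f).

Lemma map_slope (p q : F * F) :
  f (slope W p q) = slope W' (f p.1, f p.2) (f q.1, f q.2).
Proof.
rewrite /slope /= (inj_eq (fmorph_inj f)); case: ifP => _; rewrite fmorph_div.
  by rewrite !(rmorph_nat, rmorphXn, rmorphB, rmorphM, rmorphD).
by rewrite !rmorphB.
Qed.

Lemma map_add_point (P Q : point F) :
  mp (add_point W P Q) = add_point W' (mp P) (mp Q).
Proof.
case: P Q => [p|] [q|]; rewrite ?add_pointO ?add_point0 //.
have mpE r : mp (Some r) = Some (f r.1, f r.2) by [].
rewrite add_pointE !mpE add_pointE.
have -> : ((f q.1, f q.2) == opp_affine W' (f p.1, f p.2)) = (q == opp_affine W p).
  case: p q => [x1 y1] [x2 y2]; rewrite /opp_affine /= !xpair_eqE (inj_eq (fmorph_inj f)).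
  by rewrite -rmorphN -rmorphM -!rmorphB (inj_eq (fmorph_inj f)).
case: ifP => // _; rewrite mpE; congr Some; rewrite /add_affine /chord_third /= -map_slope.
by rewrite !(rmorphXn, rmorphB, rmorphM, rmorphD).
Qed.

Lemma map_opp_point (P : point F) : mp (opp_point W P) = opp_point W' (mp P).
Proof. by case: P => [[x y]|] //=; rewrite !rmorphB rmorphN rmorphM. Qed.

Lemma map_mul_point n (P : point F) : mp (mul_point W n P) = mul_point W' n (mp P).
Proof. by rewrite /mul_point; elim: n => //= n <-; rewrite map_add_point. Qed.

Lemma map_on_curve (P : point F) : on_curve W' (mp P) = on_curve W P.
Proof.
case: P => [[x y]|] //=.
by rewrite -!(rmorphXn, rmorphM, rmorphD) (inj_eq (fmorph_inj f)).
Qed.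

Lemma map_elliptic : elliptic W -> elliptic W'.
Proof.
rewrite /elliptic; have -> : discriminant W' = f (discriminant W).
  by rewrite /discriminant /= !(rmorph_nat, rmorphXn, rmorphB, rmorphM, rmorphN, rmorphD).
by rewrite fmorph_eq0.
Qed.

End MapPoint.

(** * The coordinate ring and Abel's theorem *)

Section CoordinateRing.
Variables (F : fieldType) (W : weierstrass F).
Local Notation a1 := (wa1 W).
Local Notation a2 := (wa2 W).
Local Notation a3 := (wa3 W).
Local Notation a4 := (wa4 W).
Local Notation a6 := (wa6 W).

(* The pair (A, B) stands for A(x) + y B(x). *)
Definition coordring (_ : weierstrass F) : Type := ({poly F} * {poly F})%type.
Local Notation R := (coordring W).

HB.instance Definition _ := GRing.Zmodule.copy R ({poly F} * {poly F})%type.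

Definition curve_cubic : {poly F} := 'X^3 + a2%:P * 'X^2 + a4%:P * 'X + a6%:P.
Definition curve_lin : {poly F} := a1%:P * 'X + a3%:P.

Definition cr_one : R := (1, 0).
Definition cr_mul (f g : R) : R :=
  (f.1 * g.1 + curve_cubic * f.2 * g.2, f.1 * g.2 + f.2 * g.1 - curve_lin * f.2 * g.2).

Fact cr_mulA : associative cr_mul.
Proof. by move=> [a b] [c d] [e g]; rewrite /cr_mul /=; congr (_, _); ring. Qed.
Fact cr_mulC : commutative cr_mul.
Proof. by move=> [a b] [c d]; rewrite /cr_mul /=; congr (_, _); ring. Qed.
Fact cr_mul1 : left_id cr_one cr_mul.
Proof. by move=> [a b]; rewrite /cr_mul /=; congr (_, _); ring. Qed.
Fact cr_mulDl : left_distributive cr_mul +%R.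
Proof. by move=> [a b] [c d] [e g]; rewrite /cr_mul /=; congr (_, _) => /=; ring. Qed.
Fact cr_one_neq0 : cr_one != 0.
Proof. by apply/eqP => -[/eqP]; rewrite oner_eq0. Qed.

HB.instance Definition _ :=
  GRing.Zmodule_isComNzRing.Build R cr_mulA cr_mulC cr_mul1 cr_mulDl cr_one_neq0.

Lemma cr_mulE (f g : R) : f * g =
  (f.1 * g.1 + curve_cubic * f.2 * g.2, f.1 * g.2 + f.2 * g.1 - curve_lin * f.2 * g.2).
Proof. by []. Qed.

Definition cr_poly (A : {poly F}) : R := (A, 0).
Definition cr_y : R := (0, 1).
Local Notation y := cr_y.
Local Notation "A %:R_" := (cr_poly A) (at level 2, format "A %:R_").

Fact cr_poly_zmod : zmod_morphism cr_poly.
Proof. by move=> A B; congr (_, _); rewrite /= subrr. Qed.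
Fact cr_poly_monoid : monoid_morphism cr_poly.
Proof. by split=> // A B; congr (_, _) => /=; ring. Qed.
HB.instance Definition _ := GRing.isZmodMorphism.Build {poly F} R cr_poly cr_poly_zmod.
HB.instance Definition _ := GRing.isMonoidMorphism.Build {poly F} R cr_poly cr_poly_monoid.

Lemma crE (f : R) : f = cr_poly f.1 + y * cr_poly f.2.
Proof. by case: f => a b; congr (_, _) => /=; ring. Qed.

Lemma cr_sqry : y * y = cr_poly curve_cubic - cr_poly curve_lin * y.
Proof. by congr (_, _) => /=; ring. Qed.

(** The norm to F[x], that is, the product of [f] by its conjugate under [y -> - y - curve_lin]. For
    [f] nonzero its degree is the order of the pole of [f] at O. *)
Definition cr_norm (f : R) : {poly F} :=
  f.1 ^+ 2 - curve_lin * f.1 * f.2 - curve_cubic * f.2 ^+ 2.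

Lemma cr_normM (f g : R) : cr_norm (f * g) = cr_norm f * cr_norm g.
Proof. by case: f g => a b [c d]; rewrite /cr_norm /=; ring. Qed.

Lemma size_curve_cubic : size curve_cubic = 4%N.
Proof.
rewrite /curve_cubic -!addrA size_polyDl size_polyXn // ltnS.
rewrite (leq_trans (size_polyD _ _)) // geq_max; apply/andP; split.
  by rewrite mul_polyC (leq_trans (size_scale_leq _ _)) // size_polyXn.
rewrite (leq_trans (size_polyD _ _)) // geq_max; apply/andP; split.
  by rewrite mul_polyC (leq_trans (size_scale_leq _ _)) // size_polyX.
by rewrite (leq_trans (size_polyC_leq1 _)).
Qed.

Lemma size_curve_lin : (size curve_lin <= 2)%N.
Proof.
rewrite /curve_lin (leq_trans (size_polyD _ _)) // geq_max; apply/andP; split.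
  by rewrite mul_polyC (leq_trans (size_scale_leq _ _)) // size_polyX.
by rewrite (leq_trans (size_polyC_leq1 _)).
Qed.

Lemma size_sqr_poly (A : {poly F}) : size (A ^+ 2) = (size A).*2.-1.
Proof.
have [->|A0] := eqVneq A 0; first by rewrite expr0n /= size_poly0.
by rewrite expr2 size_mul // addnn.
Qed.

(** At O, [A(x)] and [y B(x)] have poles of orders [2 deg A] and [2 deg B + 3]. These differ in
    parity, so the leading terms cannot cancel, and the mixed term of the norm has smaller
    degree. *)
Lemma size_cr_norm (f : R) : size (cr_norm f) = maxn (size f.1).*2.-1 (if f.2 == 0 then 0 else (size f.2).*2.+2).
Proof.
case: f => a b; rewrite /cr_norm /=; have [->|b0] := eqVneq b 0.
  by rewrite expr0n /= !mulr0 !subr0 maxn0 size_sqr_poly.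
have sb : (0 < size b)%N by rewrite size_poly_gt0.
have c0 : curve_cubic != 0 by rewrite -size_poly_gt0 size_curve_cubic.
have scb : size (curve_cubic * b ^+ 2) = (size b).*2.+2.
  by rewrite size_mul ?expf_neq0 // size_sqr_poly size_curve_cubic; lia.
have [->|a0] := eqVneq a 0.
  by rewrite expr0n /= mulr0 mul0r subrr sub0r size_polyN size_poly0 scb max0n.
have sa : (0 < size a)%N by rewrite size_poly_gt0.
have slab : (size (curve_lin * a * b)%R <= size a + size b)%N.
  rewrite -mulrA (leq_trans (size_polyMleq _ _)) // size_mul //.
  by move: size_curve_lin sa sb; move: (size curve_lin) (size a) (size b) => u v w; lia.
have ssa := size_sqr_poly a.
move: ssa scb slab sa sb.
set sz_b2 := size (_ * b ^+ 2); set sz_a2 := size (a ^+ 2); set sz_ab := size (_ * a * b).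
move=> ssa scb slab sa sb.
case: (leqP (size b + 2) (size a)) => h.
  rewrite -addrA size_polyDl -/sz_a2 ssa.
    by move: h; move: (size a) (size b) => u v h; apply/esym/maxn_idPl; lia.
  rewrite -opprD size_polyN; apply: leq_ltn_trans (size_polyD _ _) _.
  rewrite gtn_max -/sz_ab -/sz_b2 scb.
  by move: h slab; move: sz_ab (size a) (size b) => w u v; lia.
rewrite addrC size_polyDl size_polyN -/sz_b2 scb.
  by move: h; move: (size a) (size b) => u v h; apply/esym/maxn_idPr; lia.
apply: leq_ltn_trans (size_polyD _ _) _.
rewrite size_polyN gtn_max -/sz_ab -/sz_a2 ssa.
by move: h slab sa sb; move: sz_ab (size a) (size b) => w u v; lia.
Qed.

Lemma cr_norm_eq0 (f : R) : (cr_norm f == 0) = (f == 0).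
Proof.
apply/idP/idP => [|/eqP->]; last by rewrite /cr_norm /= expr0n /= !mulr0 !subr0.
rewrite -size_poly_eq0 size_cr_norm; case: f => a b /=.
case: (eqVneq b 0) => [->|_]; last by move: (size a) (size b) => u v; lia.
move=> h; have : size a == 0.
  by move: h; move: (size a) => u; lia.
by rewrite size_poly_eq0 => /eqP ->.
Qed.

(** No function has a simple pole at O and no other pole; this stops the induction in [abel]. *)
Lemma size_cr_norm_neq2 (f : R) : size (cr_norm f) != 2%N.
Proof.
rewrite size_cr_norm; case: (eqVneq f.2 0) => [_|].
  by move: (size f.1) => u; lia.
by rewrite -size_poly_gt0; move: (size f.1) (size f.2) => u v; lia.
Qed.

Definition cr_eval (p : F * F) (f : R) : F := f.1.[p.1] + p.2 * f.2.[p.1].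

Lemma cr_evalM p (f g : R) : on_affine W p -> cr_eval p (f * g) = cr_eval p f * cr_eval p g.
Proof.
case: p f g => u v [a b] [c d]; rewrite /on_affine /cr_eval cr_mulE /= => e.
rewrite /curve_cubic /curve_lin !hornerE /=.
have -> : u ^+ 3 = v ^+ 2 + a1 * u * v + a3 * v - (a2 * u ^+ 2 + a4 * u + a6) by rewrite e; ring.
ring.
Qed.

Lemma cr_evalD p (f g : R) : cr_eval p (f + g) = cr_eval p f + cr_eval p g.
Proof.
have -> : f + g = (f.1 + g.1, f.2 + g.2) by [].
by rewrite /cr_eval /= !hornerD; ring.
Qed.

Lemma cr_evalN p (f : R) : cr_eval p (- f) = - cr_eval p f.
Proof.
have -> : - f = (- f.1, - f.2) by [].
by rewrite /cr_eval /= !hornerN; ring.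
Qed.

Lemma cr_eval_poly p A : cr_eval p (cr_poly A) = A.[p.1].
Proof. by rewrite /cr_eval /= horner0 mulr0 addr0. Qed.

Lemma cr_eval_y p : cr_eval p y = p.2.
Proof. by rewrite /cr_eval /= horner0 hornerC mulr1 add0r. Qed.

End CoordinateRing.

Section Abel.
Variables (F : fieldType) (W : weierstrass F).
Local Notation a1 := (wa1 W).
Local Notation a2 := (wa2 W).
Local Notation a3 := (wa3 W).
Local Notation a4 := (wa4 W).
Local Notation a6 := (wa6 W).
Local Notation R := (coordring W).
Local Notation cst c := (cr_poly W c%:P).
Local Notation X := (cr_poly W 'X).
Local Notation y := (cr_y W).

(* The product of the maximal ideals of the points of [s]. *)
Fixpoint vanish_on (s : seq (F * F)) (f : R) : Prop :=
  if s is p :: s' then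
    exists a b, [/\ vanish_on s' a, vanish_on s' b &
      f = (X - cst p.1) * a + (y - cst p.2) * b]
  else True.

Lemma vanish_onM s g f : vanish_on s f -> vanish_on s (g * f).
Proof.
elim: s g f => // p s IHs g f [a [b [va vb ->]]] /=.
by exists (g * a), (g * b); split; [exact: IHs|exact: IHs|ring].
Qed.

Lemma vanish_onD s f g : vanish_on s f -> vanish_on s g -> vanish_on s (f + g).
Proof.
elim: s f g => // p s IHs f g [a [b [va vb ->]]] [a' [b' [va' vb' ->]]] /=.
by exists (a + a'), (b + b'); split; [exact: IHs|exact: IHs|ring].
Qed.

Lemma vanish_on_eval p s f : on_affine W p -> vanish_on (p :: s) f -> cr_eval p f = 0.
Proof.
move=> ep [a [b [_ _ ->]]].
rewrite cr_evalD !cr_evalM // !cr_evalD !cr_evalN !cr_eval_poly cr_eval_y.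
by rewrite hornerX !hornerC; ring.
Qed.

Lemma poly_sub_eval (A : {poly F}) c : exists B, A = A.[c]%:P + ('X - c%:P) * B.
Proof.
have : root (A - A.[c]%:P) c by rewrite /root !hornerE subrr.
by move=> /factor_theorem[B eB]; exists B; rewrite mulrC -eB; ring.
Qed.

Lemma eval0_vanish p f : cr_eval p f = 0 -> exists a b : R,
  f = (X - cst p.1) * a + (y - cst p.2) * b.
Proof.
move=> e; rewrite [f](crE f).
have [A eA] := poly_sub_eval f.1 p.1; have [B eB] := poly_sub_eval f.2 p.1.
exists (cr_poly W A + cst p.2 * cr_poly W B), (cr_poly W f.2).
have e0 : f.1.[p.1] = - (p.2 * f.2.[p.1]) by apply/eqP; rewrite -addr_eq0; apply/eqP.
have h1 : cr_poly W f.1 = - (cst p.2 * cst f.2.[p.1]) + (X - cst p.1) * cr_poly W A.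
  by rewrite {1}eA e0 polyCN polyCM !(rmorphB, rmorphD, rmorphM, rmorphN).
have h2 : cr_poly W f.2 = cst f.2.[p.1] + (X - cst p.1) * cr_poly W B.
  by rewrite {1}eB !(rmorphB, rmorphD, rmorphM, rmorphN).
by rewrite h1 h2; ring.
Qed.

Lemma vanish_on_neq p s : on_affine W p -> (forall q, q \in s -> on_affine W q) ->
  p \notin s -> exists2 g, vanish_on s g & cr_eval p g != 0.
Proof.
move=> ep; elim: s => [|q s IHs] es ps.
  by exists 1 => //; rewrite /cr_eval /= horner0 mulr0 addr0 hornerC oner_eq0.
have [||g vg g0] := IHs; first by move=> r rs; apply: es; rewrite inE rs orbT.
  by apply: contra ps => ps; rewrite inE ps orbT.
have /orP : (p.1 != q.1) || (p.2 != q.2).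
  apply: contraNT ps; rewrite negb_or !negbK => /andP[/eqP e1 /eqP e2].
  by rewrite inE (surjective_pairing p) e1 e2 -surjective_pairing eqxx.
have v0 : vanish_on s (0 * g) by apply: vanish_onM.
case=> n; [exists ((X - cst q.1) * g)|exists ((y - cst q.2) * g)].
- by exists g, (0 * g); split=> //; ring.
- rewrite cr_evalM // mulf_neq0 // cr_evalD cr_evalN !cr_eval_poly hornerX hornerC.
  by rewrite subr_eq0.
- by exists (0 * g), g; split=> //; ring.
- rewrite cr_evalM // mulf_neq0 // cr_evalD cr_evalN !cr_eval_poly cr_eval_y hornerC.
  by rewrite subr_eq0.
Qed.

(* The maximal ideals of distinct points are comaximal, so that their product
   is their intersection. *)
Lemma eval_vanish_on s f : uniq s -> (forall p, p \in s -> on_affine W p) ->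
  (forall p, p \in s -> cr_eval p f = 0) -> vanish_on s f.
Proof.
elim: s => // p s IHs /= /andP[ps us] es vs.
have ep : on_affine W p by apply: es; rewrite mem_head.
have es' q : q \in s -> on_affine W q by move=> qs; apply: es; rewrite inE qs orbT.
have vf : vanish_on s f by apply: IHs => // q qs; apply: vs; rewrite inE qs orbT.
have [g vg g0] := vanish_on_neq ep es' ps.
have [a [b eab]] : exists a b : R, cst (cr_eval p g)^-1 * g - 1 = (X - cst p.1) * a + (y - cst p.2) * b.
  apply: eval0_vanish; rewrite cr_evalD cr_evalN cr_evalM // cr_eval_poly hornerC mulVf //.
  by rewrite -[1 : R]/(cr_poly W 1) cr_eval_poly hornerC subrr.
have [c [d ecd]] := eval0_vanish (vs p (mem_head _ _)).
pose g' := cst (cr_eval p g)^-1 * g; have vg' : vanish_on s g' by apply: vanish_onM.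
exists (c * g' + - a * f), (d * g' + - b * f).
split; [apply: vanish_onD; exact: vanish_onM|apply: vanish_onD; exact: vanish_onM|].
transitivity (f * g' - (g' - 1) * f); first by ring.
by rewrite {1}ecd /g' eab; ring.
Qed.

Lemma cr_chord p q s : on_affine W p -> is_slope W p q s ->
  let r := chord_third W s p q in
  let l : R := y - cst p.2 - cst s * (X - cst p.1) in
  let m : R := y + cst s * (X - cst p.1) + cst p.2 + cr_poly W (curve_lin W) in
  l * m = (X - cst p.1) * (X - cst q.1) * (X - cst r).
Proof.
move=> ep [s1 s2] r l m.
pose L : {poly F} := s *: ('X - p.1%:P) + p.2%:P.
have a4E : a4 = s * (p.2 + q.2 + a1 * q.1 + a3) + a1 * p.2 -
   (q.1 ^+ 2 + p.1 * q.1 + p.1 ^+ 2 + a2 * (p.1 + q.1)) by rewrite s2; ring.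
have a6E : a6 = p.2 ^+ 2 + a1 * p.1 * p.2 + a3 * p.2 - (p.1 ^+ 3 + a2 * p.1 ^+ 2 + a4 * p.1).
  by rewrite ep; ring.
have cub : curve_cubic W - (L ^+ 2 + curve_lin W * L) =
    ('X - p.1%:P) * ('X - q.1%:P) * ('X - r%:P).
  rewrite /curve_cubic /curve_lin /r /chord_third a6E a4E s1 /L -mul_polyC.
  rewrite !(polyCD, polyCN, polyCM, polyC_exp); ring.
transitivity (cr_poly W (curve_cubic W - (L ^+ 2 + curve_lin W * L))); last first.
  by rewrite cub !rmorphM !rmorphB.
have -> : cr_poly W (curve_cubic W - (L ^+ 2 + curve_lin W * L)) =
  y * y + cr_poly W (curve_lin W) * y - (cr_poly W L ^+ 2 + cr_poly W (curve_lin W) * cr_poly W L).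
  have eL : cr_poly W (L ^+ 2 + curve_lin W * L) =
    cr_poly W L ^+ 2 + cr_poly W (curve_lin W) * cr_poly W L by rewrite rmorphD rmorphM rmorphXn.
  by rewrite cr_sqry -eL (rmorphB (cr_poly W) (curve_cubic W)); ring.
have -> : cr_poly W L = cst s * (X - cst p.1) + cst p.2.
  by rewrite /L -mul_polyC rmorphD rmorphM rmorphB.
rewrite /l /m; ring.
Qed.

(** Multiplying [f] by [(x - x(p + q)) / l], with [l] the line through [p] and [q], trades the zeros
    [p] and [q] for [p + q] and lowers the order of the pole at O by one. *)
Lemma vanish_on_chord p q s f : on_affine W p -> on_affine W q -> q <> opp_affine W p ->
  vanish_on [:: p, q & s] f ->
  exists2 f', vanish_on (add_affine W p q :: s) f' &
   exists l : R, [/\ size (cr_norm l) = 4%N &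
    (X - cst (add_affine W p q).1) * f = l * f'].
Proof.
move=> ep eq nq [a [b [[a' [a'' [va' va'' ->]]] [b' [b'' [vb' vb'' ->]]] ->]]].
have sl := slopeP ep eq nq; have [s1 _] := sl; set lam := slope W p q in sl s1.
have /= := cr_chord ep sl; set r := chord_third W lam p q.
set l : R := y - _ - _; set m : R := y + _ + _ + _ => lm.
(* Substituting [l + lam (x - x_p)] for [y - y_p] and [l + lam (x - x_q)] for [y - y_q] in the four
   terms of [f] gives [f = (x - x_p) (x - x_q) B + l A]; then [lm] makes [(x - r) f] a multiple of
   [l]. *)
pose B := a' + cst lam * a'' + cst lam * b' + cst lam ^+ 2 * b''.
pose A := (X - cst p.1) * a'' + (X - cst q.1) * b' +
   (l + cst lam * (X - cst p.1) + cst lam * (X - cst q.1)) * b''.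
have vB : vanish_on s B by do 3![apply: vanish_onD; last exact: vanish_onM].
have vA : vanish_on s A by do 2![apply: vanish_onD; last exact: vanish_onM]; exact: vanish_onM.
exists ((X - cst r) * (A + cst (lam + a1) * B) + (y - cst (add_affine W p q).2) * B).
  exists (A + cst (lam + a1) * B), B; split=> //.
  by apply: vanish_onD => //; apply: vanish_onM.
exists l; split.
  rewrite size_cr_norm; have -> : l = ((- p.2)%:P - lam *: ('X - p.1%:P), 1).
    by rewrite /l [LHS]crE /=; congr (_, _) => /=; rewrite -?mul_polyC ?polyCN; ring.
  rewrite /= oner_eq0 size_poly1 /=; apply/maxn_idPr.
  have : (size ((- p.2)%:P - lam *: ('X - p.1%:P))%R <= 2)%N.
    rewrite (leq_trans (size_polyD _ _)) // geq_max size_polyN.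
    rewrite (leq_trans (size_polyC_leq1 _)) //= (leq_trans (size_scale_leq _ _)) //.
    by rewrite size_XsubC.
  by move: (size _) => n; lia.
have qE : cst q.2 = cst p.2 + cst lam * (cst q.1 - cst p.1) :> R.
  by rewrite s1 !(polyCD, polyCN, polyCM) !(rmorphB, rmorphD, rmorphM, rmorphN) /=; ring.
have mE : m = y - cst (add_affine W p q).2 + cst (lam + a1) * (X - cst r).
  have r2E : (add_affine W p q).2 = lam * (p.1 - r) - p.2 - a1 * r - a3 by [].
  rewrite /m r2E /curve_lin; clear; clearbody r lam.
  by rewrite !(polyCB, polyCD, polyCM) !(rmorphB, rmorphD, rmorphM) /=; ring.
transitivity (l * ((X - cst r) * A + m * B)); last by rewrite mE; ring.
transitivity (l * (X - cst r) * A + (l * m) * B); last by ring.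
rewrite lm /A /B qE /l /=; ring.
Qed.

Lemma vanish_on_opp p s f : on_affine W p ->
  vanish_on [:: p, opp_affine W p & s] f ->
  exists2 f', vanish_on s f' & f = (X - cst p.1) * f'.
Proof.
move=> ep [a [b [[a' [a'' [va' va'' ->]]] [b' [b'' [vb' vb'' ->]]] ->]]].
have [k kE] := poly_sub_eval (curve_cubic W) p.1.
have cE : (curve_cubic W).[p.1] = p.2 ^+ 2 + a1 * p.1 * p.2 + a3 * p.2.
  by rewrite ep /curve_cubic !hornerE.
exists ((X - cst p.1) * a' + (y - cst (opp_affine W p).2) * a'' +
  (y - cst p.2) * b' + (cr_poly W k - cst a1 * y) * b'').
  by do 3![apply: vanish_onD; last exact: vanish_onM]; exact: vanish_onM.
have e : (y - cst p.2) * (y - cst (opp_affine W p).2) =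
    (X - cst p.1) * (cr_poly W k - cst a1 * y).
  transitivity (y * y - (cst p.2 + cst (opp_affine W p).2) * y + cst p.2 * cst (opp_affine W p).2 : R).
    by ring.
  rewrite cr_sqry kE cE /curve_lin /opp_affine /=.
  by rewrite !(polyCB, polyCD, polyCN, polyCM, polyC_exp) !(rmorphB, rmorphD, rmorphM, rmorphN, rmorphXn) /=; ring.
transitivity ((X - cst p.1) * ((X - cst p.1) * a' + (y - cst (opp_affine W p).2) * a'' +
  (y - cst p.2) * b') + ((y - cst p.2) * (y - cst (opp_affine W p).2)) * b'').
  by rewrite /=; ring.
by rewrite e; ring.
Qed.

Lemma size_cr_norm_XsubC c : size (cr_norm (X - cst c : R)) = 3%N.
Proof.
have -> : X - cst c = cr_poly W ('X - c%:P) by rewrite rmorphB.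
by rewrite size_cr_norm /= eqxx maxn0 size_XsubC.
Qed.

Hypothesis smooth : elliptic W.
Local Notation E := (curve smooth).

Definition affine_of (P : E) : F * F := (xcoord P, ycoord P).

(** The bound on the norm leaves no room for zeros outside [s]. Two points of [s] are merged into
    their sum, or dropped when opposite; the order of the pole at O falls by as much as the number
    of points, so the bound persists. *)
Theorem abel (s : seq E) (f : R) : f != 0 -> all (fun P => P != 0) s ->
  vanish_on (map affine_of s) f -> (size (cr_norm f) <= (size s).+1)%N ->
  \sum_(P <- s) P = 0.
Proof.
elim: {s}_.+1 {-2}s f (ltnSn (size s)) => // n IHn s f.
case: s => [|P [|Q s]] /=; rewrite ?ltnS => sn f0.
- by rewrite big_nil.
(* A pole of order at most one is no pole: [f] would be a nonzero constant vanishing at [P]. *)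
- rewrite andbT => P0 vf; rewrite leq_eqVlt (negPf (size_cr_norm_neq2 f)) /= ltnS.
  have [_ eP] := curve_neq0 P0; have := @vanish_on_eval _ [::] f eP vf.
  rewrite size_cr_norm geq_max => ev /andP[h1]; case: eqVneq => [f2 _|//].
  have h : (size f.1 <= 1)%N by move: h1; move: (size f.1) => u; lia.
  move: ev; rewrite /cr_eval f2 horner0 mulr0 addr0 (size1_polyC h) hornerC => e0.
  by case/eqP: f0; rewrite [f]crE f2 (size1_polyC h) e0 !rmorph0 mulr0 addr0.
move=> /and3P[P0 Q0 s0].
rewrite -[X in X -> _]/(vanish_on [:: affine_of P, affine_of Q & map affine_of s] f) => vf szf; rewrite !big_cons.
have [vP eP] := curve_neq0 P0; have [vQ eQ] := curve_neq0 Q0.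
have Nf0 : cr_norm f != 0 by rewrite cr_norm_eq0.
have [PQ0|PQ0] := eqVneq (P + Q) 0.
  have QE : Q = - P by apply/eqP; rewrite -addr_eq0 addrC PQ0.
  have oppE : affine_of Q = opp_affine W (affine_of P).
    by rewrite /affine_of QE /opp_affine xcoordN ycoordN.
  rewrite oppE in vf; have [f' vf' fE] := vanish_on_opp eP vf.
  have f'0 : f' != 0 by apply: contra_neq f0 => f'0; rewrite fE f'0 mulr0.
  rewrite addrA PQ0 add0r; apply: (IHn _ f') => //; first exact: ltnW.
  have Nf'0 : cr_norm f' != 0 by rewrite cr_norm_eq0.
  move: szf; rewrite fE cr_normM size_mul // -?size_poly_eq0 ?size_cr_norm_XsubC //.
have nQ := curve_opp_affine P0 Q0 PQ0.
have [f' vf' [l [szl fE]]] := vanish_on_chord eP eQ nQ vf.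
have PQE : affine_of (P + Q) = add_affine W (affine_of P) (affine_of Q).
  exact: curve_add_affine.
have := congr1 (fun g => size (cr_norm g)) fE; rewrite /= !cr_normM.
rewrite size_mul // -?size_poly_eq0 ?size_cr_norm_XsubC // => szE.
have f'0 : f' != 0.
  apply/eqP => f'e; move: szE Nf0; rewrite f'e (_ : cr_norm 0 = 0) => [|]; last first.
    by apply/eqP; rewrite cr_norm_eq0.
  by rewrite mulr0 size_poly0 -size_poly_gt0; move: (size _) => u; lia.
rewrite addrA -(big_cons _ _ (P + Q) s xpredT id); apply: (IHn _ f') => //.
- by rewrite /= PQ0.
- by rewrite -[map _ _]/(affine_of (P + Q) :: map affine_of s) PQE.
have Nf'0 : cr_norm f' != 0 by rewrite cr_norm_eq0.
move: szE szf; rewrite size_mul // -?size_poly_eq0 szl //.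
by rewrite [size (_ :: s)]/=; move: (size (cr_norm f)) (size (cr_norm f')) (size s) => u v w; lia.
Qed.

End Abel.

(** * The fixed field of the absolute Galois group *)

Lemma min_size_poly (R : nzRingType) (P : {poly R} -> Prop) :
  (exists p, P p) -> exists2 p, P p & forall q, P q -> (size p <= size q)%N.
Proof.
move=> [p]; elim: {p}_.+1 {-2}p (ltnSn (size p)) => // n IHn p sp Pp.
have [[q [Pq sq]]|h] := pselect (exists q, P q /\ (size q < size p)%N).
  by apply: (IHn q) => //; apply: leq_trans sq _.
exists p => // q Pq; rewrite leqNgt; apply/negP => sq; apply: h.
by exists q.
Qed.

Section AutomorphismExtension.
Variables (K L : fieldType) (f : {rmorphism K -> L}).
Local Notation "p ^f" := (map_poly f p) : ring_scope.
Implicit Types (G : set (L * L)) (a b c : L).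

(* The graph of a ring morphism over [K] from a subring of [L] to [L]. *)
Definition morphism_graph G : Prop :=
  [/\ forall k, G (f k, f k),
      forall a b a' b', G (a, b) -> G (a', b') -> G (a - a', b - b'),
      forall a b a' b', G (a, b) -> G (a', b') -> G (a * a', b * b')
    & forall b, G (0, b) -> b = 0].

Section Graph.
Variables (G : set (L * L)) (mG : morphism_graph G).

Let Gc k : G (f k, f k). Proof. by case: mG. Qed.
Let GB a b a' b' : G (a, b) -> G (a', b') -> G (a - a', b - b').
Proof. by case: mG => _ + _ _; apply. Qed.
Let GM a b a' b' : G (a, b) -> G (a', b') -> G (a * a', b * b').
Proof. by case: mG => _ _ + _; apply. Qed.
Let Gfun b : G (0, b) -> b = 0. Proof. by case: mG => _ _ _; apply. Qed.
Let G0 : G (0, 0). Proof. by rewrite -(rmorph0 f). Qed.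
Let G1 : G (1, 1). Proof. by rewrite -(rmorph1 f). Qed.
Let GN a b : G (a, b) -> G (- a, - b).
Proof. by move=> h; rewrite -[- a]add0r -[- b]add0r; apply: GB. Qed.
Let GD a b a' b' : G (a, b) -> G (a', b') -> G (a + a', b + b').
Proof. by move=> h h'; rewrite -[a']opprK -[b']opprK; apply: GB => //; apply: GN. Qed.

Lemma morphism_graph_uniq a b b' : G (a, b) -> G (a, b') -> b = b'.
Proof. by move=> h h'; apply/eqP; rewrite -subr_eq0; apply/eqP/Gfun; rewrite -(subrr a); apply: GB. Qed.

Lemma graph_sum n (F1 F2 : 'I_n -> L) : (forall i, G (F1 i, F2 i)) ->
  G (\sum_(i < n) F1 i, \sum_(i < n) F2 i).
Proof.
by move=> h; apply: (big_ind2 (fun a b => G (a, b))) => // *; apply: GD.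
Qed.

Definition graph_poly (p q : {poly L}) := forall i, G (p`_i, q`_i).

Lemma graph_polyB p q p' q' : graph_poly p q -> graph_poly p' q' -> graph_poly (p - p') (q - q').
Proof. by move=> h h' i; rewrite !coefB; apply: GB. Qed.

Lemma graph_polyD p q p' q' : graph_poly p q -> graph_poly p' q' -> graph_poly (p + p') (q + q').
Proof. by move=> h h' i; rewrite !coefD; apply: GD. Qed.

Lemma graph_polyM p q p' q' : graph_poly p q -> graph_poly p' q' -> graph_poly (p * p') (q * q').
Proof. by move=> h h' i; rewrite !coefM; apply: graph_sum => j; apply: GM. Qed.

Lemma graph_polyC a b : G (a, b) -> graph_poly a%:P b%:P.
Proof. by move=> h i; rewrite !coefC; case: ifP. Qed.

Lemma graph_polyXn n : graph_poly 'X^n 'X^n.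
Proof. by move=> i; rewrite !coefXn; case: (i == n). Qed.

Lemma graph_poly_map p : graph_poly p^f p^f.
Proof. by move=> i; rewrite !coef_map; apply: Gc. Qed.

Lemma graph_horner p q a b : graph_poly p q -> G (a, b) -> G (p.[a], q.[b]).
Proof.
move=> h hab; pose n := maxn (size p) (size q).
rewrite (@horner_coef_wide _ n) ?leq_maxl // (@horner_coef_wide _ n) ?leq_maxr //.
apply: graph_sum => i; apply: GM => //.
by elim: (nat_of_ord i) => // j IHj; rewrite !exprS; apply: GM.
Qed.

Lemma graph_poly0 q : graph_poly 0 q -> q = 0.
Proof. by move=> h; apply/polyP => i; rewrite coef0; apply: Gfun; have := h i; rewrite coef0. Qed.

(** Division by a monic polynomial uses ring operations on coefficients only, so it runs on both
    sides of the graph at once. *)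
Lemma graph_poly_div m m' p p' : m \is monic -> graph_poly m m' -> graph_poly p p' ->
  exists q q' r r', [/\ graph_poly q q', graph_poly r r', p = q * m + r,
     p' = q' * m' + r' & (size r < size m)%N].
Proof.
move=> mm hm; elim: {p}(size p) {-2}p p' (leqnn (size p)) => [|n IHn] p p' sp hp.
  exists 0, 0, p, p'; split; rewrite ?mul0r ?add0r //; first by move=> i; rewrite !coef0.
  by rewrite (leq_ltn_trans sp) // size_poly_gt0 monic_neq0.
have [sm|sm] := ltnP (size p) (size m).
  by exists 0, 0, p, p'; split; rewrite ?mul0r ?add0r // => i; rewrite !coef0.
pose k := (size p - size m)%N.
pose c := p`_n *: ('X^k : {poly L}); pose c' := p'`_n *: ('X^k : {poly L}).
have hc : graph_poly c c'.
  rewrite /c /c' -!mul_polyC; apply: graph_polyM; [exact: graph_polyC|exact: graph_polyXn].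
have sp' : (size (p - c * m)%R <= n)%N.
  have m0 : (0 < size m)%N by rewrite size_poly_gt0 monic_neq0.
  apply/leq_sizeP => j nj; rewrite coefB /c -scalerAl coefZ coefXnM.
  have [jn|jn] := eqVneq j n; last first.
    have lt : (n < j)%N by rewrite ltn_neqAle eq_sym jn.
    rewrite nth_default; last exact: leq_trans sp lt.
    rewrite sub0r; case: ifP => _; first by rewrite mulr0 oppr0.
    rewrite [m`_ _]nth_default ?mulr0 ?oppr0 //.
    by move: sm sp lt m0; rewrite /k; move: (size p) (size m) => u v; lia.
  have [spn|spn] := leqP (size p) n.
    by rewrite jn nth_default // mul0r subr0.
  have spE : size p = n.+1 by apply/eqP; rewrite eqn_leq sp spn.
  rewrite jn ifN; last by rewrite /k spE -leqNgt; move: m0; move: (size m) => u; lia.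
  have -> : (n - k)%N = (size m).-1.
    by move: sm m0; rewrite /k spE; move: (size m) => u; lia.
  by move: mm; rewrite monicE /lead_coef => /eqP ->; rewrite mulr1 subrr.
have [q [q' [r [r' [hq hr e e' sr]]]]] := IHn _ _ sp' (graph_polyB hp (graph_polyM hc hm)).
exists (c + q), (c' + q'), r, r'; split=> //; first exact: graph_polyD.
  by rewrite mulrDl -addrA -e addrC subrK.
by rewrite mulrDl -addrA -e' addrC subrK.
Qed.

Hypothesis algL : forall z : L, exists2 p : {poly K}, separable_poly p & root p^f z.

(** The minimal polynomial of [a] over K has a nonzero constant term, so [a^-1] is a polynomial in
    [a] over K. As [b] is a root of the same polynomial, [b^-1] is the same expression in [b]. *)
Lemma graph_inv a b : G (a, b) -> a != 0 -> G (a^-1, b^-1).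
Proof.
move=> hab a0.
have [p [p0 pa] pmin] : exists2 p : {poly K}, p != 0 /\ root p^f a &
    forall q, q != 0 /\ root q^f a -> (size p <= size q)%N.
  apply: min_size_poly; have [p sp pa] := algL a; exists p; split=> //.
  exact: separable_poly_neq0.
have [r rE] : exists r, p = (p`_0)%:P + r * 'X.
  have : root (p - (p`_0)%:P) 0 by rewrite /root hornerD hornerN hornerC horner_coef0 subrr.
  by case/factor_theorem => r; rewrite polyC0 subr0 => e; exists r; rewrite -e addrC subrK.
have c0 : p`_0 != 0.
  apply: contraTneq pa => c0; rewrite rE c0 polyC0 add0r rmorphM /= map_polyX rootM rootX (negPf a0) orbF.
  apply/negP => ra; have r0 : r != 0 by apply: contra_neq p0; rewrite rE c0 => ->; rewrite mul0r addr0.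
  by have := pmin r (conj r0 ra); rewrite {1}rE c0 polyC0 add0r size_mulX // ltnn.
have pE c : p^f.[c] = f p`_0 + r^f.[c] * c.
  by rewrite {1}rE rmorphD rmorphM /= map_polyC map_polyX !hornerE.
have pb : p^f.[b] = 0.
  by apply: Gfun; rewrite -(rootP pa); apply: graph_horner => //; apply: graph_poly_map.
have fc0 : f p`_0 != 0 by rewrite fmorph_eq0.
have invE c : p^f.[c] = 0 -> c^-1 = - (f (p`_0)^-1) * r^f.[c].
  rewrite pE => e; have e' : r^f.[c] * c = - f p`_0 by apply/eqP; rewrite -addr_eq0 addrC e.
  have cn0 : c != 0 by apply: contraNneq fc0 => c0'; rewrite -oppr_eq0 -e' c0' mulr0.
  by apply: (mulIf cn0); rewrite mulVf // -mulrA e' fmorphV mulrNN mulVf.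
rewrite (invE a) ?(invE b) //; last exact/rootP.
by apply: GM; [apply: GN|apply: graph_horner => //; apply: graph_poly_map].
Qed.

Hypothesis closedL : forall p : {poly L}, separable_poly p -> (1 < size p)%N -> exists z, root p z.

(** Let [m] be the minimal polynomial of [w] over the domain of [G] and [m'] its image; [h(w)] is
    sent to [h'(v)] for a root [v] of [m']. *)
Lemma graph_extend (w : L) : (forall v, ~ G (w, v)) ->
  exists G' : set (L * L), [/\ morphism_graph G', (G `<=` G')%classic & exists v, G' (w, v)].
Proof.
move=> nw.
pose ann m := m != 0 /\ (exists2 m', graph_poly m m' & m.[w] = 0).
have [q sq qw] := algL w; have q0 := separable_poly_neq0 sq.
have [p [p0 [p' hp pw]] pmin] : exists2 m, ann m & forall n, ann n -> (size m <= size n)%N.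
  apply: min_size_poly; exists q^f; split; first by rewrite map_poly_eq0.
  by exists q^f; [exact: graph_poly_map|exact/rootP].
pose d := lead_coef p; pose d' := p'`_(size p).-1.
have hd : G (d, d') by apply: hp.
have d0 : d != 0 by rewrite lead_coef_eq0.
have hdV := graph_inv hd d0.
have dV' : d'^-1 * d' = 1.
  by have := GM hdV hd; rewrite (mulVf d0) => h; apply: morphism_graph_uniq h G1.
pose m := d^-1 *: p; pose m' := d'^-1 *: p'.
have hm : graph_poly m m' by rewrite /m /m' -!mul_polyC; apply: graph_polyM => //; apply: graph_polyC.
have sm : size m = size p by rewrite size_scale // invr_eq0.
have mm : m \is monic by rewrite monicE lead_coefZ mulVf.
have mw : m.[w] = 0 by rewrite hornerZ pw mulr0.
have sm' : size m' = size m.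
  apply/eqP; rewrite eqn_leq; apply/andP; split.
    apply/leq_sizeP => j sj; apply: Gfun; have := hm j.
    by rewrite nth_default.
  rewrite sm leqNgt; apply/negP => s'; have := dV'.
  have p1 : (0 < size p)%N by rewrite size_poly_gt0.
  have : m'`_(size p).-1 = 0 by rewrite nth_default // -ltnS prednK.
  by rewrite coefZ -/d' => -> /eqP; rewrite eq_sym oner_eq0.
have small r r' : graph_poly r r' -> (size r < size m)%N -> r.[w] = 0 -> r = 0 /\ r' = 0.
  move=> hr sr rw; have r0 : r = 0.
    apply: contraTeq sr => r0; rewrite -leqNgt sm; apply: pmin; split=> //.
    by exists r'.
  by split=> //; apply: graph_poly0; rewrite -r0.
have [u [u' [r [r' [hu hr e e' sr]]]]] := graph_poly_div mm hm (graph_poly_map q).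
have [|r0 r'0] := small _ _ hr sr.
  by have := rootP qw; rewrite e hornerD hornerM mw mulr0 add0r.
(* The coefficients of [q] come from K, so [q^f] is its own image; thus [m'] divides it and inherits
   its separability. *)
have sepm' : separable_poly m'.
  apply: (@dvdp_separable _ q^f); last by rewrite separable_map.
  by rewrite e' r'0 addr0 dvdp_mull.
have [v vroot] : exists v, root m' v.
  apply: closedL => //; rewrite sm' ltnNge; apply/negP => s1.
  move: mw; rewrite (size1_polyC s1) hornerC => mc.
  by move: (monic_neq0 mm); rewrite (size1_polyC s1) mc eqxx.
exists [set ab | exists h h', graph_poly h h' /\ ab = (h.[w], h'.[v])]%classic; split.
- split.
  + move=> k; exists (f k)%:P, (f k)%:P; split; first exact: graph_polyC.
    by rewrite !hornerC.
  + move=> _ _ _ _ [h [h' [hh [-> ->]]]] [g [g' [hg [-> ->]]]].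
    exists (h - g), (h' - g'); split; first exact: graph_polyB.
    by rewrite !hornerD !hornerN.
  + move=> _ _ _ _ [h [h' [hh [-> ->]]]] [g [g' [hg [-> ->]]]].
    exists (h * g), (h' * g'); split; first exact: graph_polyM.
    by rewrite !hornerM.
  + move=> b [h [h' [hh [hw ->]]]].
    have [s [s' [t [t' [hs ht eh eh' st]]]]] := graph_poly_div mm hm hh.
    have [|t0 t'0] := small _ _ ht st.
      by have := esym hw; rewrite eh hornerD hornerM mw mulr0 add0r.
    by rewrite eh' t'0 addr0 hornerM (rootP vroot) mulr0.
- move=> [a b] hab; exists a%:P, b%:P; split; first exact: graph_polyC.
  by rewrite !hornerC.
- exists v, 'X, 'X; split; last by rewrite !hornerX.
  by move=> i; rewrite !coefX; case: (i == 1%N).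
Qed.

End Graph.

Hypothesis algL : forall z : L, exists2 p : {poly K}, separable_poly p & root p^f z.
Hypothesis closedL : forall p : {poly L}, separable_poly p -> (1 < size p)%N -> exists z, root p z.

Lemma total_graph G0 : morphism_graph G0 ->
  exists G, [/\ morphism_graph G, (G0 `<=` G)%classic & forall a, exists b, G (a, b)].
Proof.
move=> mG0.
pose P G := G = classical_sets.set0 \/ morphism_graph G /\ (G0 `<=` G)%classic.
have [F FP Ftot|G [[GE|[mG sG]] Gmax]] := @Zorn_bigcup _ P.
- have [[H [FH [ab Hab]]]|nH] := pselect (exists H, F H /\ exists ab, H ab); last first.
    left; apply/seteqP; split=> // ab [H FH Hab]; case: nH; exists H; split=> //.
    by exists ab.
  have ne H' : F H' -> H' !=set0%classic -> morphism_graph H' /\ (G0 `<=` H')%classic.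
    by move=> /FP[->|//] [x []].
  have both x x' : (\bigcup_(X in F) X)%classic x -> (\bigcup_(X in F) X)%classic x' ->
      exists H', [/\ F H', morphism_graph H', H' x & H' x'].
    move=> [H1 FH1 h1] [H2 FH2 h2].
    have [s|s] := Ftot _ _ FH1 FH2.
      by exists H2; split=> //; [apply: (ne _ FH2 _).1; exists x'|exact: s].
    by exists H1; split=> //; [apply: (ne _ FH1 _).1; exists x|exact: s].
  have [mH sH] := ne H FH (ex_intro _ ab Hab).
  right; split; last by move=> x /sH Hx; exists H.
  split.
  + by move=> k; exists H => //; case: mH.
  + move=> a b a' b' h h'; have [H' [FH' [_ c _ _] x x']] := both _ _ h h'.
    by exists H' => //; apply: c.
  + move=> a b a' b' h h'; have [H' [FH' [_ _ c _] x x']] := both _ _ h h'.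
    by exists H' => //; apply: c.
  + by move=> b h; have [H' [FH' [_ _ _ c] x x']] := both _ _ h h; apply: c.
- case: (Gmax G0); last by right; split.
  rewrite GE; split=> // h; have [c _ _ _] := mG0.
  by have := h _ (c 0).
- exists G; split=> // a; apply: contrapT => na.
  have [|G' [mG' sG' [v hv]]] := graph_extend mG algL closedL (w := a).
    by move=> v hv; apply: na; exists v.
  apply: (Gmax G').
    by split=> // s; apply: na; exists v; apply: s.
  by right; split=> //; apply: classical_sets.subset_trans sG sG'.
Qed.

Lemma graph_automorphism G : morphism_graph G -> (forall a, exists b, G (a, b)) ->
  exists2 s : {rmorphism L -> L}, galois_aut f s & forall a, G (a, s a).
Proof.
move=> mG tot; pose s a := projT1 (cid (tot a)).
have sG a : G (a, s a) by rewrite /s; case: cid.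
have [Gc GB GM _] := mG.
have uni := morphism_graph_uniq mG.
have sB : zmod_morphism s by move=> a b; apply: uni (sG _) _; apply: GB.
have sM : monoid_morphism s.
  split; first by apply: uni (sG _) _; rewrite -(rmorph1 f).
  by move=> a b; apply: uni (sG _) _; apply: GM.
pose s' : {rmorphism L -> L} := HB.pack s (GRing.isZmodMorphism.Build _ _ s sB)
  (GRing.isMonoidMorphism.Build _ _ s sM).
have sf (k : K) : s' (f k) = f k by apply: uni (sG _) _; apply: Gc.
exists s' => //; split=> //.
have sinj : injective s' by apply: fmorph_inj.
(* The iterates of [b] are roots of one polynomial over K, so they repeat; by injectivity the cycle
   contains [b]. *)
have surj b : exists a, s' a = b.
  have [p sp pb] := algL b.
  have proot n : root p^f (iter n s' b).
    elim: n => //= n IHn; rewrite /root.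
    have -> : p^f.[s' (iter n s' b)] = s' p^f.[iter n s' b].
      by rewrite -horner_map -map_poly_comp; congr (_.[_]); apply: eq_map_poly => k; rewrite [RHS]sf.
    by rewrite (rootP IHn) rmorph0.
  have itinj j : injective (iter j s') by elim: j => //= j IHj x y /sinj/IHj.
  have sp0 : (0 < size p^f)%N by rewrite size_poly_gt0 map_poly_eq0 separable_poly_neq0.
  have : ~~ uniq (traject s' b (size p^f)).
    apply/negP => u; have := @max_poly_roots _ p^f (traject s' b (size p^f)).
    rewrite map_poly_eq0 separable_poly_neq0 // u size_traject ltnn => h.
    suff : false by []; apply: h => //; apply/allP => x /trajectP[i _ ->]; exact: proot.
  rewrite -(prednK sp0) looping_uniq negbK => /trajectP[i ilt e].
  exists (iter ((size p^f).-1 - i).-1 s' b); apply: (itinj i).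
  rewrite -iterS prednK ?subn_gt0 // -iterD subnKC //; exact: ltnW.
exists (fun b => projT1 (cid (surj b))) => b; last by case: cid.
by apply: sinj; case: cid.
Qed.

(** If [a] is not in K, its minimal polynomial is separable of degree at least two and has another
    root [a']. The graph [G0] of the morphism from K[a] that sends [a] to [a'] extends to an
    automorphism, which moves [a]. *)
Theorem galois_fixed (a : L) :
  (forall s : {rmorphism L -> L}, galois_aut f s -> s a = a) -> exists k, a = f k.
Proof.
move=> fixa; apply: contrapT => nK.
have [p [p0 pa] pmin] : exists2 p : {poly K}, p != 0 /\ root p^f a &
    forall q, q != 0 /\ root q^f a -> (size p <= size q)%N.
  apply: min_size_poly; have [p sp pa] := algL a; exists p; split=> //.
  exact: separable_poly_neq0.
have pdvd q : root q^f a -> p %| q.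
  move=> qa; rewrite /dvdp; apply/negPn/negP => r0.
  have : root (q %% p)^f a.
    have := congr1 (fun r => r^f.[a]) (divp_eq q p).
    rewrite rmorphD rmorphM /= !hornerE (rootP qa) (rootP pa) mulr0 add0r => e.
    by apply/rootP.
  by move=> ra; have := pmin _ (conj r0 ra); rewrite leqNgt ltn_modp p0.
have [q sq qa] := algL a.
have sepp : separable_poly p by apply: dvdp_separable (pdvd q qa) sq.
have [r rE] := factor_theorem _ _ pa.
have : separable_poly p^f by rewrite separable_map.
rewrite rE separable_root => /andP[sepr ra].
have pf0 : p^f != 0 by rewrite map_poly_eq0.
have r0 : r != 0 by apply: contra_neq pf0 => r0; rewrite rE r0 mul0r.
have szr : (1 < size r)%N.
  rewrite ltnNge; apply/negP => s1; apply: nK.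
  have szp : size p = 2%N.
    have := size_map_poly f p; rewrite rE size_Mmonic ?monicXsubC // size_XsubC.
    by move: s1 r0; rewrite -size_poly_gt0; move: (size r) (size p) => u v; lia.
  have p1 : p`_1 != 0 by have := lead_coef_eq0 p; rewrite /lead_coef szp /= => ->.
  have : p^f.[a] = 0 by exact/rootP.
  rewrite (@horner_coef_wide _ 2) ?size_map_poly ?szp // !big_ord_recl big_ord0 /=.
  rewrite !coef_map expr0 mulr1 expr1 addr0 => e.
  exists (- p`_0 / p`_1); rewrite rmorphM fmorphV rmorphN.
  apply: (canRL (mulfK _)); first by rewrite fmorph_eq0.
  by apply/eqP; rewrite mulrC -addr_eq0 addrC e.
have [a' ra'] := closedL sepr szr.
have aa' : a' != a by apply: contraNneq ra => <-.
have pa' : p^f.[a'] = 0 by rewrite rE hornerM (rootP ra') mul0r.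
pose G0 := [set ab | exists q : {poly K}, ab = (q^f.[a], q^f.[a'])]%classic.
have mG0 : morphism_graph G0.
  split.
  - by move=> k; exists k%:P; rewrite map_polyC !hornerC.
  - by move=> _ _ _ _ [q1 [-> ->]] [q2 [-> ->]]; exists (q1 - q2); rewrite rmorphB !hornerE.
  - by move=> _ _ _ _ [q1 [-> ->]] [q2 [-> ->]]; exists (q1 * q2); rewrite rmorphM !hornerE.
  - move=> b [q1 [e ->]]; have /dvdpP[u ->] : p %| q1 by apply/pdvd/rootP.
    by rewrite rmorphM hornerM pa' mulr0.
have [G [mG sG tot]] := total_graph mG0.
have [s gs hs] := graph_automorphism mG tot.
have : G (a, a') by apply: sG; exists 'X; rewrite map_polyX !hornerX.
by move=> /(morphism_graph_uniq mG (hs a)); rewrite fixa // => e; rewrite e eqxx in aa'.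
Qed.

End AutomorphismExtension.

(** * Elliptic systems and their folding *)

Section EllipticSystem.
Variables (K L : fieldType) (f : {rmorphism K -> L}).
Hypothesis K2 : (2%:R : K) != 0.
Implicit Types (U X : nat -> L) (n a b k l : nat).

Definition wsum U a k : L := \sum_(q < a) U (k + q)%N.

(* With P_k = b - k t for t of order n, U k and X k stand for u_0(P_k) and
   x(P_k), so that u_l(P_k) = U (k + l), and [wsum U a] is the sum of u_0, ...,
   u_(a-1), with simple poles at 0 and a t.  The fields [es_mul], [es_sqr] and
   [es_mulX] are multiplication rules that only depend on the poles of the
   factors; [es_half] says that the function of [wsum U T] that changes sign
   under the translation by T t, for n = 2 T, does not vanish at the P_k. *)
Record ellsys (n : nat) (U X : nat -> L) : Prop := EllSys {
  es_gt0 : (0 < n)%N;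
  es_perU : forall k, U (k + n)%N = U k;
  es_perX : forall k, X (k + n)%N = X k;
  es_sum : forall k, wsum U n k = 1;
  es_free : forall e : nat -> K, (forall k, \sum_(l < n) f (e l) * U (k + l)%N = 0) ->
    forall l, (l < n)%N -> e l = 0;
  es_span : exists xi : nat -> K, forall k, X k = \sum_(l < n) f (xi l) * U (k + l)%N;
  es_mul : forall a b, (0 < a < n)%N -> (0 < b < n)%N -> a != b ->
    exists c0 c1 c2 : K, forall k,
      wsum U a k * wsum U b k = X k + f c0 + f c1 * wsum U a k + f c2 * wsum U b k;
  es_sqr : forall a, (0 < a < n)%N ->
    exists c0 c1 : K, forall k,
      wsum U a k ^+ 2 = X k + X (k + a)%N + f c0 + f c1 * wsum U a k;
  es_mulX : forall i j, (0 < i)%N -> (i < j < n)%N ->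
    exists c0 c1 c2 c3 : K, forall k,
      X k * (wsum U j k - wsum U i k) =
      f c0 + f c1 * X k + f c2 * wsum U i k + f c3 * wsum U j k;
  es_half : forall T, n = (T + T)%N -> forall k, wsum U T k != f 2%:R^-1 }.

Lemma wsumD U a b k : wsum U (a + b) k = wsum U a k + wsum U b (k + a)%N.
Proof.
rewrite /wsum big_split_ord /=; congr (_ + _).
by apply: eq_bigr => i _; rewrite addnA.
Qed.

Section Step.
Variables (T : nat) (U X : nat -> L).
Hypothesis sys : ellsys (T + T) U X.

(* The trace to the quotient of the curve by the 2-torsion point T t. *)
Definition fold_shift (g : nat -> L) k := g k + g (k + T)%N.
Local Notation U' := (fold_shift U).
Local Notation X' := (fold_shift X).
Local Notation A := (wsum U).
Local Notation A' := (wsum U').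
Local Notation h := (2%:R^-1 : K).

Let T0 : (0 < T)%N. Proof. by have := es_gt0 sys; case: T. Qed.

Lemma wsum_per a k : A a (k + T + T)%N = A a k.
Proof.
apply: eq_bigr => i _; rewrite -(es_perU sys (k + i)).
by congr (U _); lia.
Qed.

Lemma perX2 k : X (k + T + T)%N = X k. Proof. by rewrite -addnA (es_perX sys). Qed.

Lemma wsum_fold a k : A' a k = A a k + A a (k + T)%N.
Proof. by rewrite /wsum -big_split; apply: eq_bigr => i _; rewrite /fold_shift /= addnAC. Qed.

Lemma wsum_half k : A T (k + T)%N = 1 - A T k.
Proof. by rewrite -(es_sum sys k) wsumD addrC addKr. Qed.

Lemma wsum_halfD a k : A (T + a) k = A T k + A a (k + T)%N. Proof. exact: wsumD. Qed.

Lemma wsum_halfD' a k : A (T + a) (k + T)%N = 1 - A T k + A a k.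
Proof. by rewrite wsumD wsum_per wsum_half. Qed.

Lemma two_neq0 : (2%:R : L) != 0. Proof. by rewrite -(rmorph_nat f) fmorph_eq0. Qed.

Lemma half_double : f h * 2%:R = 1.
Proof. by rewrite -(rmorph_nat f) -rmorphM mulVf // rmorph1. Qed.

(** The cross term [wsum U a k * wsum U b (k + T)] is the difference of the products of [wsum U a]
    by [wsum U (T + b)] and by [wsum U T], in which [X] cancels; the direct terms supply [X']. The
    rules [fold_sqr] and [fold_mulX] also obtain their cross terms from indices shifted by [T]. *)
Lemma fold_mul a b : (0 < a < T)%N -> (0 < b < T)%N -> a != b ->
  exists c0 c1 c2 : K, forall k,
    A' a k * A' b k = X' k + f c0 + f c1 * A' a k + f c2 * A' b k.
Proof.
move=> ha hb ab.
have [||//|a0 [a1 [a2 e1]]] := @es_mul _ _ _ sys a b; [lia|lia|].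
have [|||b0 [b1 [b2 e2]]] := @es_mul _ _ _ sys a (T + b); [lia|lia|lia|].
have [|||g0 [g1 [g2 e3]]] := @es_mul _ _ _ sys a T; [lia|lia|lia|].
exists (2%:R * (a0 + b0 - g0) + b2 - g2), (a1 + b1 - g1), (a2 + b2) => k.
rewrite !wsum_fold /fold_shift.
have := e3 k; have := e3 (k + T)%N; have := e2 k; have := e2 (k + T)%N.
have := e1 k; have := e1 (k + T)%N.
rewrite wsum_halfD' wsum_halfD wsum_half.
move: (A a k) (A a (k + T)) (A b k) (A b (k + T)) (A T k) (X k) (X (k + T)) => u u' v v' t x x'.
move=> e1' {}e1 e2' {}e2 e3' {}e3.
transitivity (u * v + u' * v' + (u * (t + v') - u * t) + (u' * (1 - t + v) - u' * (1 - t))); first by ring.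
by rewrite e1 e1' e2 e2' e3 e3'; ring.
Qed.

Lemma fold_sqr a : (0 < a < T)%N ->
  exists c0 c1 : K, forall k,
    A' a k ^+ 2 = X' k + X' (k + a)%N + f c0 + f c1 * A' a k.
Proof.
move=> ha.
have [|a0 [a1 e1]] := @es_sqr _ _ _ sys a; first by lia.
have [|||b0 [b1 [b2 e2]]] := @es_mul _ _ _ sys a (T + a); [lia|lia|lia|].
have [|||g0 [g1 [g2 e3]]] := @es_mul _ _ _ sys a T; [lia|lia|lia|].
exists (2%:R * (a0 + b0 - g0) + b2 - g2), (a1 + b1 - g1 + b2) => k.
rewrite !wsum_fold /fold_shift.
have := e3 k; have := e3 (k + T)%N; have := e2 k; have := e2 (k + T)%N.
have := e1 k; have := e1 (k + T)%N.
rewrite wsum_halfD' wsum_halfD wsum_half [(k + T + a)%N]addnAC.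
move: (A a k) (A a (k + T)) (A T k) (X k) (X (k + T)) (X (k + a)) (X (k + a + T)) => u u' t x x' y y'.
move=> e1' {}e1 e2' {}e2 e3' {}e3.
transitivity (u ^+ 2 + u' ^+ 2 + (u * (t + u') - u * t) + (u' * (1 - t + u) - u' * (1 - t))); first by ring.
by rewrite e1 e1' e2 e2' e3 e3'; ring.
Qed.

Lemma fold_mulX i j : (0 < i)%N -> (i < j < T)%N ->
  exists c0 c1 c2 c3 : K, forall k,
    X' k * (A' j k - A' i k) = f c0 + f c1 * X' k + f c2 * A' i k + f c3 * A' j k.
Proof.
move=> i0 ij.
have [||a0 [a1 [a2 [a3 e1]]]] := @es_mulX _ _ _ sys i j; [lia|lia|].
have [||b0 [b1 [b2 [b3 e2]]]] := @es_mulX _ _ _ sys (T + i) (T + j); [lia|lia|].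
exists (2%:R * (a0 + b0) + b2 + b3), (a1 + b1), (a2 + b2), (a3 + b3) => k.
rewrite !wsum_fold /fold_shift.
have := e2 k; have := e2 (k + T)%N; have := e1 k; have := e1 (k + T)%N.
rewrite !wsum_halfD' !wsum_halfD.
move: (A i k) (A i (k + T)) (A j k) (A j (k + T)) (A T k) (X k) (X (k + T)) => u u' v v' t x x'.
move=> e1' {}e1 e2' {}e2.
transitivity (x * (v - u) + x' * (v' - u') + x * (t + v' - (t + u')) + x' * (1 - t + v - (1 - t + u))); first by ring.
by rewrite e1 e1' e2 e2'; ring.
Qed.

(** The values of [wsum U T] at [k] and [k + T] add up to 1; centring at 1/2 makes them opposite. *)
Definition zfun k : L := A T k - f h.

Lemma zfun_neq0 k : zfun k != 0. Proof. by rewrite subr_eq0 (es_half sys). Qed.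

Lemma zfunT k : zfun (k + T)%N = - zfun k.
Proof.
by rewrite /zfun wsum_half opprB -[X in X - _ - _]half_double; ring.
Qed.

(** [X] cancels between the products of [wsum U T] by [wsum U (T + l)] and by [wsum U l]. Both
    factors change sign under [k -> k + T], so the product equals its average over [k] and [k + T],
    where only folded functions remain. *)
Lemma zfun_mul l : (0 < l < T)%N -> exists c0 c1 : K, forall k,
  zfun k * zfun (k + l)%N = f c1 * A' l k + f c0.
Proof.
move=> hl.
have [|||a0 [a1 [a2 e1]]] := @es_mul _ _ _ sys T (T + l); [lia|lia|lia|].
have [|||b0 [b1 [b2 e2]]] := @es_mul _ _ _ sys T l; [lia|lia|lia|].
exists (a0 - b0 + h * (a1 - b1 + a2 - h)), (h * (a2 - b2)) => k.
have zE k' : zfun (k' + l)%N = A (T + l) k' - A l k' - f h.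
  by rewrite [(T + l)%N]addnC wsumD [A l k' + _]addrC addrK.
have E k' : zfun k' * zfun (k' + l)%N = f (a0 - b0) + f (a1 - b1) * A T k' +
   f a2 * A (T + l) k' - f b2 * A l k' - f h * (A T k' + A (T + l) k' - A l k') + f h ^+ 2.
  rewrite zE /zfun.
  transitivity (A T k' * A (T + l) k' - A T k' * A l k' - f h * (A T k' + A (T + l) k' - A l k') + f h ^+ 2).
    by ring.
  by rewrite e1 e2; ring.
have E2 : zfun k * zfun (k + l)%N = f h * (zfun k * zfun (k + l)%N + zfun (k + T) * zfun (k + T + l)).
  by rewrite addnAC !zfunT mulrNN -[LHS]mul1r -half_double; ring.
rewrite E2 !E wsum_fold wsum_halfD' wsum_halfD wsum_half.
move: (A l k) (A l (k + T)) (A T k) => u u' t.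
by field; exact: two_neq0.
Qed.

Lemma zfun_sqr : exists c : K, forall k, zfun k ^+ 2 = X' k + f c.
Proof.
have [|a0 [a1 e1]] := @es_sqr _ _ _ sys T; first by lia.
exists (a0 + h * (a1 - 1) + h ^+ 2) => k.
have E k' : zfun k' ^+ 2 = X' k' + f a0 + (f a1 - 1) * A T k' + f h ^+ 2.
  transitivity (A T k' ^+ 2 - f h * 2%:R * A T k' + f h ^+ 2); first by rewrite /zfun; ring.
  by rewrite e1 half_double /fold_shift; ring.
have E2 : zfun k ^+ 2 = f h * (zfun k ^+ 2 + zfun (k + T) ^+ 2).
  by rewrite zfunT sqrrN -[LHS]mul1r -half_double; ring.
have X'T : X' (k + T)%N = X' k by rewrite /fold_shift perX2 addrC.
rewrite E2 !E X'T wsum_half; move: (A T k) (X' k) => t x.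
by field; exact: two_neq0.
Qed.

(** Seen from [k + l], [zfun k] is up to a constant the difference of the partial sums of lengths
    [T - l] and [2 T - l], to which [es_mulX] applies. The bounds on [l] keep the double poles of
    the second factor away from the poles of [zfun k]. *)
Lemma zfun_mulX l : (0 < l < T)%N -> exists c0 c1 c2 : K, forall k,
  zfun k * (X (k + l)%N - X (k + l + T)%N) = f c2 * X' (k + l)%N + f c1 * A' l k + f c0.
Proof.
move=> hl.
have [||c0 [c1 [c2 [c3 e]]]] := @es_mulX _ _ _ sys (T - l) (T - l + T); [lia|lia|].
exists (- (2%:R * c0 + c2 + 2%:R * c3)), (c2 + c3), (h - c1) => k.
have A1 k' : A (T - l) (k' + l) = A T k' - A l k'.
  have TE : T = (l + (T - l))%N by lia.
  by rewrite [in A T k']TE wsumD addrC addKr.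
have A2 k' : A (T - l + T) (k' + l) = 1 - A l k'.
  rewrite wsumD A1 -(addnA k') subnKC; last by lia.
  by rewrite wsum_half; ring.
have zE k' : zfun k' = A (T - l) (k' + l) - A (T - l + T) (k' + l) + f h.
  by rewrite A1 A2 /zfun -[X in _ - (X - _)]half_double; ring.
have E k' : zfun k' * X (k' + l)%N = f h * X (k' + l)%N -
   (f c0 + f c1 * X (k' + l)%N + f c2 * (A T k' - A l k') + f c3 * (1 - A l k')).
  by rewrite -A1 -A2 -e zE; ring.
transitivity (zfun k * X (k + l)%N + zfun (k + T) * X (k + T + l)%N).
  by rewrite zfunT addnAC; ring.
rewrite !E wsum_fold wsum_half /fold_shift [(k + T + l)%N]addnAC.
by move: (A T k) (A l k) (A l (k + T)) (X _) (X _) => t u u' x x'; ring.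
Qed.

Lemma window m k : (m <= T)%N ->
  A T (k + m)%N = \sum_(l < T + T) f ((m <= l < m + T)%:R) * U (k + l)%N.
Proof.
move=> mT; rewrite /wsum -(big_mkord xpredT (fun q => U (k + m + q)%N)).
rewrite -(big_mkord xpredT (fun l => f (m <= l < m + T)%:R * U (k + l)%N)).
rewrite [RHS](@big_cat_nat _ _ _ m) //=; last by lia.
rewrite [X in _ = _ + X](@big_cat_nat _ _ _ (m + T)) //=; [|lia|lia].
rewrite [X in _ = X + _]big_nat_cond [X in _ = X + _]big1 ?add0r; last first.
  by move=> i /andP[/andP[_ im] _]; rewrite leqNgt im /= rmorph0 mul0r.
rewrite [X in _ = _ + X]big_nat_cond [X in _ = _ + X]big1 ?addr0; last first.
  by move=> i /andP[/andP[im _] _]; rewrite [(i < _)%N]ltnNge im andbF rmorph0 mul0r.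
rewrite -{2}[m]add0n [(m + T)%N]addnC big_addn addnK; apply: eq_big_nat => i /andP[_ iT].
by rewrite leq_addl ltn_add2r iT rmorph1 mul1r; congr (U _); lia.
Qed.

Lemma window0 k : A T k = \sum_(l < T + T) f ((l < T)%:R) * U (k + l)%N.
Proof. by have := window k (leq0n T); rewrite addn0 => ->. Qed.

(* If c1 = 0, then zfun k = zfun (k + 2 l) because zfun has no zero, and zfun
   would have a period that its poles do not have. *)
Lemma zfun_mul_neq0 l c0 c1 : (0 < l < T)%N ->
  (forall k, zfun k * zfun (k + l)%N = f c1 * A' l k + f c0) -> c1 != 0.
Proof.
move=> hl e; apply/eqP => c10.
have E k : zfun (k + l + l)%N = zfun k.
  apply: (mulfI (zfun_neq0 (k + l))); have := e (k + l)%N; rewrite c10 rmorph0 mul0r add0r => ->.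
  by rewrite mulrC e c10 rmorph0 mul0r add0r.
(* If [2 l = T], the period contradicts the change of sign. Otherwise it is a linear relation
   between shifts of [U], with coefficient 1 at index [2 l - T] or at index 0, against [es_free]. *)
have [lT|lT|lT] := ltngtP (l + l) T; last first.
- have := E 0%N; rewrite -addnA lT zfunT => /eqP; rewrite eq_sym -addr_eq0.
  by rewrite -mulr2n -mulr_natl mulf_eq0 (negPf two_neq0) (negPf (zfun_neq0 _)).
- pose m := (l + l - T)%N; have mT : (0 < m <= T)%N by rewrite /m; lia.
  suff : (m < T)%N%:R + (m <= m < m + T)%:R - 1 = 0 :> K.
    have -> : (m < T)%N = true by rewrite /m; lia.
    have -> : (m <= m < m + T)%N = true by lia.
    by rewrite addrK => /eqP; rewrite oner_eq0.
  apply: (@es_free _ _ _ sys (fun i => (i < T)%N%:R + (m <= i < m + T)%:R - 1)); last by lia.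
  move=> k; under eq_bigr do rewrite rmorphB rmorphD rmorph1 mulrBl mulrDl mul1r.
  rewrite !big_split /= sumrN -window0 -window; last by lia.
  have -> : \sum_(i < T + T) U (k + i)%N = 1 := es_sum sys k.
  have := E k; rewrite -addnA (_ : (l + l = m + T)%N); last by rewrite /m; lia.
  rewrite addnA zfunT /zfun => /eqP; rewrite -subr_eq0 => /eqP e1.
  transitivity (- (- (A T (k + m) - f h) - (A T k - f h)) + (f h * 2%:R - 1)); first by ring.
  by rewrite e1 half_double; ring.
have lT' : (l + l <= T)%N by exact: ltnW.
suff : (0 < T)%N%:R - (l + l <= 0 < l + l + T)%N%:R = 0 :> K.
  have -> : (l + l <= 0 < l + l + T)%N = false by lia.
  by rewrite T0 subr0 => /eqP; rewrite oner_eq0.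
apply: (@es_free _ _ _ sys (fun i => (i < T)%N%:R - (l + l <= i < l + l + T)%N%:R)); last by lia.
move=> k; under eq_bigr do rewrite rmorphB mulrBl.
rewrite big_split /= sumrN -window0 -window //.
have := E k; rewrite /zfun -addnA => /(addIr _) ->; exact: subrr.
Qed.

Lemma perX' k : X' (k + T)%N = X' k.
Proof. by rewrite /fold_shift perX2 addrC. Qed.

Lemma perU' k : U' (k + T)%N = U' k.
Proof. by rewrite /fold_shift -addnA (es_perU sys) addrC. Qed.

Lemma sum_fold (e : nat -> L) (g : nat -> L) k :
  \sum_(l < T) e l * fold_shift g (k + l)%N =
  \sum_(l < T + T) e (if (l < T)%N then l : nat else (l - T)%N) * g (k + l)%N.
Proof.
rewrite big_split_ord /= -big_split /=; apply: eq_bigr => i _.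
by rewrite /fold_shift ltn_ord ltnNge leq_addr /= mulrDr addKn; congr (_ + _ * g _); lia.
Qed.

Lemma sum_unfold (e : nat -> L) k :
  \sum_(l < T + T) e l * U' (k + l)%N = \sum_(l < T) (e l + e (l + T)%N) * U' (k + l)%N.
Proof.
rewrite big_split_ord /= -big_split /=; apply: eq_bigr => i _.
by rewrite [(T + i)%N]addnC addnA perU' mulrDl.
Qed.

Lemma ellsys_fold : ellsys T U' X'.
Proof.
split; [exact: T0|exact: perU'|exact: perX'| | | |exact: fold_mul|exact: fold_sqr|exact: fold_mulX|].
- by move=> k; rewrite wsum_fold -wsumD (es_sum sys).
- move=> e e0 l lT.
  have := @es_free _ _ _ sys (fun l => e (if (l < T)%N then l : nat else (l - T)%N)) _ l _.
  rewrite lT; apply; last by lia.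
  by move=> k; rewrite -[RHS](e0 k) (sum_fold (fun l => f (e l))).
- have [xi xiE] := es_span sys; exists (fun l => xi l + xi (l + T)%N) => k.
  under eq_bigr do rewrite rmorphD.
  rewrite -(sum_unfold (fun l => f (xi l))) /fold_shift !xiE -big_split.
  by apply: eq_bigr => i _; rewrite /= mulrDr addnAC.
(* If [A' S] is 1/2 at [k], it is 1/2 at [k + S] too, so [zfun k * zfun (k + S)] takes the same
   value at both places; but [zfun (k + 2 S) = - zfun k] makes these values opposite, hence zero. *)
move=> S TS k; apply/eqP => e.
have S0 : (0 < S < T)%N by move: T0; rewrite TS; lia.
have [c0 [c1 E]] := zfun_mul S0.
have e' : A' S (k + S)%N = f h.
  have : A' S k + A' S (k + S)%N = 1 by rewrite -wsumD -TS wsum_fold -wsumD (es_sum sys).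
  by rewrite e => h1; apply: (addrI (f h)); rewrite h1 -half_double; ring.
have := E (k + S)%N; rewrite e' -addnA -TS zfunT mulrN -e mulrC -E => /eqP.
rewrite eq_sym -addr_eq0 -mulr2n -mulr_natl !mulf_eq0.
by rewrite (negPf two_neq0) !(negPf (zfun_neq0 _)).
Qed.

Lemma zfun_window m k : (m <= T)%N ->
  zfun (k + m)%N = \sum_(l < T) (f ((m <= l)%:R) - f h) * (U (k + l)%N - U (k + l + T)%N).
Proof.
move=> mT; rewrite /zfun (window _ mT).
have {1}-> : f h = \sum_(l < T + T) f h * U (k + l)%N
  by rewrite -mulr_sumr -[X in _ * X]/(A (T + T) k) (es_sum sys k) mulr1.
rewrite -sumrB big_split_ord /= -big_split /=; apply: eq_bigr => i _.
have -> : (m <= i < m + T)%N = (m <= i)%N by have := ltn_ord i; lia.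
have -> : (m <= T + i < m + T)%N = ~~ (m <= i)%N by lia.
rewrite addnA [(k + T + i)%N]addnAC; move: (U _) (U _) => u v.
by case: (m <= i)%N; rewrite /= ?rmorph0 ?rmorph1; field; exact: two_neq0.
Qed.

Lemma zfunS k : zfun k - zfun k.+1 = U k - U (k + T)%N.
Proof.
have wsum1 k' : A 1 k' = U k' by rewrite /wsum big_ord1 addn0.
have := wsumD U 1 T k; rewrite addnC wsumD !wsum1 addn1 /zfun => e.
by apply/eqP; rewrite -subr_eq0; apply/eqP; rewrite -(subrr (A T k + U (k + T)%N)) {2}e; ring.
Qed.

Lemma sum_by_parts (a z : nat -> L) (c : L) n : (0 < n)%N ->
  \sum_(l < n) a l * (z l - z l.+1) + a n.-1 * z n + c * z 0%N =
  \sum_(l < n) (if l : nat is l'.+1 then a l'.+1 - a l' else a 0%N + c) * z l.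
Proof.
elim: n => // -[|n] IHn _; first by rewrite !big_ord1 /=; ring.
rewrite big_ord_recr [RHS]big_ord_recr -IHn //=; ring.
Qed.

Lemma zfun_span : exists theta : nat -> K, forall k,
  X k - X (k + T)%N = \sum_(m < T) f (theta m) * zfun (k + m)%N.
Proof.
have [xi xiE] := es_span sys.
pose w l := xi l - xi (l + T)%N.
have E k : X k - X (k + T)%N = \sum_(l < T) f (w l) * (zfun (k + l)%N - zfun (k + l).+1).
  rewrite !xiE -sumrB big_split_ord /= -big_split /=; apply: eq_bigr => i _.
  have -> : zfun (k + i)%N - zfun (k + i).+1 = U (k + i)%N - U (k + i + T)%N.
    exact: zfunS.
  rewrite [(k + (T + i))%N]addnA addnAC -[(k + T + (T + i))%N]addnA [(T + (T + i))%N]addnA.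
  rewrite [(T + T + i)%N]addnC addnA (es_perU sys) /w rmorphB [(i + T)%N]addnC; ring.
(* The coefficients after summation by parts. The boundary term at [T] returns to index 0 with the
   opposite sign, whence the extra [w T.-1]. *)
pose theta m := if m is m'.+1 then w m - w m' else w 0%N + w T.-1.
exists theta => k.
rewrite E; under eq_bigr do rewrite -addnS.
have := @sum_by_parts (f \o w) (fun l => zfun (k + l)%N) (f (w T.-1)) T T0.
rewrite /= zfunT mulrN addn0 subrK => ->.
by apply: eq_bigr => -[[|m] mT] _; rewrite /theta /= -?rmorphB -?rmorphD.
Qed.

Lemma zfun_sum_shift (theta : nat -> K) l k : (l < T)%N ->
  \sum_(m < T) f (theta m) * zfun (k + l + m)%N =
  \sum_(m < T) f (if (l <= m)%N then theta (m - l)%N else - theta (m + T - l)%N) * zfun (k + m)%N.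
Proof.
move=> lT; rewrite -(big_mkord xpredT (fun m => f (theta m) * zfun (k + l + m)%N)).
rewrite -(big_mkord xpredT (fun m => f (if (l <= m)%N then theta (m - l)%N
  else - theta (m + T - l)%N) * zfun (k + m)%N)).
rewrite (@big_cat_nat _ _ _ (T - l)) //=; last by lia.
rewrite [RHS](@big_cat_nat _ _ _ l) //=; last by lia.
rewrite addrC; congr (_ + _).
  have -> : \sum_(T - l <= i < T) f (theta i) * zfun (k + l + i)%N =
     \sum_(0 + (T - l) <= i < l + (T - l)) f (theta i) * zfun (k + l + i)%N.
    by congr bigop; congr index_iota; lia.
  rewrite big_addn addnK; apply: eq_big_nat => i /andP[_ il].
  rewrite ifN -?ltnNge // rmorphN mulNr -mulrN -zfunT.
  by congr (f (theta _) * zfun _); lia.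
have -> : \sum_(l <= i < T) f (if (l <= i)%N then theta (i - l)%N else - theta (i + T - l)%N) * zfun (k + i)%N =
   \sum_(0 + l <= i < (T - l) + l) f (if (l <= i)%N then theta (i - l)%N else - theta (i + T - l)%N) * zfun (k + i)%N.
  by congr bigop; congr index_iota; lia.
rewrite big_addn addnK; apply: eq_big_nat => i _.
by rewrite leq_addl addnK [(i + l)%N]addnC addnA.
Qed.

Lemma wsum_fold_window m k : (m <= T)%N ->
  A' m k = \sum_(l < T) f ((l < m)%:R) * U' (k + l)%N.
Proof.
move=> mT; rewrite /wsum -(big_mkord xpredT (fun q => U' (k + q)%N)).
rewrite -(big_mkord xpredT (fun l => f (l < m)%:R * U' (k + l)%N)).
rewrite [RHS](@big_cat_nat _ _ _ m) //= [X in _ = _ + X]big_nat_cond [X in _ = _ + X]big1 ?addr0.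
  by apply: eq_big_nat => i /andP[_ ->]; rewrite rmorph1 mul1r.
by move=> i /andP[/andP[mi _] _]; rewrite ltnNge mi rmorph0 mul0r.
Qed.

Lemma wsum_fold_sum (g : nat -> K) k :
  \sum_(l < T) f (\sum_(m < T) g m * (l < m)%:R) * U' (k + l)%N =
  \sum_(m < T) f (g m) * A' m k.
Proof.
under eq_bigr => l _ do rewrite rmorph_sum mulr_suml.
rewrite exchange_big; apply: eq_bigr => m _ /=.
rewrite wsum_fold_window ?mulr_sumr; last exact: ltnW.
by apply: eq_bigr => l _; rewrite rmorphM mulrA.
Qed.

(** By [wsum_fold_sum], passing from partial sums to the [U'] turns coefficients into suffix sums;
    consecutive differences undo this. *)
Lemma sum_gtn_pred (g : nat -> K) m : (0 < m < T)%N ->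
  \sum_(i < T) g i * (m.-1 < i)%:R = g m + \sum_(i < T) g i * (m < i)%:R.
Proof.
move=> /andP[m0 mT]; rewrite prednK // (bigD1 (Ordinal mT)) //= leqnn mulr1; congr (_ + _).
rewrite [RHS](bigD1 (Ordinal mT)) //= ltnn mulr0 add0r; apply: eq_bigr => i im.
by move: im; rewrite -val_eqE leq_eqVlt [m == i]eq_sym /= => /negPf ->.
Qed.

(* Multiplication by [zfun] turns the antisymmetric problem into the folded one,
   up to a sparse change of basis; this determines all the coefficients but the
   first one, which is computed separately as a linear form in F. *)
Lemma antisymmetric_solve : exists a p q s v kappa theta : nat -> K,
  forall F r : nat -> K,
  (forall k, \sum_(l < T) f (r l) * U' (k + l)%N = \sum_(l < T) f (a l * F l) * X' (k + l)%N) ->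
  forall k, \sum_(m < T) f (p m * r m.-1 + q m * r m + s m * F m
       + v m * (\sum_(l < T) kappa l * F l) + theta m * F 0%N) * zfun (k + m)%N =
    \sum_(l < T) f (F l) * (X (k + l)%N - X (k + l + T)%N).
Proof.
have [theta thetaE] := zfun_span.
pose Theta l m := if (l <= m)%N then theta (m - l)%N else - theta (m + T - l)%N.
have [g gE] := zfun_sqr.
have /choice[cz czE] l : exists c : K * K, (0 < l < T)%N -> forall k,
    zfun k * zfun (k + l)%N = f c.1 * A' l k + f c.2.
  have [hl|] := boolP (0 < l < T)%N; last by exists (0, 0).
  by have [c0 [c1 e]] := zfun_mul hl; exists (c1, c0).
have /choice[cx cxE] l : exists c : K * K * K, (0 < l < T)%N -> forall k,
    zfun k * (X (k + l)%N - X (k + l + T)%N) = f c.1.1 * X' (k + l)%N + f c.1.2 * A' l k + f c.2.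
  have [hl|] := boolP (0 < l < T)%N; last by exists (0, 0, 0).
  by have [c0 [c1 [c2 e]]] := zfun_mulX hl; exists (c2, c1, c0).
have [xi xiE] := es_span ellsys_fold.
(* The values at [m = 0] let [zzE] include [zfun_sqr], where [X'] replaces the partial sum. *)
pose al (m : nat) := if m == 0%N then 0 else (cz m).1.
pose ga (m : nat) := if m == 0%N then g else (cz m).2.
pose x0 (m : nat) : K := (m == 0%N)%:R.
have zzE m k : (m < T)%N -> zfun k * zfun (k + m)%N = f (x0 m) * X' k + f (al m) * A' m k + f (ga m).
  move=> mT; rewrite /x0 /al /ga; case: m mT => [|m] mT /=.
    by rewrite addn0 -expr2 gE rmorph1 rmorph0; ring.
  by rewrite czE // rmorph0; ring.
pose a l := if l == 0%N then 0 else (cx l).1.1.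
pose b l := if l == 0%N then 0 else (cx l).1.2.
pose c l := if l == 0%N then 0 else (cx l).2.
pose kappa l := if l == 0%N then 0 else Theta l 0%N.
pose eta m := xi m.-1 - xi m.
have al0 m : (0 < m < T)%N -> al m != 0.
  move=> hm; rewrite /al ifN; last by lia.
  exact: (zfun_mul_neq0 hm (czE m hm)).
exists a, (fun m => if m == 0%N then 0 else (al m)^-1), (fun m => if m == 0%N then 0 else - (al m)^-1),
  (fun m => if m == 0%N then 0 else b m / al m),
  (fun m => if m == 0%N then 1 else - eta m / al m), kappa, theta => F r rE k.
(* The term [l = 0] is set aside, since [zfun k * X k] has a pole of order three; it is restored at
   the end through [theta]. *)
pose F' l := if l == 0%N then 0 else F l.
pose phi m := \sum_(l < T) F' l * Theta l m.
have phiE k' : \sum_(m < T) f (phi m) * zfun (k' + m)%N =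
    \sum_(l < T) f (F' l) * (X (k' + l)%N - X (k' + l + T)%N).
  under [RHS]eq_bigr => l _ do rewrite thetaE zfun_sum_shift // mulr_sumr.
  rewrite exchange_big; apply: eq_bigr => m _.
  rewrite /phi rmorph_sum mulr_suml; apply: eq_bigr => l _ /=.
  by rewrite rmorphM mulrA.
have phi0 : \sum_(l < T) kappa l * F l = phi 0%N.
  by apply: eq_bigr => l _; rewrite /kappa /F'; case: eqP => _; rewrite ?mul0r // mulrC.
(* Index 0 is out of reach because [al 0 = 0]; the coefficient [phi 0] is the linear form of
   [phi0]. *)
have comp m : (0 < m < T)%N -> al m * phi m = r m.-1 - r m + b m * F m - phi 0%N * eta m.
  move=> hm.
  pose C := \sum_(m < T) phi m * ga m - \sum_(l < T) F l * c l.
  (* The coefficient of [U' (k' + l)] in [zfun k'] times the difference of the two sides of [phiE];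
     the constant [C] occurs at every index because the [U'] sum to 1. The difference of two
     consecutive coefficients isolates [phi m]. *)
  pose e l := phi 0%N * xi l + \sum_(m < T) phi m * al m * (l < m)%:R - r l
     - \sum_(m < T) F m * b m * (l < m)%:R + C.
  have e0 l : (l < T)%N -> e l = 0.
    apply: (es_free ellsys_fold) => k'.
    have UC : \sum_(l < T) f C * U' (k' + l)%N = f C.
      by rewrite -mulr_sumr (_ : \sum_(l < T) _ = 1) ?mulr1 //; apply: es_sum ellsys_fold k'.
    transitivity (zfun k' * \sum_(m < T) f (phi m) * zfun (k' + m)%N -
        zfun k' * \sum_(l < T) f (F' l) * (X (k' + l)%N - X (k' + l + T)%N)); last by rewrite phiE subrr.
    have lhsE : zfun k' * (\sum_(m < T) f (phi m) * zfun (k' + m)%N) =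
        f (phi 0%N) * X' k' + \sum_(m < T) f (phi m * al m) * A' m k' + f (\sum_(m < T) phi m * ga m).
      rewrite mulr_sumr (eq_bigr (fun m : 'I_T => f (phi m * x0 m) * X' k' +
         (f (phi m * al m) * A' m k' + f (phi m * ga m)))).
        rewrite !big_split /= -rmorph_sum addrA -mulr_suml -rmorph_sum; congr (f _ * _ + _ + _).
        rewrite (bigD1 (Ordinal T0)) //= /x0 mulr1 big1 ?addr0 // => i; rewrite -val_eqE /= => /negPf ->.
        by rewrite mulr0.
      by move=> j _; rewrite mulrCA zzE // !rmorphM; ring.
    have rhsE : zfun k' * (\sum_(l < T) f (F' l) * (X (k' + l)%N - X (k' + l + T)%N)) =
        \sum_(l < T) f (r l) * U' (k' + l)%N + \sum_(l < T) f (F l * b l) * A' l k' + f (\sum_(l < T) F l * c l).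
      rewrite rE mulr_sumr rmorph_sum -!big_split; apply: eq_bigr => j _ /=.
      rewrite mulrCA /F' /a /b /c; case: eqP => [->|/eqP j0]; first by rewrite !(mul0r, mulr0, rmorph0); ring.
      by rewrite cxE ?lt0n ?j0 ?ltn_ord // !rmorphM; ring.
    rewrite lhsE rhsE xiE mulr_sumr -(wsum_fold_sum (fun m => phi m * al m)) -(wsum_fold_sum (fun l => F l * b l)).
    rewrite (eq_bigr (fun l : 'I_T => f (phi 0%N) * (f (xi l) * U' (k' + l)%N) +
      f (\sum_(m < T) phi m * al m * (l < m)%:R) * U' (k' + l)%N - f (r l) * U' (k' + l)%N -
      f (\sum_(m < T) F m * b m * (l < m)%:R) * U' (k' + l)%N + f C * U' (k' + l)%N)); last first.
      by move=> j _; rewrite /e !(rmorphD, rmorphN, rmorphM); ring.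
    rewrite !big_split /= !sumrN UC /C rmorphB; ring.
  have m1 : (m.-1 < T)%N by lia.
  have mT : (m < T)%N by lia.
  have := e0 _ m1; have := e0 _ mT; rewrite /e.
  rewrite (sum_gtn_pred (fun m => phi m * al m) hm) (sum_gtn_pred (fun m => F m * b m) hm).
  rewrite /eta; move: (\sum_(i < T) _ * _) (\sum_(i < T) _ * _) => S1 S2 em em1.
  apply/eqP; rewrite -subr_eq0; apply/eqP; rewrite -(subrr 0) -{1}em1 -em; ring.
rewrite phi0.
transitivity (\sum_(m < T) f (phi m) * zfun (k + m)%N + f (F 0%N) * (X k - X (k + T)%N)).
  rewrite thetaE mulr_sumr -big_split; apply: eq_bigr => m _ /=.
  rewrite [f (F 0%N) * _]mulrA -mulrDl -rmorphM -rmorphD; congr (f _ * _).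
  rewrite [F 0%N * _]mulrC; congr (_ + _).
  case: eqP => [->|/eqP m0]; first by rewrite !mul0r !add0r mul1r.
  have hm : (0 < m < T)%N by rewrite lt0n m0 ltn_ord.
  apply: (mulfI (al0 _ hm)); rewrite comp //; field; exact: al0.
rewrite phiE; case: T T0 => // T' _; rewrite !big_ord_recl /= /F' /=.
by rewrite rmorph0 mul0r add0r addn0 addrC.
Qed.

(** [zfun (k + m)] has coefficient 1/2 at the indices [l >= m] and -1/2 below, which gives prefix
    sums minus half the total: a change of basis in linear time. *)
Lemma sum_zfun (phi : nat -> K) k :
  \sum_(m < T) f (phi m) * zfun (k + m)%N =
  \sum_(l < T) f (\sum_(m < l.+1) phi m - h * \sum_(m < T) phi m) * (U (k + l)%N - U (k + l + T)%N).
Proof.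
transitivity (\sum_(m < T) \sum_(l < T) f (phi m * (m <= l)%:R - h * phi m) * (U (k + l)%N - U (k + l + T)%N)).
  apply: eq_bigr => m _; rewrite zfun_window ?mulr_sumr; last exact: ltnW.
  by apply: eq_bigr => l _; rewrite rmorphB !rmorphM; ring.
rewrite exchange_big; apply: eq_bigr => l _ /=.
rewrite -mulr_suml -rmorph_sum sumrB -mulr_sumr; congr (f (_ - _) * _).
rewrite [RHS](big_ord_widen T (fun m => phi m)) // [RHS]big_mkcond; apply: eq_bigr => m _ /=.
by rewrite ltnS; case: (m <= l)%N; rewrite ?mulr1 ?mulr0.
Qed.

Lemma fold_combine (F r g : nat -> K) k :
  (forall k, \sum_(l < T) f (r l) * U' (k + l)%N =
     \sum_(l < T) f (h * F l + h * F (l + T)%N) * X' (k + l)%N) ->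
  (forall k, \sum_(l < T) f (g l) * (U (k + l)%N - U (k + l + T)%N) =
     \sum_(l < T) f (h * F l - h * F (l + T)%N) * (X (k + l)%N - X (k + l + T)%N)) ->
  \sum_(l < T + T) f (if (l < T)%N then r l + g l else r (l - T)%N - g (l - T)%N) * U (k + l)%N =
  \sum_(l < T + T) f (F l) * X (k + l)%N.
Proof.
move=> /(_ k) e1 /(_ k) e2; rewrite !big_split_ord /= -!big_split /=.
transitivity (\sum_(l < T) f (r l) * U' (k + l)%N + \sum_(l < T) f (g l) * (U (k + l)%N - U (k + l + T)%N)).
  rewrite -big_split; apply: eq_bigr => l _ /=.
  rewrite ltn_ord ltnNge leq_addr /= addKn /fold_shift [(T + l)%N]addnC addnA rmorphD rmorphB; ring.
rewrite e1 e2 -big_split; apply: eq_bigr => l _ /=.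
rewrite /fold_shift [(T + l)%N]addnC addnA.
rewrite rmorphD rmorphB !rmorphM; move: (X _) (X _) (F _) (F _) => u v w x.
by field; exact: two_neq0.
Qed.

End Step.
End EllipticSystem.

(** * Straight-line programs *)

Section Slp.
Variables (K : fieldType) (n : nat).
Local Notation Fn := (('I_n -> K) -> K).
Implicit Types (c : seq (operation K)) (g : Fn) (G H M : Fn -> Prop).

Definition run c (inp : 'I_n -> K) : seq K :=
  foldl (fun mem op => rcons mem (operation_val mem op)) [seq inp i | i <- enum 'I_n] c.

Lemma run_cat c c' inp : run (c ++ c') inp =
  foldl (fun mem op => rcons mem (operation_val mem op)) (run c inp) c'.
Proof. exact: foldl_cat. Qed.

Lemma size_run c inp : size (run c inp) = (n + size c)%N.
Proof.
elim/last_ind: c => [|c op IHc]; first by rewrite /run /= size_map size_enum_ord addn0.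
by rewrite -cats1 run_cat /= size_rcons IHc size_cat addn1 addnS.
Qed.

Lemma nth_run_cat c c' inp i : (i < n + size c)%N -> (run (c ++ c') inp)`_i = (run c inp)`_i.
Proof.
elim/last_ind: c' => [|c' op IHc] hi; first by rewrite cats0.
rewrite -cats1 catA run_cat /= nth_rcons size_run ifT ?IHc // size_cat; lia.
Qed.

Definition available c g := exists2 o : operand K, operand_ok (n + size c) o &
  forall inp, operand_val (run c inp) o = g inp.

Lemma available_cat c c' g : available c g -> available (c ++ c') g.
Proof.
case=> [[i|a] oko e]; last by exists (Cst a).
exists (Reg i); first by move: oko; rewrite /= size_cat; lia.
by move=> inp; rewrite -e /= nth_run_cat.
Qed.

Lemma code_ok_cat m c c' : code_ok m (c ++ c') = code_ok m c && code_ok (m + size c) c'.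
Proof.
elim: c m => [|op c IHc] m /=; first by rewrite addn0.
by rewrite IHc addSnnS andbA.
Qed.

(** Quantifying over every code in which [G] is available makes blocks composable: a block is
    appended to any earlier code, whose results stay available for sharing. *)
Definition computes (a : nat) G H := forall c, code_ok n c ->
  (forall g, G g -> available c g) ->
  exists c', [/\ (size c' <= a)%N, code_ok n (c ++ c')
    & forall g, H g -> available (c ++ c') g].

Lemma computes_trans a b G H M : computes a G H ->
  computes b (fun g => G g \/ H g) M -> computes (a + b) G M.
Proof.
move=> GH HM c okc avG; have [c1 [s1 ok1 av1]] := GH c okc avG.
have [|c2 [s2 ok2 av2]] := HM _ ok1; first by move=> g [/avG|/av1] //; apply: available_cat.
exists (c1 ++ c2); rewrite size_cat catA; split=> //; lia.
Qed.

Lemma computes_sub a b G G' H H' : (a <= b)%N -> (forall g, G g -> G' g) ->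
  (forall g, H' g -> H g) -> computes a G H -> computes b G' H'.
Proof.
move=> ab sG sH GH c okc avG; have [|c1 [s1 ok1 av1]] := GH c okc; first by move=> g /sG/avG.
exists c1; split=> //; [exact: leq_trans s1 ab | by move=> g /sH/av1].
Qed.

Lemma computes_refl G H : (forall g, H g -> G g) -> computes 0 G H.
Proof. by move=> sH c okc avG; exists [::]; rewrite cats0; split=> // g /sH/avG. Qed.

Lemma computes_op g G :
  (forall c, (forall g, G g -> available c g) ->
    exists2 op, operation_ok (n + size c) op & forall inp, operation_val (run c inp) op = g inp) ->
  computes 1 G (eq g).
Proof.
move=> hop c okc avG; have [o oko e] := hop c avG.
exists [:: o]; split=> //; first by rewrite code_ok_cat okc /= oko.
move=> _ <-; exists (Reg (n + size c)); first by rewrite /= size_cat /=; lia.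
by move=> inp; rewrite run_cat /= nth_rcons size_run ltnn eqxx e.
Qed.

Lemma computes_add g1 g2 G : G g1 -> G g2 -> computes 1 G (eq (fun inp => g1 inp + g2 inp)).
Proof.
move=> G1 G2; apply: computes_op => c avG.
have [o1 ok1 e1] := avG _ G1; have [o2 ok2 e2] := avG _ G2.
by exists (SlpAdd o1 o2); [rewrite /= ok1 ok2 | move=> inp; rewrite /= e1 e2].
Qed.

Lemma computes_scale a g G : G g -> computes 1 G (eq (fun inp => a * g inp)).
Proof.
move=> Gg; apply: computes_op => c avG; have [o ok1 e] := avG _ Gg.
by exists (SlpScale a o) => //= inp; rewrite /= e.
Qed.

Lemma computes_axpy b g0 a g G : G g -> computes b G (eq g0) ->
  computes (b + 2) G (eq (fun inp => g0 inp + a * g inp)).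
Proof.
move=> Gg Gg0; apply: computes_trans Gg0 _.
apply: (@computes_trans 1 1 _ (eq (fun inp => a * g inp))); first by apply: computes_scale; left.
by apply: computes_add; [left; right|right].
Qed.

Definition fn_family m (h : nat -> Fn) : Fn -> Prop := fun g => exists2 i, (i < m)%N & g = h i.

Lemma computes_family m a (h : nat -> Fn) G :
  (forall i, (i < m)%N -> computes a G (eq (h i))) -> computes (m * a) G (fn_family m h).
Proof.
elim: m => [|m IHm] hm; first by apply: computes_refl => g [].
rewrite mulSn addnC.
have h1 : computes (m * a) G (fn_family m h) by apply: IHm => i im; apply: hm; lia.
move=> c okc avG; have [c1 [s1 ok1 av1]] := h1 c okc avG.
have [g Gg|c2 [s2 ok2 av2]] := hm m (leqnn _) _ ok1; first by apply: available_cat; apply: avG.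
exists (c1 ++ c2); rewrite size_cat catA; split=> //; first lia.
move=> g [i im ->]; have [->|ne] := eqVneq i m; first exact: av2.
by apply: available_cat; apply: av1; exists i => //; lia.
Qed.

(** Each sum reuses the previous one; treating the sums separately with [computes_family] would cost
    quadratically many operations. *)
Lemma computes_prefix m (h : nat -> Fn) G : (forall i, (i < m)%N -> G (h i)) ->
  computes m G (fn_family m (fun i inp => \sum_(j < i.+1) h j inp)).
Proof.
elim: m => [|m IHm] hm; first by apply: computes_refl => g [].
rewrite -addn1; apply: computes_trans (IHm _) _; first by move=> i im; apply: hm; lia.
case: m IHm hm => [|m] IHm hm.
  apply: (computes_sub (leq0n _)) (computes_refl (G := G) (H := fn_family 1 (fun i inp => \sum_(j < i.+1) h j inp)) _) => //.
    by move=> g; left.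
  move=> g [i]; rewrite ltnS leqn0 => /eqP -> ->.
  rewrite (_ : (fun inp => _) = h 0%N); first exact: hm.
  by apply/funext => inp; rewrite big_ord1.
set G' := (fun g => G g \/ _).
have cp : computes 1 G' (eq (fun inp => \sum_(j < m.+1) h j inp + h m.+1 inp)).
  by apply: computes_add; [right; exists m|left; apply: hm].
move=> c okc avG; have [c1 [s1 ok1 av1]] := cp c okc avG.
exists c1; split=> // g [i im ->]; have [->|ne] := eqVneq i m.+1.
  apply: av1; apply/funext => inp; by rewrite [RHS]big_ord_recr.
by apply: available_cat; apply: avG; right; exists i => //; lia.
Qed.

Lemma computes_lin m (a : nat -> K) (h : nat -> Fn) G : (0 < m)%N -> (forall i, (i < m)%N -> G (h i)) ->
  computes (2 * m) G (eq (fun inp => \sum_(j < m) a j * h j inp)).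
Proof.
elim: m => // -[|m] IHm _ hm.
  rewrite (_ : (fun inp => _) = fun inp => a 0%N * h 0%N inp); last first.
    by apply/funext => inp; rewrite big_ord1.
  apply: (computes_sub (a := 1) (G := G) (H := eq (fun inp => a 0%N * h 0%N inp))) => //.
  by apply: computes_scale; apply: hm.
rewrite (_ : (fun inp => _) = fun inp => \sum_(j < m.+1) a j * h j inp + a m.+1 * h m.+1 inp).
  rewrite mulnS addnC; apply: computes_axpy; first exact: hm.
  by apply: IHm => // i im; apply: hm; lia.
by apply/funext => inp; rewrite big_ord_recr.
Qed.

End Slp.

(** * The recursion and its operation count *)

Section Recursion.
Variables (K L : fieldType) (f : {rmorphism K -> L}).
Hypothesis K2 : (2%:R : K) != 0.

(** The data [F] are functions of arbitrarily many inputs, since recursive calls act on intermediate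
    values. *)
Definition reducible_in (cost n : nat) (U X : nat -> L) : Prop :=
  exists rho : (nat -> K) -> nat -> K,
  (forall F k, \sum_(l < n) f (rho F l) * U (k + l)%N = \sum_(l < n) f (F l) * X (k + l)%N) /\
  forall N (F : nat -> ('I_N -> K) -> K) (G : (('I_N -> K) -> K) -> Prop),
    (forall l, (l < n)%N -> G (F l)) ->
    computes cost G (fn_family n (fun l inp => rho (fun i => F i inp) l)).

Lemma in_fn_family N m (h : nat -> ('I_N -> K) -> K) i : (i < m)%N -> fn_family m h (h i).
Proof. by exists i. Qed.

(** The recursive calls are [s4] and [s5]. The stages [s1] to [s3] cost 3 + 3 + 1 and [s6] to [s10]
    cost 2 + 9 + 1 + 2 + 4 operations per index below [T], 25 in all. *)
Lemma reducible_step T cost U X : ellsys f (T + T) U X ->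
  reducible_in cost T (fold_shift T U) (fold_shift T X) ->
  reducible_in (2 * cost + 25 * T) (T + T) U X.
Proof.
move=> sys [rho' [rho'E rho'C]].
have [a [p [q [s [v [kappa [theta sol]]]]]]] := antisymmetric_solve K2 sys.
have T0 : (0 < T)%N by have := es_gt0 sys; lia.
set h : K := 2%:R^-1.
pose Fp (F : nat -> K) l := h * F l + h * F (l + T)%N.
(* Subtractions are written as additions of constant multiples, to fit [computes_axpy]. *)
pose Fm (F : nat -> K) l := h * F l + (- h) * F (l + T)%N.
pose aF (F : nat -> K) l := a l * Fm F l.
pose p0 (F : nat -> K) := \sum_(l < T) kappa l * Fm F l.
pose phi F m := p m * rho' (aF F) m.-1 + q m * rho' (aF F) m + s m * Fm F m
  + v m * p0 F + theta m * Fm F 0%N.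
pose S F l := \sum_(m < l.+1) phi F m.
pose g F l := S F l + (- h) * S F T.-1.
pose rho F l := if (l < T)%N then rho' (Fp F) l + 1 * g F l
  else rho' (Fp F) (l - T)%N + (-1) * g F (l - T)%N.
exists rho; split=> [F k|N F G GF].
  have e1 k' : \sum_(l < T) f (rho' (Fp F) l) * fold_shift T U (k' + l)%N =
      \sum_(l < T) f (h * F l + h * F (l + T)%N) * fold_shift T X (k' + l)%N by exact: rho'E.
  have e2 k' : \sum_(l < T) f (g F l) * (U (k' + l)%N - U (k' + l + T)%N) =
      \sum_(l < T) f (h * F l - h * F (l + T)%N) * (X (k' + l)%N - X (k' + l + T)%N).
    transitivity (\sum_(m < T) f (phi F m) * zfun f T U (k' + m)%N).
      rewrite (sum_zfun K2 sys); apply: eq_bigr => l _; congr (f _ * _).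
      by rewrite /g /S prednK // mulNr.
    rewrite (sol (Fm F) (rho' (aF F))); last by move=> k''; exact: rho'E.
    by apply: eq_bigr => l _; rewrite /Fm mulNr.
  rewrite -(fold_combine K2 k e1 e2); apply: eq_bigr => l _; rewrite /rho.
  by case: ifP => _; rewrite ?mul1r ?mulN1r.
pose ev (e : (nat -> K) -> nat -> K) (l : nat) (inp : 'I_N -> K) := e (fun i => F i inp) l.
pose G1 := (fun x => G x \/ fn_family T (ev Fp) x).
pose G2 := (fun x => G1 x \/ fn_family T (ev Fm) x).
pose G3 := (fun x => G2 x \/ fn_family T (ev aF) x).
pose G4 := (fun x => G3 x \/ fn_family T (ev (fun F => rho' (Fp F))) x).
pose G5 := (fun x => G4 x \/ fn_family T (ev (fun F => rho' (aF F))) x).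
pose G6 := (fun x => G5 x \/ eq (ev (fun F _ => p0 F) 0%N) x).
pose G7 := (fun x => G6 x \/ fn_family T (ev phi) x).
pose G8 := (fun x => G7 x \/ fn_family T (ev S) x).
pose G9 := (fun x => G8 x \/ fn_family T (ev g) x).
have GFm l : (l < T)%N -> G2 (ev Fm l) by right; exact: in_fn_family.
have s1 : computes (T * 3) G (fn_family T (ev Fp)).
  apply: computes_family => l lT.
  by apply: (@computes_axpy _ _ 1); [apply: GF; lia|apply: computes_scale; apply: GF; lia].
have s2 : computes (T * 3) G1 (fn_family T (ev Fm)).
  apply: computes_family => l lT; apply: (@computes_axpy _ _ 1); first by left; apply: GF; lia.
  by apply: computes_scale; left; apply: GF; lia.
have s3 : computes (T * 1) G2 (fn_family T (ev aF)).
  by apply: computes_family => l lT; apply: computes_scale; apply: GFm.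
have s4 : computes cost G3 (fn_family T (ev (fun F => rho' (Fp F)))).
  by apply: (rho'C N (ev Fp)) => l lT; left; left; right; exact: in_fn_family.
have s5 : computes cost G4 (fn_family T (ev (fun F => rho' (aF F)))).
  by apply: (rho'C N (ev aF)) => l lT; left; right; exact: in_fn_family.
have s6 : computes (2 * T) G5 (eq (ev (fun F _ => p0 F) 0%N)).
  by apply: (@computes_lin _ _ _ kappa (ev Fm)) => // l lT; left; left; left; apply: GFm.
have s7 : computes (T * 9) G6 (fn_family T (ev phi)).
  apply: computes_family => m mT.
  have Gr l : (l < T)%N -> G6 (ev (fun F => rho' (aF F)) l) by left; right; exact: in_fn_family.
  have GFm' l : (l < T)%N -> G6 (ev Fm l) by do 4!left; apply: GFm.
  have m1 : (m.-1 < T)%N by lia.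
  apply: (@computes_axpy _ _ 7 _ (theta m) (ev Fm 0%N)); first exact: GFm'.
  apply: (@computes_axpy _ _ 5 _ (v m) (ev (fun F _ => p0 F) 0%N)); first by right.
  apply: (@computes_axpy _ _ 3 _ (s m) (ev Fm m)); first exact: GFm'.
  apply: (@computes_axpy _ _ 1 _ (q m) (ev (fun F => rho' (aF F)) m)); first exact: Gr.
  by apply: (@computes_scale _ _ (p m) (ev (fun F => rho' (aF F)) m.-1)); apply: Gr.
have s8 : computes T G7 (fn_family T (ev S)).
  by apply: (@computes_prefix _ _ T (ev phi)) => l lT; right; exact: in_fn_family.
have s9 : computes (T * 2) G8 (fn_family T (ev g)).
  apply: computes_family => l lT.
  apply: (@computes_axpy _ _ 0 _ (- h) (ev S T.-1)); first by right; apply: in_fn_family; lia.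
  by apply: computes_refl => _ <-; right; exact: in_fn_family.
have s10 : computes ((T + T) * 2) G9 (fn_family (T + T) (ev rho)).
  have Gr l : (l < T)%N -> G9 (ev (fun F => rho' (Fp F)) l).
    by do 5!left; right; exact: in_fn_family.
  have Gg l : (l < T)%N -> G9 (ev g l) by right; exact: in_fn_family.
  apply: computes_family => l lT; have [lT'|lT'] := ltnP l T.
    rewrite (_ : ev rho l = fun inp => ev (fun F => rho' (Fp F)) l inp + 1 * ev g l inp); last first.
      by apply/funext => inp; rewrite /ev /rho lT'.
    apply: (@computes_axpy _ _ 0); first exact: Gg.
    by apply: computes_refl => _ <-; apply: Gr.
  have lT2 : (l - T < T)%N by lia.
  rewrite (_ : ev rho l = fun inp => ev (fun F => rho' (Fp F)) (l - T)%N inp + (-1) * ev g (l - T)%N inp); last first.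
    by apply/funext => inp; rewrite /ev /rho ltnNge lT'.
  apply: (@computes_axpy _ _ 0); first exact: Gg.
  by apply: computes_refl => _ <-; apply: Gr.
have tot := computes_trans s1 (computes_trans s2 (computes_trans s3 (computes_trans s4
  (computes_trans s5 (computes_trans s6 (computes_trans s7 (computes_trans s8 (computes_trans s9 s10)))))))).
by apply: computes_sub tot => //; lia.
Qed.

(** Doubling [T] adds [25 T], which is at most [13 * (2 T)]. For a single point [U] is constantly 1,
    and one scaling by [xi 0] suffices. *)
Theorem reducible_pow2 delta U X : ellsys f (2 ^ delta) U X ->
  reducible_in ((13 * delta + 1) * 2 ^ delta) (2 ^ delta) U X.
Proof.
elim: delta U X => [|delta IHd] U X.
  rewrite expn0 => sys; have [xi xiE] := es_span sys.
  have U1 k : U k = 1 by rewrite -(es_sum sys k) /wsum big_ord1 addn0.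
  exists (fun F l => xi 0%N * F l); split=> [F k|N F G GF].
    by rewrite !big_ord1 xiE big_ord1 !U1 !mulr1 rmorphM mulrC.
  by apply: (@computes_family _ _ 1 1) => l l1; apply: computes_scale; apply: GF.
rewrite expnS mul2n -addnn => sys.
have [rho [rhoE rhoC]] := reducible_step sys (IHd _ _ (ellsys_fold K2 sys)).
exists rho; split=> // N F G GF; apply: computes_sub (rhoC N F G GF) => //.
by move: (2 ^ delta)%N => T; nia.
Qed.

End Recursion.

(** * Slopes on a torsor under a cyclic group *)

Section Torsor.
Variables (F : fieldType) (W : weierstrass F) (smooth : elliptic W).
Local Notation E := (curve smooth).
Local Notation a1 := (wa1 W).
Local Notation a2 := (wa2 W).
Local Notation a3 := (wa3 W).
Variables (t b : E) (T : nat).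
Local Notation d := (T + T)%N.
Hypotheses (T0 : (0 < T)%N) (td : t *+ d = 0).
Hypothesis tk : forall k, (0 < k < d)%N -> t *+ k != 0.
Hypothesis bd : b *+ d != 0.

Definition orbit_pt k : E := b - t *+ k.
Definition opp_mul k : E := - (t *+ k).
Local Notation P := orbit_pt.
Local Notation Q := opp_mul.

(** The value at [P k] of [u_(A,B)] for [A = O] and [B = a t]: the slope of the line through [P k]
    and [- a t]. *)
Definition dslope a k : F := cslope (P k) (Q a).

Lemma torsion_mul k : t *+ k *+ d = 0. Proof. by rewrite mulrnAC td mul0rn. Qed.

Lemma torsor_neq0 (u : E) : u *+ d = 0 -> b + u != 0.
Proof.
move=> ud; apply: contraNneq bd => e.
have <- : (b + u) *+ d = b *+ d by rewrite mulrnDl ud addr0.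
by rewrite e mul0rn.
Qed.

Lemma orbit_neq0 k : P k != 0.
Proof. by apply: torsor_neq0; rewrite mulNrn torsion_mul oppr0. Qed.

Lemma orbitD k l : P k + Q l = P (k + l).
Proof. by rewrite /orbit_pt /opp_mul mulrnDr opprD addrA. Qed.

Lemma orbit_per k : P (k + d) = P k.
Proof. by rewrite /orbit_pt mulrnDr td addr0. Qed.

Lemma opp_mul_neq0 k : (0 < k < d)%N -> Q k != 0.
Proof. by move=> hk; rewrite oppr_eq0 tk. Qed.

Lemma opp_mulD k l : Q k + Q l = Q (k + l). Proof. by rewrite /opp_mul mulrnDr opprD. Qed.

Lemma opp_mulN k : (k <= d)%N -> Q (d - k) = t *+ k.
Proof. by move=> kd; rewrite /opp_mul mulrnBr // td sub0r opprK. Qed.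

Lemma mul_inj i j : (i < d)%N -> (j < d)%N -> t *+ i = t *+ j -> i = j.
Proof.
wlog ij : i j / (i <= j)%N => [h|] id jd e.
  by case/orP: (leq_total i j) => ij; [apply: h|apply/esym/h].
apply/eqP; rewrite eqn_leq ij leqNgt; apply/negP => ij'.
have : t *+ (j - i) = 0 by rewrite mulrnBr // e subrr.
by apply/eqP/tk; lia.
Qed.

Lemma orbit_torsion k l : P k != t *+ l /\ P k != - (t *+ l).
Proof.
split; rewrite -subr_eq0 /orbit_pt -addrA; apply: torsor_neq0.
  by rewrite -opprD -mulrnDr mulNrn torsion_mul oppr0.
by rewrite opprK mulrnDl mulNrn !torsion_mul oppr0 addr0.
Qed.

Lemma orbit_inj i j : (i < d)%N -> (j < d)%N -> P i = P j -> i = j.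
Proof. by move=> id jd /addrI/oppr_inj; apply: mul_inj. Qed.

Lemma xcoord_orbit_neq k a : (0 < a < d)%N -> xcoord (P k) != xcoord (Q a).
Proof.
move=> ha; apply/eqP => e; have [n1 n2] := orbit_torsion k a.
have [e'|e'] := xcoord_inj (orbit_neq0 k) (opp_mul_neq0 ha) e.
  by rewrite -e' eqxx in n2.
by rewrite -[t *+ a]opprK -/(Q a) e' opprK eqxx in n1.
Qed.

Lemma dslopeE k a : (0 < a < d)%N ->
  dslope a k = (ycoord (P k) - ycoord (Q a)) / (xcoord (P k) - xcoord (Q a)).
Proof.
move=> ha; have nx := xcoord_orbit_neq k ha.
apply: (canRL (mulfK _)); first by rewrite subr_eq0.
by apply: cslope_line; rewrite ?orbit_neq0 ?opp_mul_neq0 // orbitD orbit_neq0.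
Qed.

(** The cocycle identity for [P k], [Q a], [Q 1]. It makes the partial sums of the [u_l] equal to
    slopes [dslope c], up to constants. *)
Lemma dslopeS k a : (0 < a)%N -> (a.+1 < d)%N ->
  dslope a k + dslope 1 (k + a) = cslope (Q a) (Q 1) + dslope a.+1 k.
Proof.
move=> a0 ad; have ha : (0 < a < d)%N by lia.
have h1 : (0 < 1 < d)%N by lia.
have := @cslope_cocycle _ _ smooth (P k) (Q a) (Q 1).
rewrite opp_mulD !orbitD addn1 !orbit_neq0 !opp_mul_neq0 //.
by move=> <- //; rewrite addrC.
Qed.

Lemma dslope_sqr k a : (0 < a < d)%N ->
  dslope a k ^+ 2 = xcoord (P k) + xcoord (P (k + a)) + (a2 + xcoord (Q a)) - a1 * dslope a k.
Proof.
move=> ha; rewrite -orbitD xcoordD ?orbit_neq0 ?opp_mul_neq0 ?orbitD ?orbit_neq0 //.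
by rewrite /dslope; ring.
Qed.

(** This is [cslope3] for [P (k + a)], [- Q a], [Q c], whose first partial sum is [P k]; [cslopeDN]
    and [dslope_sqr] bring everything back to [P k]. *)
Lemma dslope_mul k a c : (0 < a < d)%N -> (0 < c < d)%N -> a != c ->
  let e := cslope (- Q a) (Q c) in
  dslope a k * dslope c k = xcoord (P k) + (a2 + xcoord (Q a) + xcoord (Q c))
    + e * dslope a k - (e + a1) * dslope c k.
Proof.
move=> ha hc ac e.
have Pa : P (k + a) + - Q a = P k by rewrite -orbitD addrK.
have nQ : - Q a != 0 by rewrite oppr_eq0 opp_mul_neq0.
have nQQ : - Q a + Q c != 0.
  rewrite opprK subr_eq0; apply: contra ac => /eqP/mul_inj-> //; lia.
have := @cslope3 _ _ smooth (P (k + a)) (- Q a) (Q c).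
rewrite Pa orbitD !orbit_neq0 opp_mul_neq0 // => /(_ isT nQ isT isT nQQ isT).
have := @cslopeDN _ _ smooth (P (k + a)) (- Q a); rewrite Pa !orbit_neq0 => /(_ isT nQ isT).
rewrite [- - Q a]opprK -/(dslope a k) -/(dslope c k) -/e => dE.
have -> : cslope (P (k + a)) (- Q a) = - dslope a k - a1 by rewrite dE; ring.
have xE : xcoord (P (k + a)) = dslope a k ^+ 2 + a1 * dslope a k - a2 - xcoord (Q a) - xcoord (P k).
  by rewrite dslope_sqr //; ring.
rewrite xE; move: (dslope a k) (dslope c k) (xcoord (P k)) (xcoord (Q a)) (xcoord (Q c)) => u v x xa xc h.
transitivity ((v + (- u - a1) + a1) * (e - (- u - a1)) - v * e - v * a1 + u * e + u ^+ 2 + u * a1).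
  by ring.
by rewrite h; ring.
Qed.

Lemma dslope_line k a : (0 < a < d)%N ->
  xcoord (P k) * dslope a k = ycoord (P k) - ycoord (Q a) + xcoord (Q a) * dslope a k.
Proof.
move=> ha; rewrite -(@cslope_line _ _ smooth) ?orbit_neq0 ?opp_mul_neq0 // ?orbitD ?orbit_neq0 //.
by rewrite /dslope; ring.
Qed.

Lemma dslope_half k : dslope T (k + T) = - dslope T k - a1.
Proof.
have hT : (0 < T < d)%N by lia.
have QT : - Q T = Q T by rewrite -[in RHS](addnK T T) opp_mulN ?leq_addr // opprK.
rewrite /dslope -orbitD -[X in cslope _ X]QT.
by apply: cslopeDN; rewrite ?orbit_neq0 ?opp_mul_neq0 // orbitD orbit_neq0.
Qed.

(** Otherwise the line through [P k] and the 2-torsion point [Q T] would carry the vanishing of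
    [2 y + a1 x + a3] from [Q T] to [P k]. Then [P k] would be 2-torsion and, [d] being even,
    [d b = O]. *)
Lemma dslope_half_neq0 k : 2%:R * dslope T k + a1 != 0.
Proof.
have hT : (0 < T < d)%N by lia.
apply/eqP => e.
have QT : Q T + Q T == 0 by rewrite opp_mulD /opp_mul td oppr0.
have := QT; rewrite two_torsion ?opp_mul_neq0 // => /eqP yQ.
have PP : P k + P k == 0.
  rewrite two_torsion ?orbit_neq0 //; apply/eqP.
  have l := dslope_line k hT.
  have -> : 2%:R * ycoord (P k) + a1 * xcoord (P k) + a3 =
    (2%:R * ycoord (Q T) + a1 * xcoord (Q T) + a3) + (xcoord (P k) - xcoord (Q T)) * (2%:R * dslope T k + a1).
    have -> : ycoord (P k) = xcoord (P k) * dslope T k + ycoord (Q T) - xcoord (Q T) * dslope T k by rewrite l; ring.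
    ring.
  by rewrite yQ e mulr0 addr0.
have : P k *+ d = 0 by rewrite mulrnDr -mulrnDl (eqP PP) mul0rn.
rewrite /orbit_pt mulrnDl mulNrn torsion_mul oppr0 addr0.
by apply/eqP.
Qed.

Lemma xcoord_mul_inj i j : (0 < i <= T)%N -> (0 < j <= T)%N ->
  xcoord (t *+ i) = xcoord (t *+ j) -> i = j.
Proof.
move=> hi hj e.
have ti : t *+ i != 0 by apply: tk; lia.
have tj : t *+ j != 0 by apply: tk; lia.
have [e'|e'] := xcoord_inj ti tj e; first by apply/esym/mul_inj => //; lia.
have : t *+ (i + j) = 0 by rewrite mulrnDr e' subrr.
have [ij|ij] := leqP d (i + j); first by move=> _; lia.
by move/eqP; rewrite (negPf (tk _)) //; lia.
Qed.

(** For [0 < l < d], the representative of [l] up to sign in [1, ..., T]: [l t] and [(d - l) t] are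
    opposite and share their abscissa. *)
Definition fold_index l := if (l <= T)%N then l else (d - l)%N.

Lemma fold_index_bound l : (0 < l < d)%N -> (0 < fold_index l <= T)%N.
Proof. by rewrite /fold_index; case: (leqP l T) => /=; lia. Qed.

Lemma xcoord_fold_index l : (l < d)%N -> xcoord (t *+ fold_index l) = xcoord (t *+ l).
Proof.
rewrite /fold_index; case: (leqP l T) => //= _ ld.
rewrite -(@opp_mulN (d - l)) ?leq_subr // subKn ?xcoordN //; exact: ltnW.
Qed.

(** The product over [1, ..., T] without the factor of index [l]. Since 0 is not in [iota 1 T],
    [x_prod 0] is the full product. *)
Definition x_prod l : {poly F} := \prod_(i <- rem l (iota 1 T)) ('X - (xcoord (t *+ i))%:P).

Lemma x_prodE l : (0 < l <= T)%N -> x_prod 0 = ('X - (xcoord (t *+ l))%:P) * x_prod l.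
Proof.
move=> hl; rewrite /x_prod rem_id; last by rewrite mem_iota; lia.
by rewrite (big_rem l) // mem_iota; lia.
Qed.

Lemma size_x_prod l : (0 < l <= T)%N -> size (x_prod l) = T.
Proof. by move=> hl; rewrite size_prod_XsubC size_rem ?mem_iota ?size_iota; [rewrite prednK|lia]. Qed.

Lemma size_x_prod0 : size (x_prod 0) = T.+1.
Proof. by rewrite size_prod_XsubC rem_id ?size_iota // mem_iota; lia. Qed.

Lemma x_prod_eq0 l x :
  ((x_prod l).[x] == 0) = has (fun i => x == xcoord (t *+ i)) (rem l (iota 1 T)).
Proof.
rewrite horner_prod prodf_seq_eq0; apply: eq_has => i /=.
by rewrite hornerXsubC subr_eq0.
Qed.

Lemma x_prod_vanish l m : (0 < m < d)%N -> fold_index m != l -> (x_prod l).[xcoord (t *+ m)] = 0.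
Proof.
move=> hm ml; apply/eqP; rewrite x_prod_eq0; apply/hasP; exists (fold_index m).
  have := fold_index_bound hm.
  by rewrite (mem_rem_uniq _ (iota_uniq _ _)) inE ml mem_iota /=; lia.
by rewrite xcoord_fold_index //; lia.
Qed.

Lemma x_prod_fold_neq0 m : (0 < m < d)%N -> (x_prod (fold_index m)).[xcoord (t *+ m)] != 0.
Proof.
move=> hm; rewrite x_prod_eq0; apply/hasPn => i.
rewrite (mem_rem_uniq _ (iota_uniq _ _)) inE mem_iota => /andP[im hi].
rewrite -xcoord_fold_index; last by lia.
apply: contra im => /eqP e; apply/eqP/esym.
by apply: xcoord_mul_inj e; [exact: fold_index_bound|lia].
Qed.

(** * Linear independence of the slopes *)

Section Free.
Variables (psi : nat -> F) (c : F).

(* The function c + \sum_l psi_l u_(0,l) times \prod_(i <= T) (x - x(i t)), which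
   clears the poles at i t and at - i t together. *)
Definition pole_clear : coordring W :=
  (c *: x_prod 0 - \sum_(1 <= l < d) (psi l * ycoord (Q l)) *: x_prod (fold_index l),
   \sum_(1 <= l < d) psi l *: x_prod (fold_index l)).

Lemma pole_clear_eval p : cr_eval p pole_clear =
  c * (x_prod 0).[p.1] + \sum_(1 <= l < d) psi l * (p.2 - ycoord (Q l)) * (x_prod (fold_index l)).[p.1].
Proof.
rewrite /cr_eval /= !hornerE !horner_sum -addrA; congr (_ + _).
rewrite mulr_sumr -sumrN -big_split; apply: eq_bigr => l _ /=.
by rewrite !hornerE /=; ring.
Qed.

Lemma pole_clear_orbit k : cr_eval (affine_of (P k)) pole_clear =
  (x_prod 0).[xcoord (P k)] * (c + \sum_(1 <= l < d) psi l * dslope l k).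
Proof.
rewrite pole_clear_eval mulrDr mulrC; congr (_ + _); rewrite mulr_sumr.
apply: eq_big_nat => l hl; rewrite (x_prodE (fold_index_bound hl)) dslopeE //.
rewrite hornerM hornerXsubC xcoord_fold_index; last by lia.
have := xcoord_orbit_neq k hl; rewrite /opp_mul xcoordN -subr_eq0 /= => nx.
by rewrite mulrACA mulrCA mulrA [RHS]mulrAC -!mulrA; field.
Qed.

Lemma pole_clear_torsion m : (0 < m < d)%N -> cr_eval (affine_of (t *+ m)) pole_clear =
  psi m * (ycoord (t *+ m) - ycoord (Q m)) * (x_prod (fold_index m)).[xcoord (t *+ m)].
Proof.
move=> hm; rewrite pole_clear_eval /= x_prod_vanish // ?mulr0 ?add0r; last first.
  by have := fold_index_bound hm; case: fold_index.
rewrite (bigD1_seq m) ?iota_uniq //=; last by rewrite mem_index_iota.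
rewrite big_nat_cond big1 ?addr0 // => l /andP[hl lm].
have [e|ne] := eqVneq (fold_index m) (fold_index l); last by rewrite x_prod_vanish // mulr0.
have -> : l = (d - m)%N.
  by move: e lm; rewrite /fold_index; case: (leqP m T); case: (leqP l T) => /=; lia.
by rewrite opp_mulN ?subrr ?mulr0 ?mul0r //; lia.
Qed.

(** [pole_clear] vanishes at the [d] points [P k] and also at [T t], where [x - x(T t)] has a double
    zero against a simple pole. If it were nonzero, then, its norm having degree at most [d + 1],
    these points would add up to O by [abel]; but the [P k] add up to [d b - T t], so [d b] would be
    O. *)
Lemma dslope_free : (forall k, c + \sum_(1 <= l < d) psi l * dslope l k = 0) ->
  c = 0 /\ forall l, (0 < l < d)%N -> psi l = 0.
Proof.
move=> vf; have hT : (0 < T < d)%N by lia.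
have QT : Q T = t *+ T by rewrite -[in LHS](addnK T T) opp_mulN ?leq_addr.
have F0 : pole_clear = 0.
  apply/eqP; apply/negPn/negP => Fn0.
  pose s := t *+ T :: [seq P k | k <- iota 0 d].
  have s0 : all (fun R : E => R != 0) s.
    by rewrite /= tk //=; apply/allP => _ /mapP[k _ ->]; apply: orbit_neq0.
  have us : uniq s.
    rewrite /= map_inj_in_uniq ?iota_uniq ?andbT.
      by apply/mapP => -[k _ e]; have [] := orbit_torsion k T; rewrite e eqxx.
    by move=> i j; rewrite !mem_iota => hi hj; apply: orbit_inj; lia.
  have affs R : R \in s -> val R = Some (affine_of R) /\ on_affine W (affine_of R).
    by move=> /(allP s0); apply: curve_neq0.
  have vs : vanish_on (map (@affine_of _ _ smooth) s) pole_clear.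
    apply: eval_vanish_on.
    - rewrite map_inj_in_uniq // => R R' /affs[e _] /affs[e' _] ee.
      by apply: val_inj; rewrite e e' ee.
    - by move=> p /mapP[R /affs[_ ?] ->].
    - move=> p /mapP[R]; rewrite inE => /predU1P[->|/mapP[k _ ->]] ->.
        by rewrite pole_clear_torsion // QT subrr mulr0 mul0r.
      by rewrite pole_clear_orbit vf mulr0.
  have sz : (size (cr_norm pole_clear) <= (size s).+1)%N.
    rewrite /= size_map size_iota size_cr_norm geq_max /=.
    have szP l : (l \in index_iota 1 d) -> (size (x_prod (fold_index l)) <= T)%N.
      by rewrite mem_index_iota => /fold_index_bound/size_x_prod ->.
    have sz1 : (size (c *: x_prod 0 - \sum_(1 <= l < d) (psi l * ycoord (Q l)) *: x_prod (fold_index l))%R <= T.+1)%N.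
      rewrite (leq_trans (size_polyD _ _)) // geq_max size_polyN; apply/andP; split.
        by rewrite (leq_trans (size_scale_leq _ _)) // size_x_prod0.
      rewrite big_seq; apply: (leq_trans (size_sum _ _ _)); apply/bigmax_leqP_seq => l hl _.
      by rewrite (leq_trans (size_scale_leq _ _)) // (leq_trans (szP _ hl)).
    have sz2 : (size (\sum_(1 <= l < d) psi l *: x_prod (fold_index l))%R <= T)%N.
      rewrite big_seq; apply: (leq_trans (size_sum _ _ _)); apply/bigmax_leqP_seq => l hl _.
      by rewrite (leq_trans (size_scale_leq _ _)) // szP.
    move: sz1 sz2; set u := size _; set w := size _ => sz1 sz2.
    by apply/andP; split; [lia|case: ifP => _; lia].
  have := abel Fn0 s0 vs sz.
  rewrite big_cons big_map /orbit_pt sumrB.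
  have -> : \sum_(j <- iota 0 d) b = b *+ d by rewrite big_const_seq count_predT size_iota iter_addr addr0.
  have -> : \sum_(j <- iota 0 d) t *+ j = t *+ (T + (T.-1) * d).
    rewrite -(big_morph _ (mulrnDr t) (mulr0n t)); congr (_ *+ _).
    rewrite -[X in iota 0 X]subn0 -/(index_iota 0 d) bin2_sum bin2.
    by rewrite (_ : (d * d.-1 = (T + T.-1 * d).*2)%N) ?doubleK //; nia.
  have -> : t *+ (T + T.-1 * d) = t *+ T by rewrite mulrnDr mulrnA mulrnAC td mul0rn addr0.
  rewrite [_ - _]addrC addrA subrr add0r.
  by move/eqP; rewrite (negPf bd).
(* For [m != T] the points [m t] and [- m t] differ, and the value at [m t] gives [psi m]. Then
   [psi T] and [c] are read off the two components. *)
have psi0 m : (0 < m < d)%N -> m != T -> psi m = 0.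
  move=> hm mT; have := pole_clear_torsion hm; rewrite F0 /cr_eval /= horner0 mulr0 addr0.
  move/esym/eqP; rewrite !mulf_eq0 (negPf (x_prod_fold_neq0 hm)) orbF => /orP[/eqP//|].
  rewrite subr_eq0 => /eqP ye; case/negP: mT.
  have [v1 _] := curve_neq0 (tk hm); have [v2 _] := curve_neq0 (opp_mul_neq0 hm).
  have : t *+ m = Q m by apply: val_inj; rewrite v1 v2 ye /opp_mul xcoordN.
  move/eqP; rewrite -addr_eq0 -mulrnDr => e.
  have [mm|mm|mm] := ltngtP (m + m) d; last by apply/eqP; lia.
    by rewrite (negPf (tk _)) in e; lia.
  have : t *+ (m + m - d) == 0 by rewrite mulrnBr 1?ltnW // td subr0.
  by rewrite (negPf (tk _)); lia.
have sum0 (g : nat -> {poly F}) : \sum_(1 <= l < d) psi l *: g l = psi T *: g T.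
  rewrite (bigD1_seq T) ?iota_uniq //=; last by rewrite mem_index_iota.
  rewrite big_nat_cond big1 ?addr0 // => l /andP[hl lT]; by rewrite psi0 ?scale0r.
have fT : fold_index T = T by rewrite /fold_index leqnn.
have psiT : psi T = 0.
  have /eqP := congr1 (fun g : coordring W => g.2) F0.
  rewrite /= sum0 fT scaler_eq0 => /orP[/eqP//|].
  by rewrite -size_poly_eq0 size_x_prod; lia.
have psi00 m : (0 < m < d)%N -> psi m = 0.
  by move=> hm; have [->//|] := eqVneq m T; apply: psi0.
split=> //; have /eqP := congr1 (fun g : coordring W => g.1) F0.
rewrite /= big_nat_cond big1 ?subr0 => [|l /andP[hl _]]; last by rewrite psi00 // mul0r scale0r.
by rewrite scaler_eq0 -size_poly_eq0 size_x_prod0 orbF => /eqP.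
Qed.
End Free.
End Torsor.

(** * The functions on the torsor form an elliptic system *)

Section Assembly.
Variables (K L : fieldType) (emb : {rmorphism K -> L}).
Hypothesis sepL : separable_closure emb.
Hypothesis K2 : (2%:R : K) != 0.
Variables (W : weierstrass K) (smooth : elliptic W).
Local Notation W' := (map_weierstrass emb W).
Local Notation smooth' := (map_elliptic emb smooth).
Local Notation EK := (curve smooth).
Local Notation E := (curve smooth').
Variables (t : EK) (t' b : E) (T : nat).
Local Notation d := (T + T)%N.
Hypothesis t'E : val t' = map_point emb (val t).
Hypothesis T0 : (0 < T)%N.
Hypothesis dK : (d%:R : K) != 0.
Hypothesis torder : has_order W (val t) d.
Hypothesis bd : b *+ d != 0.
Hypothesis galB : galois_invariant emb (translate W' (val b) (val t') d).
Variable a : K.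
Hypothesis sum_a : sum_u_is W' (val t') d (emb a).

Let td : t' *+ d = 0.
Proof.
have [_ e _] := torder; apply: val_inj.
by rewrite val_curveMn t'E -map_mul_point e.
Qed.

Let tk k : (0 < k < d)%N -> t' *+ k != 0.
Proof.
have [_ _ e] := torder; move=> /e h; apply/eqP => tk0; apply: h.
have := congr1 val tk0; rewrite val_curveMn t'E -map_mul_point.
by case: (mul_point _ _ _).
Qed.

Local Notation P := (orbit_pt t' b).
Local Notation Q := (opp_mul t').
Local Notation D := (dslope t' b).

Let QE k : val (Q k) = map_point emb (val (- (t *+ k))).
Proof. by rewrite /opp_mul !val_curveN !val_curveMn t'E -map_mul_point -map_opp_point. Qed.

Let xQ k : exists c, xcoord (Q k) = emb c.
Proof.
exists (xcoord (- (t *+ k))); rewrite /xcoord QE.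
by case: (val _) => [[x y]|] //=; rewrite rmorph0.
Qed.

Let yQ k : exists c, ycoord (Q k) = emb c.
Proof.
exists (ycoord (- (t *+ k))); rewrite /ycoord QE.
by case: (val _) => [[x y]|] //=; rewrite rmorph0.
Qed.

Let slopeQ (R R' : E) (RK RK' : EK) : val R = map_point emb (val RK) ->
  val R' = map_point emb (val RK') -> exists c, cslope R R' = emb c.
Proof.
move=> e e'; exists (cslope RK RK'); rewrite /cslope map_slope /xcoord /ycoord e e' /=.
by congr (slope W' (_, _) (_, _)); case: (val _) => [[]|] //=; rewrite rmorph0.
Qed.

Definition normalizer : K := (1 - a) / d%:R.
Definition ufam k : L := D 1 k + emb normalizer.
Definition xfam k : L := xcoord (P k).

Let h1 : (0 < 1 < d)%N. Proof. by move: T0; lia. Qed.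

Lemma ul0_orbit l k : ul0 W' (val t') l (val (P k)) = D 1 (k + l).
Proof.
rewrite (dslopeE td tk bd) // /ul0 /ufun /ytr /xtr -!val_curveMn -!val_curveB.
have -> : P k - t' *+ l = P (k + l) by rewrite -orbitD.
by have -> : t' *+ l - t' *+ l.+1 = Q 1 by rewrite mulrSr opprD addrA subrr add0r /opp_mul mulr1n.
Qed.

Lemma ul_orbit l k : ul W' (val t') d (emb a) l (val (P k)) = ufam (k + l).
Proof.
by rewrite /ul ul0_orbit /ufam /normalizer fmorph_div rmorphB rmorph1 rmorph_nat.
Qed.

Lemma xl_orbit l k : xl W' (val t') l (val (P k)) = xfam (k + l).
Proof. by rewrite /xl /xtr -val_curveMn -val_curveB /xfam -orbitD. Qed.

Lemma ufam_per k : ufam (k + d) = ufam k.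
Proof. by rewrite /ufam /dslope (orbit_per b td). Qed.

Lemma xfam_per k : xfam (k + d) = xfam k.
Proof. by rewrite /xfam (orbit_per b td). Qed.

Lemma per_mul (g : nat -> L) (gper : forall k, g (k + d)%N = g k) k m : g (k + m * d)%N = g k.
Proof.
elim: m => [|m IHm]; first by rewrite mul0n addn0.
by rewrite mulSn [(d + m * d)%N]addnC addnA gper.
Qed.

Lemma wsum_dslope c : (0 < c < d)%N -> exists e : K, forall k, wsum ufam c k = D c k + emb e.
Proof.
elim: c => // -[|c] IHc hc.
  by exists normalizer => k; rewrite /wsum big_ord1 addn0.
have [|e eE] := IHc; first by lia.
have [s sE] : exists s, cslope (Q c.+1) (Q 1) = emb s by apply: slopeQ; exact: QE.
exists (e + s + normalizer) => k; rewrite -addn1 wsumD eE addn1.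
have := dslopeS T0 td tk bd k (isT : (0 < c.+1)%N).
have -> : wsum ufam 1 (k + c.+1) = ufam (k + c.+1) by rewrite /wsum big_ord1 addn0.
rewrite /ufam sE => /(_ _) h; have {}h := h ltac:(by lia).
have -> : D 1 (k + c.+1) = emb s + D c.+2 k - D c.+1 k by rewrite -h; ring.
by rewrite !rmorphD; ring.
Qed.

Lemma wsum_ufam k : wsum ufam d k = 1.
Proof.
have Pn : val (P k) \notin multiples W' (val t') d.
  apply/mapP => -[l _]; rewrite -val_curveMn => /val_inj e.
  by have [] := orbit_torsion td bd k l; rewrite e eqxx.
have := sum_a (valP (P k)) Pn; under eq_bigr do rewrite ul0_orbit.
move=> e; rewrite /wsum /ufam big_split /= e sumr_const card_ord -mulr_natr.
by rewrite -(rmorph_nat emb) -rmorphM divfK // -rmorphD addrC subrK rmorph1.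
Qed.

Lemma ufam_mul i j : (0 < i < d)%N -> (0 < j < d)%N -> i != j ->
  exists c0 c1 c2 : K, forall k, wsum ufam i k * wsum ufam j k =
    xfam k + emb c0 + emb c1 * wsum ufam i k + emb c2 * wsum ufam j k.
Proof.
move=> hi hj ij; have [ei eiE] := wsum_dslope hi; have [ej ejE] := wsum_dslope hj.
have [xi xiE] := xQ i; have [xj xjE] := xQ j.
have [s sE] : exists s, cslope (- Q i) (Q j) = emb s.
  apply: (slopeQ (RK := t *+ i)); last exact: QE.
  by rewrite opprK val_curveMn t'E -map_mul_point -val_curveMn.
exists (wa2 W + xi + xj - s * ei + (s + wa1 W) * ej - ei * ej), (s + ej), (ei - (s + wa1 W)) => k.
rewrite !eiE !ejE.
have := dslope_mul T0 td tk bd k hi hj ij; rewrite /= sE xiE xjE => e.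
rewrite mulrDl !mulrDr e /xfam !(rmorphD, rmorphN, rmorphM); ring.
Qed.

Lemma ufam_sqr i : (0 < i < d)%N -> exists c0 c1 : K, forall k,
  wsum ufam i k ^+ 2 = xfam k + xfam (k + i)%N + emb c0 + emb c1 * wsum ufam i k.
Proof.
move=> hi; have [ei eiE] := wsum_dslope hi; have [xi xiE] := xQ i.
exists (wa2 W + xi - ei ^+ 2 + wa1 W * ei), (2%:R * ei - wa1 W) => k.
rewrite !eiE sqrrD (dslope_sqr td tk bd k hi) xiE /xfam.
rewrite !(rmorphD, rmorphN, rmorphM, rmorphXn, rmorph_nat); ring.
Qed.

Lemma ufam_mulX i j : (0 < i)%N -> (i < j < d)%N ->
  exists c0 c1 c2 c3 : K, forall k,
    xfam k * (wsum ufam j k - wsum ufam i k) =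
    emb c0 + emb c1 * xfam k + emb c2 * wsum ufam i k + emb c3 * wsum ufam j k.
Proof.
move=> i0 ij; have hi : (0 < i < d)%N by lia.
have hj : (0 < j < d)%N by lia.
have [ei eiE] := wsum_dslope hi; have [ej ejE] := wsum_dslope hj.
have [xi xiE] := xQ i; have [xj xjE] := xQ j; have [yi yiE] := yQ i; have [yj yjE] := yQ j.
exists (yi - yj + xi * ei - xj * ej), (ej - ei), (- xi), xj => k.
rewrite !eiE !ejE; have li := dslope_line td tk bd k hi; have lj := dslope_line td tk bd k hj.
rewrite xiE yiE in li; rewrite xjE yjE in lj.
transitivity (xfam k * D j k - xfam k * D i k + xfam k * (emb ej - emb ei)); first by ring.
rewrite {1 2}/xfam li lj; rewrite !(rmorphD, rmorphN, rmorphM); ring.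
Qed.

(** [wsum ufam T] is [dslope T] plus a constant, and its values at [k] and [k + T] sum to 1. If one
    is 1/2 so is the other, and [dslope_half] turns this into [2 dslope T k + a1 = 0]. *)
Lemma ufam_half S : (T + T = S + S)%N -> forall k, wsum ufam S k != emb 2%:R^-1.
Proof.
move=> TS k; have -> : S = T by lia.
have hT : (0 < T < d)%N by move: T0; lia.
have [e eE] := wsum_dslope hT; apply: contraNneq (dslope_half_neq0 T0 td tk bd k) => h.
have e1 := wsum_ufam k; rewrite wsumD !eE (dslope_half T0 td tk bd k) in e1.
have eE' := eE k; rewrite h in eE'.
have f2 : emb 2%:R^-1 * 2%:R = 1 by rewrite -(rmorph_nat emb) -rmorphM mulVf // rmorph1.
have -> : 2%:R * D T k + wa1 W' = 2%:R * (D T k + emb e) - (D T k + emb e + (- D T k - wa1 W' + emb e)) by ring.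
by rewrite e1 -eE' mulrC f2 subrr.
Qed.

(** Summation by parts rewrites the relation in terms of the [dslope l], the full sum 1 contributing
    to the constant; [dslope_free] then makes the [e l] equal to each other and zero. The
    coefficients are in L because [xfam_span] solves over L before descending to K. *)
Lemma ufam_free (e : nat -> L) : (forall k, \sum_(l < d) e l * ufam (k + l)%N = 0) ->
  forall l, (l < d)%N -> e l = 0.
Proof.
move=> e0.
have /choice[c cE] l : exists c : K, (0 < l < d)%N -> forall k, wsum ufam l k = D l k + emb c.
  have [hl|] := boolP (0 < l < d)%N; last by exists 0.
  by have [c cE] := wsum_dslope hl; exists c.
pose psi l := e l.-1 - e l.
have parts n k : \sum_(l < n.+1) e l * ufam (k + l)%N =
    e n * wsum ufam n.+1 k + \sum_(1 <= l < n.+1) psi l * wsum ufam l k.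
  elim: n => [|n IHn]; first by rewrite big_ord1 big_geq // addr0 /wsum big_ord1.
  have w : wsum ufam n.+2 k = wsum ufam n.+1 k + ufam (k + n.+1)%N.
    by rewrite /wsum big_ord_recr.
  rewrite big_ord_recr /= IHn [X in _ = _ + X]big_nat_recr //= w /psi /=; ring.
have d1 : d = d.-1.+1 by move: T0; lia.
have [|c0 psi0] := @dslope_free _ _ _ t' b T T0 td tk bd psi (e d.-1 + \sum_(1 <= l < d) psi l * emb (c l)).
  move=> k; have := parts d.-1 k; rewrite -d1 e0 wsum_ufam mulr1 => h; rewrite [RHS]h.
  rewrite -addrA -big_split; congr (_ + _); apply: eq_big_nat => l hl.
  by rewrite /= cE // mulrDr addrC.
have ed l : (l < d)%N -> e l = e d.-1.
  move=> ld; have : (l <= d.-1)%N by lia.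
  move/subnK; move: (d.-1 - l)%N => m; elim: m l ld => [|m IHm] l ld; first by rewrite add0n => ->.
  rewrite addSnnS => em; rewrite -(IHm l.+1) //; last by lia.
  by apply/eqP; rewrite -subr_eq0; apply/eqP/(psi0 l.+1); lia.
have last0 : e d.-1 = 0.
  move: c0; rewrite big_nat_cond big1 ?addr0 // => l /andP[hl _].
  by rewrite psi0 ?mul0r.
by move=> l ld; rewrite ed.
Qed.

(** The automorphism fixes [t] and the equation and sends [b] to some [b + l t], so [b - k t] goes
    to the point of index [k - l], written [k + (d - l)]. *)
Lemma ufam_galois (s : {rmorphism L -> L}) : galois_aut emb s ->
  exists j, forall k, s (ufam k) = ufam (k + j)%N /\ s (xfam k) = xfam (k + j)%N.
Proof.
move=> gs; have [sbij sE] := gs.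
have sW : map_weierstrass s W' = W' by rewrite /map_weierstrass /= !sE.
have smap R : map_point s (map_point emb R) = map_point emb R.
  by case: R => [[x y]|] //=; rewrite !sE.
have : map_point s (val b) \in translate W' (val b) (val t') d.
  rewrite -(galB gs); apply/map_f/mapP; exists 0%N; first by rewrite mem_iota; lia.
  by rewrite -val_curveMn -val_curveD addr0.
case/mapP => l; rewrite mem_iota => ld; rewrite -val_curveMn -val_curveD => sb.
exists (d - l)%N.
have sQ k : map_point s (val (Q k)) = val (Q k) by rewrite QE smap.
have sP k : map_point s (val (P k)) = val (P (k + (d - l))).
  rewrite val_curveD map_add_point sW sb sQ -val_curveD; congr val.
  by rewrite -orbitD opp_mulN ?addrA //; [rewrite addrAC|lia].
move=> k; split; last first.
  by rewrite /xfam /xcoord -sP; case: (val (P k)) => [[x y]|] //=; rewrite rmorph0.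
have coordE (R R' : E) : map_point s (val R) = val R' ->
    (s (xcoord R), s (ycoord R)) = (xcoord R', ycoord R').
  rewrite /xcoord /ycoord => <-; by case: (val R) => [[x y]|] //=; rewrite rmorph0.
rewrite /ufam rmorphD sE; congr (_ + _).
rewrite /dslope /cslope map_slope sW /=.
by rewrite (coordE _ _ (sP k)) (coordE _ _ (sQ 1%N)).
Qed.

Lemma ufam_mod k l : ufam (k %% d + l) = ufam (k + l).
Proof.
rewrite -(per_mul ufam_per _ (k %/ d)); congr ufam.
by rewrite [in RHS](divn_eq k d); lia.
Qed.

Lemma xfam_mod k : xfam (k %% d) = xfam k.
Proof.
rewrite -(per_mul xfam_per _ (k %/ d)); congr xfam.
by rewrite [in RHS](divn_eq k d); lia.
Qed.

Lemma xfam_span : exists xi : nat -> K, forall k,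
  xfam k = \sum_(l < d) emb (xi l) * ufam (k + l)%N.
Proof.
pose M : 'M[L]_d := \matrix_(i, j) ufam (i + j).
have Mu : M \in unitmx.
  rewrite -row_free_unit; apply: inj_row_free => v vM.
  have v0 : forall l, (l < d)%N -> (fun l => oapp (v 0) 0 (insub l)) l = 0.
    apply: ufam_free => k.
    have kd : (k %% d < d)%N by rewrite ltn_mod; move: T0; lia.
    have := congr1 (fun u : 'rV_d => u 0 (Ordinal kd)) vM; rewrite !mxE => h; rewrite -[RHS]h.
    apply: eq_bigr => l _; rewrite valK /= mxE /=; congr (_ * _).
    by rewrite -ufam_mod addnC.
  by apply/rowP => l; have := v0 l (ltn_ord l); rewrite valK /= mxE.
pose phi := (\row_(k < d) xfam k) *m invmx M.
pose phi' l := oapp (phi 0) 0 (insub l : option 'I_d).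
have phiE k : xfam k = \sum_(l < d) phi' l * ufam (k + l)%N.
  have kd : (k %% d < d)%N by rewrite ltn_mod; move: T0; lia.
  have : phi *m M = \row_(k < d) xfam k by rewrite mulmxKV.
  move=> /(congr1 (fun u : 'rV_d => u 0 (Ordinal kd))); rewrite !mxE /= => e.
  rewrite -xfam_mod -e; apply: eq_bigr => l _; rewrite /phi' valK /= mxE /=; congr (_ * _).
  by rewrite mxE /= -[in RHS]ufam_mod [(l + _)%N]addnC.
(* Conjugating the expansion gives an expansion of a shift of [xfam], with the same coefficients by
   uniqueness; they are thus fixed by every automorphism. *)
have phiK l : (l < d)%N -> exists c, phi' l = emb c.
  move=> ld; apply: galois_fixed; [exact: sepL.1|exact: sepL.2|] => s gs.
  have [j jE] := ufam_galois gs; apply/eqP; rewrite -subr_eq0; apply/eqP.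
  apply: (@ufam_free (fun l => s (phi' l) - phi' l)) ld => k.
  (* The index [k - j] modulo [d], kept in the natural numbers. *)
  have dj : (k + (j * d - j) + j = k + j * d)%N by move: T0; nia.
  have perm i : ufam (k + (j * d - j) + i + j) = ufam (k + i).
    by rewrite addnAC dj addnAC per_mul //; exact: ufam_per.
  transitivity (s (xfam (k + (j * d - j))) - xfam (k + (j * d - j) + j)); last first.
    by have [_ ->] := jE (k + (j * d - j))%N; rewrite subrr.
  rewrite (phiE (k + (j * d - j))%N) (phiE (k + (j * d - j) + j)%N) rmorph_sum -sumrB.
  apply: eq_bigr => i _; rewrite rmorphM; have [-> _] := jE (k + (j * d - j) + i)%N.
  by rewrite [(_ + j + i)%N]addnAC perm mulrBl.
have /choice[xi xiE] l : exists c, (l < d)%N -> phi' l = emb c.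
  by have [ld|] := boolP (l < d)%N; [have [c cE] := phiK l ld; exists c|exists 0].
by exists xi => k; rewrite phiE; apply: eq_bigr => l _; rewrite xiE.
Qed.

Lemma ufam_ellsys : ellsys emb d ufam xfam.
Proof.
split; [by move: T0; lia|exact: ufam_per|exact: xfam_per|exact: wsum_ufam| |exact: xfam_span
  |exact: ufam_mul|exact: ufam_sqr|exact: ufam_mulX|exact: ufam_half].
move=> e e0 l ld; apply/eqP; rewrite -(fmorph_eq0 emb); apply/eqP.
exact: (@ufam_free (fun l => emb (e l))).
Qed.

End Assembly.

(** * From computations to programs, and the conclusion *)

Lemma slp_of_computes (K : fieldType) (n cost : nat) (g : nat -> ('I_n -> K) -> K) :
  computes cost (fn_family n (fun i inp => oapp inp 0 (insub i : option 'I_n))) (fn_family n g) ->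
  exists S : slp K n n, (slp_complexity S <= cost)%N /\
    forall inp (j : 'I_n), slp_eval S inp j = g j inp.
Proof.
move=> comp.
have [|h [i ilt ->]|c [sc okc av]] := comp [::] => //.
  exists (Reg i); first by rewrite /= addn0.
  move=> inp; rewrite /run /= (nth_map (Ordinal ilt)) ?size_enum_ord //.
  by rewrite insubT /=; congr inp; apply: val_inj; rewrite /= nth_enum_ord.
have out (j : 'I_n) : available c (g j) by apply: av; exists j.
pose o (j : 'I_n) := s2val (cid2 (out j)).
have oP (j : 'I_n) : operand_ok (n + size c) (o j) by rewrite /o; case: cid2.
exists (Slp okc oP); split=> // inp j.
by rewrite /slp_eval /= /o; case: cid2 => /= o' _ ->.
Qed.

Theorem proposition5 (R : realType) :
  exists Q : R, 0 < Q /\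
  forall (K : fieldType) (p : nat), p \in [pchar K] -> odd p ->
  forall W : weierstrass K, elliptic W ->
  forall (Ks : fieldType) (emb : {rmorphism K -> Ks}),
    separable_closure emb ->
  forall delta : nat, (1 <= delta)%N ->
  let d := (2 ^ delta)%N in
  forall t : point K, on_curve W t -> has_order W t d ->
  let E := map_weierstrass emb W in
  let ts := map_point emb t in
  forall b : point Ks, on_curve E b -> mul_point E d b <> None ->
  galois_invariant emb (translate E b ts d) ->
  forall a : K, sum_u_is E ts d (emb a) ->
  exists S : slp K d d,
    (slp_complexity S)%:R <= Q * d%:R * ln (d%:R : R) /\
    forall F : 'I_d -> K,
    let f := slp_eval S F in
    forall k : 'I_d,
    let P := add_point E b (mul_point E k ts) in
    \sum_(l < d) emb (f l) * ul E ts d (emb a) l P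
      = \sum_(l < d) emb (F l) * xl E ts l P.
Proof.
have ln2 : 0 < ln (2%:R : R) by rewrite ln_gt0 // ltr1n.
(* Here [ln d = delta * ln 2], and [13 * delta + 1 <= 14 * delta] as [delta >= 1]. *)
exists (14%:R / ln 2%:R); split; first by rewrite divr_gt0.
move=> K p pK oddp W sm Ks emb sep delta d1 d t ont ord E ts b onb db gal a suma.
have K2 : (2%:R : K) != 0.
  rewrite -(dvdn_pcharf pK); apply/negP => /dvdn_leq p2.
  have := pcharf_prime pK; case: p pK oddp p2 => [|[|[|p]]] // _ _ p2.
  by have := p2 isT.
pose T := (2 ^ delta.-1)%N.
have dE : d = (T + T)%N by rewrite /d -(prednK d1) expnS mul2n addnn.
have T0 : (0 < T)%N by rewrite expn_gt0.
have dK : (d%:R : K) != 0 by rewrite natrX expf_neq0.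
pose sm' := map_elliptic emb sm.
have onts : on_curve E ts by rewrite map_on_curve.
pose tK : curve sm := exist _ t ont.
pose tS : curve sm' := exist _ ts onts.
pose bS : curve sm' := exist _ b onb.
have bd : bS *+ d != 0 by apply/eqP => /(congr1 val); rewrite val_curveMn.
have sys : ellsys emb d (ufam tS bS T a) (xfam tS bS).
  rewrite dE; apply: (@ufam_ellsys _ _ emb sep K2 W sm tK tS bS T); rewrite -?dE //.
have [rho [rhoE rhoC]] := reducible_pow2 K2 sys.
pose input (i : nat) (inp : 'I_d -> K) := oapp inp 0 (insub i : option 'I_d).
have [S [szS evS]] := slp_of_computes (rhoC d input _ (in_fn_family input)).
exists S; split.
  have -> : ln (d%:R : R) = delta%:R * ln 2%:R by rewrite natrX lnXn // mulr_natl.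
  have -> : 14%:R / ln 2%:R * d%:R * (delta%:R * ln 2%:R) = (14 * d * delta)%:R :> R.
    by rewrite !natrM; move: (d%:R : R) => D; field; rewrite gt_eqF.
  rewrite ler_nat (leq_trans szS) //.
  by move: (d1); rewrite -/d; move: (d) => D; nia.
(* [orbit_pt] subtracts multiples of [t], so [b + k t] has index [d - k]. *)
move=> F f k P; pose k' := (d - k)%N.
have td : tS *+ d = 0.
  by case: ord => _ e _; apply: val_inj; rewrite val_curveMn -map_mul_point e.
have PE : P = val (orbit_pt tS bS k').
  have -> : P = val (bS + tS *+ k) by rewrite val_curveD val_curveMn.
  by rewrite /orbit_pt mulrnBr 1?ltnW // td sub0r opprK.
have ulE (i : nat) : ul E ts d (emb a) i (val (orbit_pt tS bS k')) = ufam tS bS T a (k' + i)%N.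
  have tE : val tS = map_point emb (val tK) by [].
  by rewrite dE; apply: (ul_orbit K2 tE); rewrite -?dE.
transitivity (\sum_(l < d) emb (f l) * ufam tS bS T a (k' + l)%N).
  by apply: eq_bigr => l _; rewrite PE ulE.
rewrite (eq_bigr (fun l : 'I_d => emb (rho (fun i => oapp F 0 (insub i : option 'I_d)) l) * ufam tS bS T a (k' + l)%N)); last first.
  by move=> l _; rewrite /f evS.
rewrite rhoE; apply: eq_bigr => l _; rewrite valK PE; congr (_ * _).
by apply/esym/xl_orbit.
Qed.
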